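(* There is no rational polynomial map $f\colon\mathbb{C}^2\to\mathbb{C}$ with irreducible fibres which is not a coordinate. That is, if $f\colon\mathbb{C}^2\to\mathbb{C}$ is a rational polynomial map such that every fibre $f^{-1}(a)$, $a\in\mathbb{C}$, is irreducible, then $f$ is a coordinate.
   Context: A polynomial map $f\colon\mathbb{C}^2\to\mathbb{C}$ is called a coordinate if there is a polynomial $g\colon\mathbb{C}^2\to\mathbb{C}$ such that $(f,g)\colon\mathbb{C}^2\to\mathbb{C}^2$ is a polynomial automorphism (i.e. a polynomial map with polynomial inverse). A polynomial map $f\colon\mathbb{C}^2\to\mathbb{C}$ is called rational if its general fibres (the fibres $f^{-1}(a)$ for all but finitely many $a\in\mathbb{C}$) are rational curves. A fibre $f^{-1}(a)$ is irreducible if it has exactly one irreducible component. *)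

(* Defs.v *)
From mathcomp Require Import all_boot all_order all_algebra.
From mathcomp Require Import boolp classical_sets cardinality reals.
From mathcomp Require Import complex mpoly.
Set Implicit Arguments.
Unset Strict Implicit.
Unset Printing Implicit Defensive.
Import GRing.Theory.
Local Open Scope ring_scope.
Local Open Scope classical_set_scope.

Section AffineVarieties.
Variable K : fieldType.

(* Points of affine n-space are row vectors v; v 0 : 'I_n -> K gives the
   coordinates at which polynomials are evaluated. *)
Definition zero_locus n (S : set {mpoly K[n]}) : set 'rV[K]_n :=
  [set v | forall p, S p -> p.@[v 0] = 0].

Definition zariski_closed n (Z : set 'rV[K]_n) : Prop :=
  exists S : set {mpoly K[n]}, Z = zero_locus S.

(* Topological irreducibility for the Zariski topology induced on X; the empty
   set is not irreducible. *)
Definition zariski_irreducible n (X : set 'rV[K]_n) : Prop :=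
  X !=set0 /\
  forall Z1 Z2, zariski_closed Z1 -> zariski_closed Z2 ->
    X `<=` Z1 `|` Z2 -> X `<=` Z1 \/ X `<=` Z2.

Definition irreducible_component n (X Z : set 'rV[K]_n) : Prop :=
  [/\ Z `<=` X, zariski_irreducible Z &
      forall Y, zariski_irreducible Y -> Z `<=` Y -> Y `<=` X -> Y = Z].

Definition affine_variety n (X : set 'rV[K]_n) : Prop :=
  zariski_closed X /\ zariski_irreducible X.

Definition open_in n (X U : set 'rV[K]_n) : Prop :=
  exists2 Z, zariski_closed Z & U = X `\` Z.

(* h is locally on U a quotient of polynomials; h is total, but its values
   outside U play no role. *)
Definition regular_on n (U : set 'rV[K]_n) (h : 'rV[K]_n -> K) : Prop :=
  forall u, U u -> exists p q : {mpoly K[n]}, q.@[u 0] != 0 /\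
    forall v, U v -> q.@[v 0] != 0 -> h v = p.@[v 0] / q.@[v 0].

Definition regular_map_on n m (U : set 'rV[K]_n) (phi : 'rV[K]_n -> 'rV[K]_m)
    : Prop :=
  forall j, regular_on U (fun v => phi v 0 j).

(* Birational equivalence of X and Y: some nonempty Zariski open subsets of X
   and Y are isomorphic. *)
Definition birational n m (X : set 'rV[K]_n) (Y : set 'rV[K]_m) : Prop :=
  exists (U : set 'rV[K]_n) (V : set 'rV[K]_m)
         (phi : 'rV[K]_n -> 'rV[K]_m) (psi : 'rV[K]_m -> 'rV[K]_n),
    [/\ open_in X U /\ U !=set0,
        open_in Y V /\ V !=set0,
        regular_map_on U phi /\ regular_map_on V psi,
        (forall u, U u -> V (phi u) /\ psi (phi u) = u) &
        (forall v, V v -> U (psi v) /\ phi (psi v) = v)].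

(* Irreducible, and birational to the line; the affine line [set: 'rV[K]_1] is
   an open subset of the projective one. *)
Definition rational_curve n (X : set 'rV[K]_n) : Prop :=
  affine_variety X /\ birational X [set: 'rV[K]_1].

Definition polynomial_map n m (F : 'I_m -> {mpoly K[n]}) (v : 'rV[K]_n)
    : 'rV[K]_m :=
  \row_i (F i).@[v 0].

(* The inverse is taken on points, which agrees with the formal inverse when K
   is infinite. *)
Definition polynomial_automorphism n (F : 'I_n -> {mpoly K[n]}) : Prop :=
  exists G : 'I_n -> {mpoly K[n]},
    cancel (polynomial_map F) (polynomial_map G) /\
    cancel (polynomial_map G) (polynomial_map F).

Definition coordinate (f : {mpoly K[2]}) : Prop :=
  exists g : {mpoly K[2]},
    polynomial_automorphism (fun i : 'I_2 => if i == 0 then f else g).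

Definition fibre (f : {mpoly K[2]}) (a : K) : set 'rV[K]_2 :=
  [set v | f.@[v 0] = a].

Definition rational_polynomial (f : {mpoly K[2]}) : Prop :=
  finite_set [set a | ~ rational_curve (fibre f a)].

(* Set-theoretic: multiplicities are ignored. *)
Definition irreducible_fibre (f : {mpoly K[2]}) (a : K) : Prop :=
  exists! Z, irreducible_component (fibre f a) Z.

End AffineVarieties.

(* Main.v *)
(* All f - a are irreducible as polynomials: otherwise f - a = c p^n with
   n > 1, and the neighbouring fibre c p^n = 1 would be reducible. Choose a
   rational fibre f = a with a transcendental over the field of coefficients of
   f, and a maximal field k containing these coefficients over which a remains
   transcendental; then k is algebraically closed and C is algebraic over k(a).
   A parametrization X, Y of the fibre embeds M = k(x, y) in C(s), with f mapped
   to a, and the subfields M and C generate C(s). By Galois descent, the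
   three-dimensional space of vector fields (q0 + q1 s + q2 s^2) d/ds has a basis
   defined over M; its members satisfy a quadratic relation, which descends to
   k(a). By Tsen's theorem the conic has a point over k(a), and projecting from
   it gives t with k(x, y) = k(f, t). Irreducibility of the fibres allows one to
   replace t by a polynomial u, and division of u - c by f - b as long as
   possible leads to k[x, y] = k[f, u]. *)
Require Import Defs.
From HB Require Import structures.
From mathcomp Require Import all_boot all_order all_algebra.
From mathcomp Require Import separable.
From mathcomp Require Import boolp classical_sets cardinality reals.
From mathcomp Require Import complex mpoly.
From mathcomp Require Import ring lra zify.
Set Implicit Arguments.
Unset Strict Implicit.
Unset Printing Implicit Defensive.
Import Order.TTheory GRing.Theory Num.Theory.
Local Open Scope ring_scope.

(** * Factorization of polynomials in two variables *)

(** Only closed fibres are known to be rational. A value a transcendental over k makes k(a) a copy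
    of k(f), and the closed fibre over a is then the generic fibre of f with scalars extended from
    k(a) to C; the injectivity of k[x, y] -> C(s) expresses this. Such an a exists because C is
    uncountable: it has to avoid only the numbers algebraic over the coefficients and finitely many
    exceptional values. Maximality of k serves twice: Tsen's theorem needs k algebraically closed,
    descent needs C algebraic over k(a). The generic fibre is a form of the projective line over
    k(a), a priori a conic without a point. The fields Q(s) d/ds with deg Q at most 2 are the global
    vector fields of the line, hence independent of the parameter, and the quadratic relation
    between three of them is the equation of the anticanonical embedding. No Galois group is formed:
    conjugation replaces a primitive element z by the other roots of its minimal polynomial over M,
    and descent is Lagrange interpolation at these roots. *)

Definition alg_closed (F : fieldType) :=
  forall p : {poly F}, size p != 1%N -> exists x, root p x.

Section Bivariate.
Variable F : fieldType.
Hypothesis Fcl : alg_closed F.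
Local Notation P2 := {poly {poly F}}.

(* Elements of P2 are polynomials in the inner variable x and the outer
   variable y; deg2 is the sum of the degrees in x and in y. *)
Definition dvd2 (d p : P2) := exists q, p = q * d.

Definition deg2 (p : P2) := ((size p).-1 + (size (swapXY p)).-1)%N.

(* Constants, including 0, have deg2 equal to 0. *)
Definition irr2 (p : P2) :=
  deg2 p != 0%N /\ forall a b, p = a * b -> deg2 a = 0%N \/ deg2 b = 0%N.

Lemma deg2M p q : p != 0 -> q != 0 -> deg2 (p * q) = (deg2 p + deg2 q)%N.
Proof.
move=> p0 q0; rewrite /deg2 rmorphM /= !size_mul ?swapXY_eq0 //.
have := size_poly_gt0 p; have := size_poly_gt0 q; rewrite p0 q0.
have := size_poly_gt0 (swapXY p); have := size_poly_gt0 (swapXY q).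
rewrite !swapXY_eq0 p0 q0.
case: (size p) => // a; case: (size q) => // b.
case: (size (swapXY p)) => // c; case: (size (swapXY q)) => // d _ _ _ _.
by rewrite /= !addnS /= addnACA.
Qed.

Lemma deg2_eq0P p : deg2 p = 0%N -> p = (p`_0`_0)%:P%:P.
Proof.
move=> /eqP; rewrite addn_eq0 => /andP[].
rewrite -[_ == 0%N]negbK -lt0n -ltnS => h1 h2.
have s1 : (size p <= 1)%N by move: h1; case: (size p) => [|[]].
have s2 : (size (swapXY p) <= 1)%N by move: h2; case: (size (swapXY p)) => [|[]].
rewrite [LHS](size1_polyC s1); congr _%:P; apply: size1_polyC.
apply: leq_trans s2; rewrite -sizeYE; exact: max_size_coefXY.
Qed.

Lemma deg2C c : deg2 c%:P%:P = 0%N.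
Proof.
rewrite /deg2 swapXY_polyC map_polyC !size_polyC.
by case: (c != 0); rewrite ?size_polyC /= ?polyC1 ?polyC0; case: eqP.
Qed.

Lemma deg2_neq0 p : deg2 p != 0%N -> p != 0.
Proof. by apply: contraNneq => ->; rewrite -!polyC0 deg2C. Qed.

Lemma irr2_neq0 p : irr2 p -> p != 0.
Proof. by case=> /deg2_neq0. Qed.

Lemma dvd2_refl p : dvd2 p p.
Proof. by exists 1; rewrite mul1r. Qed.

Lemma dvd2_trans q p r : dvd2 p q -> dvd2 q r -> dvd2 p r.
Proof. by move=> [a ->] [b ->]; exists (b * a); rewrite mulrA. Qed.

Lemma dvd2_mull d p q : dvd2 d q -> dvd2 d (p * q).
Proof. by move=> [a ->]; exists (p * a); rewrite mulrA. Qed.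

Lemma dvd2_mulr d p q : dvd2 d p -> dvd2 d (p * q).
Proof. by rewrite mulrC; apply: dvd2_mull. Qed.

Lemma dvd2D d p q : dvd2 d p -> dvd2 d q -> dvd2 d (p + q).
Proof. by move=> [a ->] [b ->]; exists (a + b); rewrite mulrDl. Qed.

Lemma dvd2B d p q : dvd2 d p -> dvd2 d q -> dvd2 d (p - q).
Proof. by move=> [a ->] [b ->]; exists (a - b); rewrite mulrBl. Qed.

Lemma dvd2_const d p c : c != 0 -> dvd2 d (c%:P%:P * p) -> dvd2 d p.
Proof.
move=> c0 [q hq]; exists (c^-1%:P%:P * q).
by rewrite -mulrA -hq mulrA -!polyCM mulVf // mul1r.
Qed.

Lemma irr_factor p : deg2 p != 0%N -> exists2 q, irr2 q & dvd2 q p.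
Proof.
have [n] := ubnP (deg2 p); elim: n p => // n IH p hn p0.
have [irr|nirr] := pselect (irr2 p); first by exists p => //; exact: dvd2_refl.
have [a [b [pE a0 b0]]] : exists a b, [/\ p = a * b, deg2 a != 0%N & deg2 b != 0%N].
  apply: contrapT => hne; apply: nirr; split=> // a b pE.
  have [|a0] := eqVneq (deg2 a) 0%N; first by left.
  have [|b0] := eqVneq (deg2 b) 0%N; first by right.
  by case: hne; exists a, b.
have ltap : (deg2 a < n)%N.
  rewrite -ltnS; apply: leq_trans hn; rewrite ltnS pE deg2M ?deg2_neq0 //.
  by rewrite -[X in (X < _)%N]addn0 ltn_add2l lt0n.
have [q irq qa] := IH a ltap a0; exists q => //.
by rewrite {1}pE; exact: dvd2_mulr.
Qed.

(** Reduction modulo x - c. Its target is a domain and its kernel consists of the multiples of x -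
    c, so x - c is prime; the cancellation of linear factors rests on this. *)
Definition redx c : P2 -> {poly F} := map_poly (horner_eval c).
HB.instance Definition _ c := GRing.RMorphism.on (redx c).

Lemma redxC c p : redx c p%:P = p.[c]%:P.
Proof. by rewrite /redx map_polyC. Qed.

Lemma redx_eq0 c p : redx c p = 0 -> exists q, p = ('X - c%:P)%:P * q.
Proof.
move=> h; exists (map_poly (fun a => a %/ ('X - c%:P)) p).
apply/polyP => i; rewrite coefCM coef_map_id0 ?div0p //.
have /polyP/(_ i) := h; rewrite coef_map coef0 /= /horner_eval => hi.
by rewrite mulrC divpK // dvdp_XsubCl; apply/rootP.
Qed.

Lemma redx_lin c (q : P2) : redx c (('X - c%:P)%:P * q) = 0.
Proof. by rewrite rmorphM /= redxC hornerXsubC subrr mul0r. Qed.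

Lemma lin_neq0 (c : F) : ('X - c%:P)%:P != 0 :> P2.
Proof. by rewrite polyC_eq0 polyXsubC_eq0. Qed.

(** Stands in for factorization in F[x]: a claim about nonzero polynomials in x is reduced to one
    linear factor at a time. *)
Lemma poly_root_ind (P : {poly F} -> Prop) :
  (forall c, c != 0 -> P c%:P) ->
  (forall c p, p != 0 -> P p -> P (('X - c%:P) * p)) ->
  forall p, p != 0 -> P p.
Proof.
move=> P0 PS p; have [n] := ubnP (size p); elim: n p => // n IH p hn p0.
have [/eqP/size_poly1P[c c0 ->]|s1] := eqVneq (size p) 1%N; first exact: P0.
have [c /factor_theorem [q pE]] := Fcl s1.
have q0 : q != 0 by apply: contraNneq p0 => q0; rewrite pE q0 mul0r.
rewrite pE mulrC; apply: PS => //; apply: IH => //.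
by rewrite -ltnS (leq_trans _ hn) // pE size_Mmonic ?monicXsubC // size_XsubC addn2.
Qed.

(* Gauss's lemma; as F is algebraically closed it suffices to cancel
   linear factors. *)
Lemma irr_cancel p (r : {poly F}) h :
  irr2 p -> (1 < size p)%N -> r != 0 -> dvd2 p (r%:P * h) -> dvd2 p h.
Proof.
move=> irp sp r0; move: r r0 h.
apply: (poly_root_ind (P := fun r => forall h, dvd2 p (r%:P * h) -> dvd2 p h)).
  by move=> c c0 h; exact: dvd2_const.
move=> c r r0 IH h [w hw]; apply: IH.
have /eqP := congr1 (redx c) hw; rewrite polyCM -mulrA redx_lin rmorphM /=.
rewrite eq_sym mulf_eq0 => /orP[] /eqP/redx_eq0[q qE].
  exists q; apply: (mulfI (lin_neq0 c)).
  by rewrite mulrA -polyCM hw qE mulrA.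
case: irp => dp /(_ _ _ qE) [].
  rewrite /deg2 swapXY_polyC !size_map_polyC size_XsubC addn1 //.
by move=> /deg2_eq0P q0; move: sp; rewrite qE q0 -polyCM size_polyC; case: (_ == 0).
Qed.

(** The form of Gauss's lemma needed after pseudo-division: each linear factor of r is prime, so it
    divides d or e and is moved from there into [al] or [be]. *)
Lemma gauss_split p (r : {poly F}) d e : r != 0 -> p != 0 -> r%:P * p = d * e ->
  exists d' e' (al be : {poly F}),
    [/\ p = d' * e', al != 0, be != 0, d = al%:P * d' & e = be%:P * e'].
Proof.
move=> r0; move: r r0 d e.
apply: (poly_root_ind (P := fun r => forall d e, p != 0 -> r%:P * p = d * e -> _)).
  move=> c c0 d e p0 h; exists (c^-1%:P%:P * d), e, c%:P, 1.
  rewrite !mulrA -polyCM -[X in X%:P * d]polyCM divff // !mul1r oner_neq0 polyC_eq0 c0.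
  by split=> //; rewrite -mulrA -h mulrA -!polyCM mulVf // mul1r.
move=> c r r0 IH d e p0 h.
have /eqP := congr1 (redx c) h; rewrite polyCM -mulrA redx_lin rmorphM /=.
have X0 := polyXsubC_eq0 c.
rewrite eq_sym mulf_eq0 => /orP[] /eqP/redx_eq0[q qE].
  have {}h : r%:P * p = q * e.
    by apply: (mulfI (lin_neq0 c)); rewrite mulrA -polyCM h qE mulrA.
  have [d' [e' [al [be [h1 h2 h3 h4 h5]]]]] := IH _ _ p0 h.
  exists d', e', (('X - c%:P) * al), be; split=> //; first by rewrite mulf_neq0 // X0.
  by rewrite qE h4 mulrA polyCM.
have {}h : r%:P * p = d * q.
  by apply: (mulfI (lin_neq0 c)); rewrite mulrA -polyCM h qE mulrCA.
have [d' [e' [al [be [h1 h2 h3 h4 h5]]]]] := IH _ _ p0 h.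
exists d', e', al, (('X - c%:P) * be); split=> //; first by rewrite mulf_neq0 // X0.
by rewrite qE h5 mulrA polyCM.
Qed.

(** Elimination of y. If p involves y, then p and g are coprime over F(x), and a Bezout relation
    cleared of denominators leaves a polynomial in x; otherwise p itself is one. *)
Lemma irr_bezout p (g : P2) : irr2 p -> ~ dvd2 p g ->
  exists r u v, r != 0 /\ u * p + v * g = r%:P.
Proof.
move=> irp npg; have p0 := irr2_neq0 irp.
have [sp|sp] := leqP (size p) 1.
  have pC := size1_polyC sp; exists p`_0, 1, 0.
  by rewrite mul1r mul0r addr0 -pC -polyC_eq0 -pC.
have [|ncop] := boolP (coprimep p g).
  case/Bezout_coprimepP => -[u v] /=; rewrite -size_poly_eq1 => /size_poly1P[r r0 rE].
  by exists r, u, v.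
case: npg; have := dvdp_gcdl p g; have := dvdp_gcdr p g.
move: (gcdp_eq0 p g) ncop; rewrite coprimep_def (negbTE p0) /=.
move: (gcdp p g) => d d0 sd.
rewrite !Pdiv.WeakIdomain.dvdp_eq => /eqP h2 /eqP h1.
move: (Pdiv.WeakIdomain.lc_expn_scalp_neq0 p d).
move: (Pdiv.WeakIdomain.lc_expn_scalp_neq0 g d) h1 h2.
(* r1 and r2 are the powers of the leading coefficient of d, polynomials in x, introduced by
   pseudo-division. By Gauss, d is a divisor d' of p times a factor in x; as d' involves y, it is p
   up to a scalar, so p divides g. *)
move: (_ ^+ _) (_ ^+ _) => r2 r1 r20 h1 h2 r10; move: h1 h2; rewrite -!mul_polyC => h1 h2.
have [e' [d' [al [be [h3 h4 h5 h6 h7]]]]] := gauss_split r10 p0 h1.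
have d'0 : (1 < size d')%N.
  have : size d = size d' by rewrite h7 mul_polyC size_scale.
  have : size d != 0%N by rewrite size_poly_eq0 d0.
  by move: sd; case: (size d) => [|[]] // n _ _ <-.
case: (irp.2 _ _ h3) => [/deg2_eq0P ec|dd]; last first.
  by move: d'0; rewrite (deg2_eq0P dd) size_polyC; case: (_ == 0).
set a := _`_0 in ec.
have a0 : a != 0 by apply: contraNneq p0 => a0; rewrite h3 ec a0 !polyC0 mul0r.
apply: (irr_cancel irp sp r20); rewrite h2 h7.
apply/dvd2_mull/dvd2_mull; exists a^-1%:P%:P.
by rewrite h3 ec mulrA -!polyCM mulVf // mul1r.
Qed.

Lemma irr_prime p (g h : P2) : irr2 p -> dvd2 p (g * h) -> dvd2 p g \/ dvd2 p h.
Proof.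
move=> irp pgh; have p0 := irr2_neq0 irp.
(* A p without y is a scalar multiple of some x - c, and [redx] applies directly; [irr_cancel] needs
   positive degree in y. *)
have [sp|sp] := leqP (size p) 1.
  have [c rc] : exists c, root p`_0 c.
    apply: Fcl; apply/negP => /size_poly1P[c c0 pc]; case: irp.
    by rewrite (size1_polyC sp) pc deg2C.
  have [q qE] : exists q, p = ('X - c%:P)%:P * q.
    by apply: redx_eq0; rewrite (size1_polyC sp) redxC (rootP rc).
  have [] := irp.2 _ _ qE.
    by rewrite /deg2 swapXY_polyC !size_map_polyC size_XsubC addn1.
  move=> /deg2_eq0P qc; set a := _`_0 in qc.
  have a0 : a != 0 by apply: contraNneq p0 => a0; rewrite qE qc a0 !polyC0 mulr0.
  have dvdE (u : P2) : redx c u = 0 -> dvd2 p u.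
    move=> /redx_eq0[v ->]; exists (a^-1%:P%:P * v).
    by rewrite [RHS]mulrC qE qc -mulrA [a%:P%:P * _]mulrA -!polyCM divff // mul1r.
  case: pgh => w hw.
  have /eqP := congr1 (redx c) hw.
  rewrite {1}qE mulrCA redx_lin rmorphM /=.
  by rewrite mulf_eq0 => /orP[] /eqP/dvdE ?; [left|right].
have [pg|npg] := pselect (dvd2 p g); [by left|right].
have [r [u [v [r0 rE]]]] := irr_bezout irp npg.
apply: (irr_cancel irp sp r0); rewrite -rE mulrDl; apply: dvd2D.
  by rewrite mulrAC; apply/dvd2_mull/dvd2_refl.
by rewrite -mulrA; apply: dvd2_mull.
Qed.

Lemma irr_ndvd_const p c : irr2 p -> c != 0 -> ~ dvd2 p c%:P%:P.
Proof.
move=> irp c0 [q h]; have := deg2C c; rewrite h.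
have q0 : q != 0.
  apply: contraNneq c0 => q0; move: h; rewrite q0 mul0r => /eqP.
  by rewrite !polyC_eq0.
rewrite deg2M ?(irr2_neq0 irp) // => /eqP; rewrite addn_eq0 => /andP[_].
by rewrite (negbTE irp.1).
Qed.

Lemma irr_primeX p g n : irr2 p -> dvd2 p (g ^+ n) -> dvd2 p g.
Proof.
move=> irp; elim: n => [|n IH].
  by rewrite expr0 -!polyC1 => /(irr_ndvd_const irp (oner_neq0 _)).
by rewrite exprS => /(irr_prime irp)[].
Qed.

End Bivariate.

Section Evaluation.
Variables (k A : comNzRingType) (rho : {rmorphism k -> A}) (x y : A).

(** The inner variable is sent to x, the outer one to y. Values at points, substitution of
    polynomials and the embedding of k[x, y] in a function field are all instances. *)
Definition ev2 : {poly {poly k}} -> A :=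
  horner_eval y \o map_poly (horner_eval x \o map_poly rho).
HB.instance Definition _ := GRing.RMorphism.on ev2.

Lemma ev2B p q : ev2 (p - q) = ev2 p - ev2 q.
Proof. exact: rmorphB. Qed.

Lemma ev2C p : ev2 p%:P = (map_poly rho p).[x].
Proof. by rewrite /ev2 /= map_polyC /horner_eval hornerC. Qed.

Lemma ev2CC c : ev2 c%:P%:P = rho c.
Proof. by rewrite ev2C map_polyC hornerC. Qed.

Lemma ev2X : ev2 'X%:P = x.
Proof. by rewrite ev2C map_polyX hornerX. Qed.

Lemma ev2Y : ev2 'X = y.
Proof. by rewrite /ev2 /= map_polyX /horner_eval hornerX. Qed.

Lemma ev2_coef n (p : {poly {poly k}}) : (size p <= n)%N ->
  ev2 p = \sum_(i < n) (map_poly rho p`_i).[x] * y ^+ i.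
Proof.
move=> hn; rewrite /ev2 /= /horner_eval (@horner_coef_wide _ n).
  by apply: eq_bigr => i _; rewrite coef_map_id0 //= /horner_eval rmorph0 horner0.
by rewrite (leq_trans _ hn) // size_poly.
Qed.
End Evaluation.

Lemma poly2_ind (k : nzRingType) (P : {poly {poly k}} -> Prop) :
  (forall c, P c%:P%:P) -> P 'X%:P -> P 'X ->
  (forall p q, P p -> P q -> P (p + q)) ->
  (forall p q, P p -> P q -> P (p * q)) -> forall p, P p.
Proof.
move=> hC hX hY hD hM; elim/poly_ind => [|p q IH]; first by rewrite -!polyC0.
apply: (hD); first exact: hM.
elim/poly_ind: q => [|q c IHq]; first by rewrite -polyC0.
by rewrite polyCD polyCM; apply: hD => //; apply: hM.
Qed.

Lemma ev2_morph (k A A' : comNzRingType) (rho : {rmorphism k -> A})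
    (rho' : {rmorphism k -> A'}) (th : {rmorphism A -> A'}) x y p :
  (forall c, th (rho c) = rho' c) ->
  th (ev2 rho x y p) = ev2 rho' (th x) (th y) p.
Proof.
move=> h; elim/poly2_ind: p => [c|||p q hp hq|p q hp hq].
- by rewrite !ev2CC.
- by rewrite !ev2X.
- by rewrite !ev2Y.
- by rewrite !rmorphD hp hq.
- by rewrite !rmorphM hp hq.
Qed.

Lemma ev2_map (k k' A : comNzRingType) (io : {rmorphism k -> k'})
    (rho : {rmorphism k' -> A}) (rho' : {rmorphism k -> A}) x y p :
  (forall c, rho (io c) = rho' c) ->
  ev2 rho x y (map_poly (map_poly io) p) = ev2 rho' x y p.
Proof.
move=> h; elim/poly2_ind: p => [c|||p q hp hq|p q hp hq].
- by rewrite !map_polyC /= map_polyC !ev2CC /= h.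
- by rewrite map_polyC /= map_polyX !ev2X.
- by rewrite map_polyX !ev2Y.
- by rewrite !rmorphD /= hp hq.
- by rewrite !rmorphM /= hp hq.
Qed.

(** * Substitution and the subring k[f] *)

Section Substitution.
Variable F : fieldType.
Hypothesis Fcl : alg_closed F.
Local Notation P2 := {poly {poly F}}.

Definition pC2 : F -> P2 := polyC \o polyC.
HB.instance Definition _ := GRing.RMorphism.on pC2.

(** A root of p - 1 is a nonroot of p, so no counting of elements of F is involved. *)
Lemma nonroot (p : {poly F}) : p != 0 -> exists b, p.[b] != 0.
Proof.
move=> p0; have [/size_poly1P[c c0 ->]|s1] := boolP (size p == 1%N).
  by exists 0; rewrite hornerC.
have s2 : (1 < size p)%N.
  by move: s1 p0; rewrite -size_poly_eq0; case: (size p) => [|[]].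
have [b /rootP] : exists b, root (p - 1%:P) b.
  apply: Fcl; rewrite size_polyDl ?(gtn_eqF s2) // size_polyN.
  by rewrite (leq_ltn_trans (size_polyC_leq1 _)).
rewrite !hornerE => /eqP; rewrite subr_eq0 => /eqP pb.
by exists b; rewrite pb oner_neq0.
Qed.

Lemma redx_neq0 (G : P2) : G != 0 -> exists b, redx b G != 0.
Proof.
move=> G0; have l0 : lead_coef G != 0 by rewrite lead_coef_eq0.
have [b hb] := nonroot l0; exists b; apply: contraNneq hb => h.
by have /polyP/(_ (size G).-1) := h; rewrite coef_map coef0 => <-.
Qed.

Definition subst2 (f u : P2) : P2 -> P2 := ev2 pC2 f u.
HB.instance Definition _ f u := GRing.RMorphism.on (subst2 f u).

Lemma ev2_subst2 (A : comNzRingType) (rho : {rmorphism F -> A}) x y p q G :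
  ev2 rho x y (subst2 p q G) = ev2 rho (ev2 rho x y p) (ev2 rho x y q) G.
Proof.
elim/poly2_ind: G => [c|||g h hg hh|g h hg hh].
- by rewrite /subst2 !ev2CC.
- by rewrite /subst2 !ev2X.
- by rewrite /subst2 !ev2Y.
- by rewrite !rmorphD /= hg hh.
- by rewrite !rmorphM /= hg hh.
Qed.

Lemma subst2_subst2 p q p' q' G :
  subst2 p q (subst2 p' q' G) = subst2 (subst2 p q p') (subst2 p q q') G.
Proof. exact: ev2_subst2. Qed.

Lemma subst2_id G : subst2 'X%:P 'X G = G.
Proof.
elim/poly2_ind: G => [c|||p q hp hq|p q hp hq].
- exact: ev2CC.
- exact: ev2X.
- exact: ev2Y.
- by rewrite rmorphD /= hp hq.
- by rewrite rmorphM /= hp hq.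
Qed.

Definition comp1 (f : P2) (R : {poly F}) : P2 := (map_poly pC2 R).[f].

Lemma comp1_subst f u R : comp1 f R = subst2 f u R%:P.
Proof. by rewrite /subst2 ev2C. Qed.

Lemma comp1C f c : comp1 f c%:P = c%:P%:P.
Proof. by rewrite /comp1 map_polyC hornerC. Qed.

Lemma comp1M f p q : comp1 f (p * q) = comp1 f p * comp1 f q.
Proof. by rewrite /comp1 rmorphM hornerM. Qed.

Lemma comp1D f p q : comp1 f (p + q) = comp1 f p + comp1 f q.
Proof. by rewrite /comp1 rmorphD hornerD. Qed.

Lemma comp1lin f b : comp1 f ('X - b%:P) = f - b%:P%:P.
Proof. by rewrite /comp1 rmorphB /= map_polyX map_polyC !hornerE. Qed.

Lemma subst2_comp f u w G : subst2 f u (G \Po w) = subst2 f (subst2 f u w) G.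
Proof.
elim/poly2_ind: G => [c|||p q hp hq|p q hp hq].
- by rewrite comp_polyC /subst2 !ev2CC.
- by rewrite comp_polyC /subst2 !ev2X.
- by rewrite comp_polyX /subst2 !ev2Y.
- by rewrite comp_polyD !rmorphD /= hp hq.
- by rewrite comp_polyM !rmorphM /= hp hq.
Qed.

Variable f : P2.
Hypothesis firr : forall b, irr2 (f - b%:P%:P).

(** Turns a relation between f and u into a relation for u alone modulo f - b, to which [dvd_horner]
    applies. *)
Lemma dvd_subst b u G :
  dvd2 (f - b%:P%:P) (subst2 f u G - (map_poly pC2 (redx b G)).[u]).
Proof.
elim/poly2_ind: G => [c|||p q [v hv] [w hw]|p q [v hv] [w hw]].
- exists 0; rewrite /subst2 ev2CC redxC hornerC map_polyC hornerC subrr.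
  by rewrite mul0r.
- exists 1; rewrite /subst2 ev2X redxC hornerX map_polyC hornerC mul1r.
  by [].
- exists 0; rewrite /subst2 ev2Y /redx !map_polyX hornerX subrr mul0r.
  by [].
- exists (v + w); rewrite !rmorphD hornerD mulrDl -hv -hw /=.
  by rewrite opprD addrACA.
- exists (v * subst2 f u q + (map_poly pC2 (redx b p)).[u] * w).
  rewrite !rmorphM hornerM mulrDl -[_ * w * _]mulrA -hw mulrAC -hv /=.
  by rewrite mulrBl mulrBr addrA subrK.
Qed.

(* If f - b divides g(u) for a nonzero g in one variable then some u - c is
   divisible by f - b, because g splits. *)
Lemma dvd_horner b u (g : {poly F}) : g != 0 ->
  dvd2 (f - b%:P%:P) (map_poly pC2 g).[u] ->
  exists c, dvd2 (f - b%:P%:P) (u - c%:P%:P).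
Proof.
move: g; apply: (poly_root_ind Fcl) => [c c0|c p p0 IH].
  by rewrite map_polyC hornerC => /(irr_ndvd_const (firr b) c0).
rewrite rmorphM hornerM => /(irr_prime Fcl (firr b))[|//].
by rewrite rmorphB /= map_polyX map_polyC !hornerE => h; exists c.
Qed.

Lemma f_neq b : f - b%:P%:P != 0.
Proof. exact: irr2_neq0. Qed.

Lemma comp1_neq0 R : R != 0 -> comp1 f R != 0.
Proof.
move: R; apply: (poly_root_ind Fcl) => [c c0|c p p0 h].
  by rewrite comp1C !polyC_eq0.
by rewrite comp1M comp1lin mulf_neq0 ?f_neq.
Qed.

Lemma dvd_comp1 p R : irr2 p -> R != 0 -> dvd2 p (comp1 f R) ->
  exists b, dvd2 p (f - b%:P%:P).
Proof.
move=> irp; move: R; apply: (poly_root_ind Fcl) => [c c0|c q q0 IH].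
  by rewrite comp1C => /(irr_ndvd_const irp c0).
by rewrite comp1M comp1lin => /(irr_prime Fcl irp)[h|//]; exists c.
Qed.

(** The criterion for membership in k[f] by which irreducibility of the fibres enters: an
    irreducible divisor of a nonzero R(f) divides some f - b, and is associated to it because f - b
    is irreducible. So g is a product of polynomials f - b and a constant. *)
Lemma comp1_factors g : g != 0 ->
  (forall p, irr2 p -> dvd2 p g -> exists2 R, R != 0 & dvd2 p (comp1 f R)) ->
  exists2 R, R != 0 & g = comp1 f R.
Proof.
have [n] := ubnP (deg2 g); elim: n g => // n IH g hn g0 hg.
have [/deg2_eq0P gc|dg] := eqVneq (deg2 g) 0%N.
  exists (g`_0`_0)%:P; last by rewrite comp1C -gc.
  by apply: contraNneq g0 => h; rewrite gc h polyC0.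
have [p irp pg] := irr_factor dg.
have [R R0 /(dvd_comp1 irp R0)[b [w hb]]] := hg p irp pg.
have [q gE] : dvd2 (f - b%:P%:P) g.
  have [wc|pc] := (firr b).2 _ _ hb; last by case: irp; rewrite pc.
  have w0 : w`_0`_0 != 0.
    apply: contraTneq (f_neq b) => h.
    by rewrite hb (deg2_eq0P wc) h !polyC0 mul0r eqxx.
  have [v ->] := pg; exists ((w`_0`_0)^-1%:P%:P * v).
  rewrite hb [X in _ = _ * (X * p)](deg2_eq0P wc) mulrACA -!polyCM mulVf //.
  by rewrite mul1r.
have q0 : q != 0 by apply: contraNneq g0 => h; rewrite gE h mul0r.
have [||R' R'0 qE] := IH q _ q0.
- rewrite -ltnS (leq_trans _ hn) // ltnS gE deg2M ?f_neq // -[X in (X < _)%N]addn0.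
  by rewrite ltn_add2l lt0n; case: (firr b).
- by move=> p' irp' p'q; apply: hg => //; rewrite gE; exact: dvd2_mulr.
exists (R' * ('X - b%:P)); first by rewrite mulf_neq0 ?polyXsubC_eq0.
by rewrite comp1M comp1lin -qE.
Qed.

Lemma deg2_subC (p : P2) c : (deg2 (p - c%:P%:P) <= deg2 p)%N.
Proof.
rewrite /deg2 (raddfB swapXY) /= swapXY_polyC map_polyC /=.
have h (q : P2) : ((size (q - c%:P%:P)%R).-1 <= (size q).-1)%N.
  rewrite -!subn1 leq_subLR (leq_trans (size_polyD _ _)) // geq_max size_polyN.
  by rewrite -leq_subLR leqnn (leq_trans (size_polyC_leq1 _)) ?leq_addr.
exact: leq_add.
Qed.

Lemma descend b c (u u' : P2) : u - c%:P%:P = u' * (f - b%:P%:P) -> u' != 0 ->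
  (deg2 u' < deg2 u)%N.
Proof.
move=> h u0; apply: leq_trans (deg2_subC u c); rewrite h deg2M ?f_neq //.
by rewrite -[X in (X < _)%N]addn0 ltn_add2l lt0n; case: (firr b).
Qed.

Lemma subst_lin b c u' :
  subst2 f u' (('X - b%:P)%:P * 'X + c%:P%:P) =
    u' * (f - b%:P%:P) + c%:P%:P.
Proof.
by rewrite rmorphD rmorphM /= -comp1_subst comp1lin /subst2 ev2Y ev2CC mulrC.
Qed.

(** k[f] is algebraically closed in k[x, y]. For b with G(b, y) nonzero, f - b divides G(b, h),
    hence some h - c; the quotient is again algebraic over k(f) and has smaller degree. *)
Lemma alg_in_comp1 (h G : P2) : G != 0 -> subst2 f h G = 0 ->
  exists R, h = comp1 f R.
Proof.
have [n] := ubnP (deg2 h); elim: n h G => // n IH h G hn G0 hG.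
have [b Gb] := redx_neq0 G0.
have [c [h' hE]] : exists c, dvd2 (f - b%:P%:P) (h - c%:P%:P).
  apply: dvd_horner Gb _; have := dvd_subst b h G.
  by rewrite hG sub0r => -[w hw]; exists (- w); rewrite mulNr -hw opprK.
have [h'0|h'0] := eqVneq h' 0.
  exists c%:P; rewrite comp1C; apply/eqP; rewrite -subr_eq0 hE h'0 mul0r.
  by [].
have hl : h = subst2 f h' (('X - b%:P)%:P * 'X + c%:P%:P).
  by rewrite subst_lin -hE subrK.
have [|||R R0] := IH h' (G \Po (('X - b%:P)%:P * 'X + c%:P%:P)).
- by rewrite -ltnS (leq_trans _ hn) // ltnS; exact: descend hE h'0.
- rewrite comp_poly2_eq0 // size_MXaddC polyC_eq0 polyXsubC_eq0 /=.
  by rewrite size_polyC polyXsubC_eq0.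
- by rewrite subst2_comp -hl.
exists (R * ('X - b%:P) + c%:P); rewrite comp1D comp1M comp1lin comp1C -R0.
by rewrite -hE subrK.
Qed.

Lemma subst2_inj u : ~ (exists R, u = comp1 f R) ->
  forall G, subst2 f u G = 0 -> G = 0.
Proof.
move=> hu G hG; apply/eqP; apply: contrapT => /negP G0; apply: hu.
exact: alg_in_comp1 G0 hG.
Qed.

(* Take u of minimal degree: if f - b divided u - c, then the quotient would be
   another generator. *)
Lemma generator u : ~ (exists R, u = comp1 f R) ->
  (forall h, exists R G, R != 0 /\ comp1 f R * h = subst2 f u G) ->
  exists u', ~ (exists R, u' = comp1 f R) /\
     forall h, exists G, h = subst2 f u' G.
Proof.
have [n] := ubnP (deg2 u); elim: n u => // n IH u hn uR hu.
have [[b [c [u' uE]]]|nd] := pselect (exists b c, dvd2 (f - b%:P%:P) (u - c%:P%:P)).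
  have u'R : ~ exists R, u' = comp1 f R.
    move=> [R u'E]; apply: uR; exists (R * ('X - b%:P) + c%:P).
    by rewrite comp1D comp1M comp1lin comp1C -u'E -uE subrK.
  apply: (IH u') => //.
    rewrite -ltnS (leq_trans _ hn) // ltnS; apply: descend uE _.
    by apply: contra_notN u'R => /eqP->; exists 0; rewrite /comp1 rmorph0 horner0.
  move=> h; have [R [G [R0 hG]]] := hu h.
  exists R, (G \Po (('X - b%:P)%:P * 'X + c%:P%:P)); split=> //.
  by rewrite subst2_comp subst_lin -uE subrK.
(* Here f - b never divides u - c, so G(b, y) must vanish whenever f - b divides G(f, u); the linear
   factors of the denominator R cancel one by one. *)
exists u; split=> // h; have [R [G [R0]]] := hu h.
move: R R0 h G {hu}; apply: (poly_root_ind Fcl) => [c c0 h G|b R R0 H h G].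
  rewrite comp1C => hG; exists (c^-1%:P%:P * G); rewrite rmorphM /= -hG.
  by rewrite -comp1_subst comp1C mulrA -!polyCM mulVf // mul1r.
rewrite comp1M comp1lin => hG.
have [|G' GE] := @redx_eq0 _ b G.
  apply/eqP; apply: contrapT => /negP Gb; case: nd; exists b.
  apply: dvd_horner Gb _; rewrite -[X in dvd2 _ X](subKr (subst2 f u G)).
  apply: dvd2B (dvd_subst _ _ _); rewrite -hG; exists (comp1 f R * h).
  by rewrite [RHS]mulrC mulrA.
apply: (H h G'); apply: (mulfI (f_neq b)); rewrite mulrA hG GE rmorphM /=.
by rewrite -comp1_subst comp1lin.
Qed.

End Substitution.

(** * Generators of the function field of the plane *)

Section ImageFractions.
Variables (T : comNzRingType) (N : fieldType) (e : {rmorphism T -> N}).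

(** Membership in the subfield generated by the image of e, with numerator and denominator available
    in T, where divisibility can be discussed. *)
Definition ratio_of (n : N) := exists al be : T, e be != 0 /\ n * e be = e al.

Lemma ratio_of_val p : ratio_of (e p).
Proof. by exists p, 1; rewrite rmorph1 oner_neq0 mulr1. Qed.

Lemma ratio_of1 : ratio_of 1.
Proof. by rewrite -(rmorph1 e); exact: ratio_of_val. Qed.

Lemma ratio_ofD m n : ratio_of m -> ratio_of n -> ratio_of (m + n).
Proof.
move=> [al [be [b0 h]]] [al' [be' [b0' h']]].
exists (al * be' + al' * be), (be * be').
by rewrite rmorphD !rmorphM /= -h -h' mulf_neq0 //; split=> //; ring.
Qed.

Lemma ratio_ofM m n : ratio_of m -> ratio_of n -> ratio_of (m * n).
Proof.
move=> [al [be [b0 h]]] [al' [be' [b0' h']]]; exists (al * al'), (be * be').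
by rewrite !rmorphM /= -h -h' mulf_neq0 //; split=> //; ring.
Qed.

Lemma ratio_of_div m n x : ratio_of m -> ratio_of n -> n != 0 -> x * n = m ->
  ratio_of x.
Proof.
move=> [al [be [b0 h]]] [al' [be' [b0' h']]] n0 xE; exists (al * be'), (be * al').
rewrite !rmorphM /= -h -h' !mulf_neq0 //; split=> //.
by rewrite -xE; ring.
Qed.

Lemma ratio_ofN m : ratio_of m -> ratio_of (- m).
Proof. by move=> [al [be [b0 h]]]; exists (- al), be; rewrite rmorphN /= -h mulNr. Qed.

Lemma ratio_of_sum n (F : 'I_n -> N) : (forall i, ratio_of (F i)) ->
  ratio_of (\sum_(i < n) F i).
Proof.
move=> h; elim/big_ind: _ => //; last exact: ratio_ofD.
by rewrite -(rmorph0 e); exact: ratio_of_val.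
Qed.

Lemma ratio_ofX n i : ratio_of n -> ratio_of (n ^+ i).
Proof.
move=> h; elim: i => [|i IH]; first exact: ratio_of1.
by rewrite exprS; exact: ratio_ofM.
Qed.

Lemma ratio_of_inv m n : ratio_of m -> ratio_of n -> ratio_of (m / n).
Proof.
move=> hm hn; have [->|n0] := eqVneq n 0.
  by rewrite invr0 mulr0 -(rmorph0 e); exact: ratio_of_val.
by apply: (ratio_of_div hm hn n0); exact: divfK.
Qed.

End ImageFractions.

Definition ratio2 (k N : fieldType) (rho : {rmorphism k -> N}) x y : N -> Prop :=
  ratio_of (ev2 rho x y).

(** * From a generator of k(x, y) over k(f) to a polynomial one *)

Section FieldGenerator.
Variable F : fieldType.
Hypothesis Fcl : alg_closed F.
Local Notation P2 := {poly {poly F}}.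
Variable f : P2.
Hypothesis firr : forall b, irr2 (f - b%:P%:P).
Variables (N : fieldType) (rho : {rmorphism F -> N}) (X Y : N).
Local Notation Psi := (ev2 rho X Y).
Hypothesis Psi_inj : forall p, Psi p = 0 -> p = 0.
Local Notation a := (Psi f).
Local Notation E t := (ev2 rho a t).

Lemma Psi_subst u G : Psi (subst2 f u G) = E (Psi u) G.
Proof. exact: ev2_subst2. Qed.

Lemma E_C t R : E t R%:P = Psi (comp1 f R).
Proof. by rewrite (comp1_subst f 0) Psi_subst !ev2C. Qed.

Lemma Psi_comp1 R : (map_poly rho R).[a] = Psi (comp1 f R).
Proof. by rewrite -(E_C 0) ev2C. Qed.

Lemma Psi_eq0 p : (Psi p == 0) = (p == 0).
Proof. by apply/eqP/eqP => [/Psi_inj//|->]; rewrite rmorph0. Qed.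

Lemma reduced_fraction n : (exists P Q, Q != 0 /\ n * Psi Q = Psi P) ->
  exists P Q, [/\ Q != 0, n * Psi Q = Psi P &
                  forall p, irr2 p -> dvd2 p P -> ~ dvd2 p Q].
Proof.
move=> [P [Q]]; have [m] := ubnP (deg2 Q); elim: m P Q => // m IH P Q hm [Q0 hn].
have [[p [irp [P' PE] [Q' QE]]]|nd] :=
  pselect (exists p, [/\ irr2 p, dvd2 p P & dvd2 p Q]); last first.
  by exists P, Q; split=> // p irp pP pQ; apply: nd; exists p.
have p0 := irr2_neq0 irp.
have Q'0 : Q' != 0 by apply: contraNneq Q0 => h; rewrite QE h mul0r.
apply: (IH P' Q'); last first.
  split=> //; have /mulIf : Psi p != 0 by rewrite Psi_eq0.
  by apply; rewrite -mulrA -!rmorphM -QE -PE.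
rewrite -ltnS (leq_trans _ hm) // ltnS QE deg2M // -[X in (X < _)%N]addn0.
by rewrite ltn_add2l lt0n; case: irp.
Qed.

(** The polynomial Q^n G(f, P / Q), that is, G homogenized in its outer variable. *)
Definition hom n (P Q G : P2) : P2 :=
  \sum_(i < n.+1) comp1 f G`_i * P ^+ i * Q ^+ (n - i).

Lemma hom_Psi n t P Q (G : P2) : (size G <= n.+1)%N -> t * Psi Q = Psi P ->
  Psi (hom n P Q G) = Psi Q ^+ n * E t G.
Proof.
move=> sG tE; rewrite (ev2_coef _ _ _ sG) mulr_sumr rmorph_sum /=.
apply: eq_bigr => i _; rewrite !rmorphM !rmorphXn /= -tE exprMn Psi_comp1.
have -> : Psi Q ^+ n = Psi Q ^+ i * Psi Q ^+ (n - i).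
  by rewrite -exprD subnKC // -ltnS.
by rewrite [RHS]mulrC !mulrA.
Qed.

(** Modulo Q only the top term survives. So an irreducible divisor of Q and of [hom n P Q G] that
    does not divide P must divide the top coefficient at f. *)
Lemma hom_top n P Q G : exists w, hom n P Q G = comp1 f G`_n * P ^+ n + Q * w.
Proof.
rewrite /hom big_ord_recr /= subnn mulr1.
exists (\sum_(i < n) comp1 f G`_i * P ^+ i * Q ^+ (n - i).-1).
rewrite addrC mulr_sumr; congr (_ + _); apply: eq_bigr => i _.
by rewrite [RHS]mulrCA -exprS prednK // subn_gt0.
Qed.

(** k(f) is algebraically closed in k(x, y). For n = P / Q in lowest terms, every irreducible factor
    of Q divides the leading coefficient of G at f, so Q is in k[f]; then P is algebraic over k(f)
    and [alg_in_comp1] applies. *)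
Lemma alg_const n G : (exists P Q, Q != 0 /\ n * Psi Q = Psi P) ->
  G != 0 -> E n G = 0 ->
  exists R1 R2, R2 != 0 /\ n * Psi (comp1 f R2) = Psi (comp1 f R1).
Proof.
move=> /reduced_fraction[P [Q [Q0 hn cop]]] G0 hG.
have lG : G`_(size G).-1 != 0 by rewrite -lead_coefE lead_coef_eq0.
have sG : (size G <= (size G).-1.+1)%N by rewrite leqSpred.
have hom0 : hom (size G).-1 P Q G = 0.
  by apply: Psi_inj; rewrite (hom_Psi sG hn) hG mulr0.
have [|R2 R20 QE] := comp1_factors Fcl firr Q0.
  move=> p irp pQ; exists G`_(size G).-1 => //.
  have [w] := hom_top (size G).-1 P Q G; rewrite hom0 => /esym/eqP.
  rewrite addr_eq0 => /eqP h.
  have [|//|/(irr_primeX Fcl irp) pP] :=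
    @irr_prime _ Fcl _ (comp1 f G`_(size G).-1) (P ^+ (size G).-1) irp.
    by rewrite h -mulrN; apply: dvd2_mulr.
  by case: (cop p irp pP pQ).
(* The equation of n multiplied by Q^deg G, where Q = R2(f), is an equation of P = n Q over k[f]. *)
pose G' : P2 := \poly_(i < (size G).-1.+1) (G`_i * R2 ^+ ((size G).-1 - i)).
have [||R1 PE] := @alg_in_comp1 _ Fcl _ firr P G'.
- apply: contraNneq lG => h; have := congr1 (fun p : P2 => p`_(size G).-1) h.
  by rewrite coef_poly ltnSn subnn mulr1 coef0 => ->.
- apply: Psi_inj; rewrite Psi_subst -hn (ev2_coef _ _ _ (size_poly _ _)).
  transitivity (Psi Q ^+ (size G).-1 * E n G); last by rewrite hG mulr0.
  rewrite (ev2_coef _ _ _ sG) mulr_sumr; apply: eq_bigr => i _.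
  rewrite coef_poly ltn_ord rmorphM hornerM rmorphXn horner_exp !Psi_comp1 -QE.
  have -> : Psi Q ^+ (size G).-1 = Psi Q ^+ i * Psi Q ^+ ((size G).-1 - i).
    by rewrite -exprD subnKC // -ltnS.
  by rewrite exprMn; ring.
exists R1, R2; split=> //; by rewrite -QE hn PE.
Qed.

Local Notation gens t := (ratio2 rho a t).

Lemma gens_C t c : gens t (rho c).
Proof. by rewrite -(ev2CC rho a t); exact: ratio_of_val. Qed.

Lemma gens_Psi t P : gens t X -> gens t Y -> gens t (Psi P).
Proof.
move=> hX hY; elim/poly2_ind: P => [c|||p q hp hq|p q hp hq].
- by rewrite ev2CC; exact: gens_C.
- by rewrite ev2X.
- by rewrite ev2Y.
- by rewrite rmorphD; exact: ratio_ofD.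
- by rewrite rmorphM; exact: ratio_ofM.
Qed.

Lemma gens_reduced t n : (forall G, E t G = 0 -> G = 0) -> gens t n ->
  exists al be : P2, [/\ be != 0, coprimep al be & n * E t be = E t al].
Proof.
move=> tr [al [be /= [b0 h]]].
have be0 : be != 0 by apply: contraNneq b0 => ->; rewrite rmorph0.
have := Pdiv.WeakIdomain.divpK (dvdp_gcdl al be).
have := Pdiv.WeakIdomain.divpK (dvdp_gcdr al be).
have := coprimep_div_gcd (introT orP (or_intror be0) : (al != 0) || (be != 0)).
have := gcdp_eq0 al be; rewrite (negbTE be0) andbF.
move: (Pdiv.WeakIdomain.lc_expn_scalp_neq0 al (gcdp al be)).
move: (Pdiv.WeakIdomain.lc_expn_scalp_neq0 be (gcdp al be)).
set d := gcdp al be; set al' := al %/ d; set be' := be %/ d.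
set r2 := _ ^+ scalp be d; set r1 := _ ^+ scalp al d.
move=> r20 r10 /negbT d0 cop h2 h1.
exists (r2 *: al'), (r1 *: be'); split.
- rewrite -mul_polyC mulf_eq0 polyC_eq0 negb_or r10; apply: contraNneq be0 => b'0.
  by move/eqP: h2; rewrite b'0 mul0r eq_sym -mul_polyC mulf_eq0 polyC_eq0 (negbTE r20).
- by rewrite coprimepZl // coprimepZr.
- have Ed : E t d != 0 by apply: contraNneq d0 => /tr ->.
  apply: (mulIf Ed); rewrite -mulrA -!rmorphM -!scalerAl h1 h2 /=.
  by rewrite -!mul_polyC !rmorphM /= -h; ring.
Qed.

Lemma E_inj_eq t p q : (forall G, E t G = 0 -> G = 0) -> E t p = E t q -> p = q.
Proof.
move=> tr h; apply: subr0_eq; apply: tr.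
by transitivity (E t p - E t q); [exact: ev2B|rewrite h subrr].
Qed.

Lemma Psi_inj_eq p q : Psi p = Psi q -> p = q.
Proof.
move=> h; apply: subr0_eq; apply: Psi_inj.
by transitivity (Psi p - Psi q); [exact: ev2B|rewrite h subrr].
Qed.

Lemma subst_comp1 R G : subst2 f (comp1 f R) G = comp1 f G.[R].
Proof. by rewrite (comp1_subst f 0) -subst2_comp comp_polyCr -comp1_subst. Qed.

Lemma gens_comp1 R n : gens (Psi (comp1 f R)) n ->
  exists R1 R2, R2 != 0 /\ n * Psi (comp1 f R2) = Psi (comp1 f R1).
Proof.
move=> [al [be /= [b0 h]]]; exists al.[R], be.[R].
rewrite -!subst_comp1 !Psi_subst; split=> //.
by apply: contraNneq b0 => b0; rewrite -Psi_subst subst_comp1 b0 /comp1 rmorph0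
   horner0 rmorph0.
Qed.

Lemma transcendental_notin t R1 R2 : (forall G, E t G = 0 -> G = 0) -> R2 != 0 ->
  t * Psi (comp1 f R2) = Psi (comp1 f R1) -> False.
Proof.
move=> tr R20 h; have : R2%:P * 'X - R1%:P = 0 :> P2.
  by apply: tr; rewrite ev2B rmorphM /= !E_C ev2Y mulrC h subrr.
move=> /(congr1 (fun p : P2 => p`_1)) /eqP.
rewrite coefB coefMX !coefC /= subr0.
by rewrite (negbTE R20).
Qed.

(** The denominator can be taken in k[f]: if h = al(f, u) / be(f, u) with al and be coprime over
    k(x), Bezout yields r(x), and be(f, u), which divides al(f, u), divides r(f); [comp1_factors]
    applies. *)
Lemma fraction_field_generated t :
  (forall G, E t G = 0 -> G = 0) -> gens t X -> gens t Y ->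
  forall u, gens (Psi u) t ->
  ~ (exists R, u = comp1 f R) /\
  forall h, exists R G, R != 0 /\ comp1 f R * h = subst2 f u G.
Proof.
move=> tr tX tY u ut.
have uR : ~ exists R, u = comp1 f R.
  by move=> [R uE]; move: ut; rewrite uE => /gens_comp1[R1 [R2 []]]; exact: transcendental_notin.
split=> // h.
have tru G : E (Psi u) G = 0 -> G = 0.
  by rewrite -Psi_subst => /Psi_inj; exact: (subst2_inj Fcl firr uR).
have uE n : gens t n -> gens (Psi u) n.
  move=> [al [be /= [b0 hn]]].
  have gens_E G : gens (Psi u) (E t G).
    elim/poly2_ind: G => [c|||p q hp hq|p q hp hq].
    - by rewrite ev2CC; exact: gens_C.
    - by exists 'X%:P, 1; rewrite rmorph1 oner_neq0 mulr1 /= !ev2X.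
    - by rewrite ev2Y.
    - by rewrite rmorphD; exact: ratio_ofD.
    - by rewrite rmorphM; exact: ratio_ofM.
  exact: ratio_of_div (gens_E al) (gens_E be) b0 hn.
have /(gens_reduced tru)[al [be [b0 cop]]] : gens (Psi u) (Psi h).
  by apply: gens_Psi; apply: uE.
rewrite -!Psi_subst -rmorphM => /Psi_inj_eq hE.
have /Bezout_coprimepP[[U V] /=] := cop.
rewrite -size_poly_eq1 => /size_poly1P[r r0 rE].
have sb0 : subst2 f u be != 0.
  by apply: contraNneq b0 => /(subst2_inj Fcl firr uR) ->.
have [|R R0 RE] := comp1_factors Fcl firr sb0.
  move=> p irp pb; exists r => //; rewrite (comp1_subst _ u) -rE rmorphD !rmorphM /=.
  by apply: dvd2D; apply: dvd2_mull => //; rewrite -hE; exact: dvd2_mull.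
by exists R, al; rewrite -RE mulrC.
Qed.

(* be(P / Q) Q ^ n lies in k[f], since each of its irreducible factors divides
   some f - b. *)
Lemma hom_const t P Q (x al be : P2) (n := (maxn (size al) (size be)).-1) :
  t * Psi Q = Psi P -> Q != 0 -> (forall p, irr2 p -> dvd2 p P -> ~ dvd2 p Q) ->
  (forall G, E t G = 0 -> G = 0) -> be != 0 -> coprimep al be ->
  Psi x * E t be = E t al ->
  exists2 R, R != 0 & Psi Q ^+ n * E t be = Psi (comp1 f R).
Proof.
move=> tE Q0 copPQ tr b0 cop hx.
have sal : (size al <= n.+1)%N by rewrite (leq_trans (leq_maxl _ (size be))) // leqSpred.
have sbe : (size be <= n.+1)%N by rewrite (leq_trans (leq_maxr (size al) _)) // leqSpred.
have Eb0 : E t be != 0 by apply: contraNneq b0 => /tr ->.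
have homE : x * hom n P Q be = hom n P Q al.
  apply: Psi_inj_eq; rewrite rmorphM /= (hom_Psi sal tE) (hom_Psi sbe tE).
  by rewrite mulrCA hx.
have hb0 : hom n P Q be != 0.
  by rewrite -Psi_eq0 (hom_Psi sbe tE) mulf_neq0 // expf_neq0 // Psi_eq0.
have [|R R0 RE] := comp1_factors Fcl firr hb0; last first.
  by exists R => //; rewrite -RE (hom_Psi sbe tE).
move=> p irp pb; have pa : dvd2 p (hom n P Q al) by rewrite -homE; exact: dvd2_mull.
(* If p divides Q, it divides the coefficients of index n of [al] and [be] at f, not both zero since
   n is the larger degree. Otherwise a Bezout relation, homogenized, shows that p divides Q^(m + n)
   r(f), hence r(f). *)
have [pQ|npQ] := pselect (dvd2 p Q).
  have npP : ~ dvd2 p P by move=> pP; exact: copPQ irp pP pQ.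
  have top (g : P2) : dvd2 p (hom n P Q g) -> dvd2 p (comp1 f g`_n).
    move=> pg; have [w wE] := hom_top n P Q g.
    have [|//|/(irr_primeX Fcl irp)//] :=
      @irr_prime _ Fcl _ (comp1 f g`_n) (P ^+ n) irp.
    rewrite (_ : _ * _ = hom n P Q g - Q * w); last by rewrite wE addrK.
    by apply: dvd2B => //; exact: dvd2_mulr.
  have [bn0|bn0] := eqVneq be`_n 0; last by exists be`_n => //; exact: top.
  exists al`_n; last exact: top.
  apply: contraTneq cop => an0.
  have lt1 (g : P2) : (size g <= n.+1)%N -> g`_n = 0 -> (size g <= n)%N.
    rewrite leq_eqVlt => /orP[/eqP sg gn|//].
    have : lead_coef g = 0 by rewrite lead_coefE sg.
    by move=> /eqP; rewrite lead_coef_eq0 => /eqP g0; rewrite g0 size_poly0 in sg.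
  have : (maxn (size al) (size be) <= n)%N by rewrite geq_max !lt1.
  rewrite /n -ltnS prednK ?ltnn //.
  by rewrite (leq_trans _ (leq_maxr _ _)) // size_poly_gt0.
have /Bezout_coprimepP[[U V] /=] := cop.
rewrite -size_poly_eq1 => /size_poly1P[r r0 rE].
exists r => //.
pose m := maxn (size U) (size V).
have sU : (size U <= m.+1)%N by rewrite leqW // leq_maxl.
have sV : (size V <= m.+1)%N by rewrite leqW // leq_maxr.
have : dvd2 p (hom m P Q U * hom n P Q al + hom m P Q V * hom n P Q be).
  by apply: dvd2D; apply: dvd2_mull.
rewrite (_ : _ + _ = Q ^+ (m + n) * comp1 f r).
  by move=> /(irr_prime Fcl irp)[/(irr_primeX Fcl irp)|].
apply: Psi_inj_eq; rewrite rmorphD !rmorphM /= !(hom_Psi _ tE) // -(E_C t) -rE.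
by rewrite rmorphXn rmorphD !rmorphM exprD /=; ring.
Qed.

(* Write t = P / Q in lowest terms and Q = q2 / q1 (t). As be(t) Q ^ n is in
   k(f), q1 is constant and q2 has degree at most 1: either Q is in k(f), or t
   is a polynomial of degree 1 in Q over k(f). *)
Lemma polynomial_generator t :
  (exists P Q, Q != 0 /\ t * Psi Q = Psi P) ->
  (forall G, E t G = 0 -> G = 0) -> gens t X -> gens t Y ->
  exists u, gens (Psi u) t.
Proof.
move=> /reduced_fraction[P [Q [Q0 tE cop]]] tr tX tY.
suff key (x al be : P2) : (1 < maxn (size al) (size be))%N -> be != 0 ->
    coprimep al be -> Psi x * E t be = E t al -> exists u, gens (Psi u) t.
  (* [gens 0] is k(f), as adjoining 0 adds nothing. *)
  have ct (x : P2) : gens t (Psi x) -> gens 0 (Psi x) \/ exists u, gens (Psi u) t.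
    move=> /(gens_reduced tr)[al [be [b0 cp hx]]].
    have [le1|lt1] := leqP (maxn (size al) (size be)) 1; last first.
      by right; apply: key hx.
    left; move: le1; rewrite geq_max => /andP[/size1_polyC aE /size1_polyC bE].
    exists (al`_0)%:P, (be`_0)%:P.
    rewrite /= (E_C 0) -(E_C t) -bE; split; first by apply: contraNneq b0 => /tr ->.
    by rewrite (E_C 0) -(E_C t) -aE.
  have := ct 'X%:P; rewrite ev2X => /(_ tX)[X0|//].
  have := ct 'X; rewrite ev2Y => /(_ tY)[Y0|//].
  (* If X and Y were both in k(f), so would be t = P / Q, which is transcendental over k(f). *)
  exfalso; have := ratio_of_div (gens_Psi P X0 Y0) (gens_Psi Q X0 Y0) _ tE.
  rewrite Psi_eq0 Q0 => /(_ isT).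
  rewrite (_ : 0 = Psi (comp1 f 0)); last by rewrite /comp1 rmorph0 horner0 rmorph0.
  by move=> /gens_comp1[R1 [R2 []]]; exact: transcendental_notin.
move=> smax b0 cp hx.
have [R R0 hR] := hom_const tE Q0 cop tr b0 cp hx.
set n := _.-1 in hR.
have n0 : (0 < n)%N by rewrite /n -ltnS prednK // ltnW.
have sbe : (size be <= n.+1)%N by exact: leq_trans (leq_maxr (size al) _) (leqSpred _).
have [q1 [q2 [q20 cq hq]]] := gens_reduced tr (gens_Psi Q tX tY).
have eq12 : be * q1 ^+ n = R%:P * q2 ^+ n.
  apply: (E_inj_eq tr); rewrite !rmorphM !rmorphXn /= E_C -hR -hq exprMn; ring.
have sq1 : (size q1 <= 1)%N.
  apply: leq_trans (size_polyC_leq1 R); apply: dvdp_leq; first by rewrite polyC_eq0.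
  rewrite -(Gauss_dvdpl _ (coprimep_expr n cq)) -eq12.
  by apply: dvdp_mull; rewrite -(prednK n0) exprS dvdp_mulr.
have [c q1E] : exists c, q1 = c%:P by exists q1`_0; exact: size1_polyC.
have c0 : c != 0.
  apply/negP => /eqP c0; move/eqP: hq; rewrite q1E c0 rmorph0 mulf_eq0 Psi_eq0 (negbTE Q0) /=.
  by apply/negP; apply: contraNneq q20 => /tr ->.
have sq2 : (size q2 <= 2)%N.
  have := congr1 (fun p : P2 => (size p).-1) eq12.
  rewrite q1E -polyC_exp mulrC !mul_polyC !size_scale ?expf_neq0 // size_exp => hs.
  have : ((size q2).-1 * n <= 1 * n)%N by rewrite mul1n -hs -ltnS prednK ?size_poly_gt0.
  by rewrite leq_pmul2r //; case: (size q2) => [|[|[]]].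
have q2E : E t q2 = Psi (comp1 f q2`_0) + Psi (comp1 f q2`_1) * t.
  by rewrite (ev2_coef _ _ _ sq2) !big_ord_recl big_ord0 !Psi_comp1 addr0 mulr1 expr1.
move: hq; rewrite q1E E_C q2E => hq.
have [q21|q21] := eqVneq q2`_1 0.
  exists P; exists ((q2`_0)%:P * 'X), c%:P.
  rewrite /= E_C Psi_eq0 comp1_neq0 // rmorphM /= E_C ev2Y -hq q21; split=> //.
  rewrite /comp1 [map_poly _ 0]rmorph0 horner0 rmorph0 -tE /comp1; ring.
exists Q; exists (c%:P - (q2`_0)%:P * 'X), ((q2`_1)%:P * 'X).
rewrite /= ev2B !rmorphM /= !E_C ev2Y mulf_neq0 ?Psi_eq0 ?comp1_neq0 //.
by split=> //; rewrite -hq; ring.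
Qed.

Theorem coordinate_of_generator t :
  (exists P Q, Q != 0 /\ t * Psi Q = Psi P) ->
  (forall G, E t G = 0 -> G = 0) -> gens t X -> gens t Y ->
  exists u, (forall G, subst2 f u G = 0 -> G = 0) /\
    forall h, exists G, h = subst2 f u G.
Proof.
move=> tfrac tr tX tY.
have [u /(fraction_field_generated tr tX tY)[uR hu]] := polynomial_generator tfrac tr tX tY.
have [u' [u'R hu']] := generator Fcl firr uR hu.
by exists u'; split=> //; exact: subst2_inj.
Qed.

End FieldGenerator.

(** * Points on conics over k(a) *)

Lemma interpolation (F : fieldType) (rs : seq F) (v : F -> F) : uniq rs ->
  exists r : {poly F}, (size r <= size rs)%N /\ forall x, x \in rs -> r.[x] = v x.
Proof.
elim: rs => [_|x rs IH /= /andP[xrs /IH[r [sr hr]]]].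
  by exists 0; rewrite size_poly0.
pose P := \prod_(y <- rs) ('X - y%:P).
have Px : P.[x] != 0 by rewrite -/(root P x) root_prod_XsubC.
exists (r + ((v x - r.[x]) / P.[x]) *: P); split.
  rewrite (leq_trans (size_polyD _ _)) // geq_max leqW //=.
  by rewrite (leq_trans (size_scale_leq _ _)) // size_prod_XsubC.
move=> y; rewrite inE hornerD hornerZ => /orP[/eqP->|yrs].
  by rewrite divfK // addrC subrK.
have /rootP -> : root P y by rewrite root_prod_XsubC.
by rewrite mulr0 addr0 hr.
Qed.

Section Conics.
Variable F : fieldType.
Hypothesis Fcl : alg_closed F.
Hypothesis F2 : 2%:R != 0 :> F.
Implicit Types g b : {poly F}.

Lemma split_poly b : b != 0 ->
  exists c rs, c != 0 /\ b = c *: \prod_(x <- rs) ('X - x%:P).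
Proof.
move: b; apply: (poly_root_ind Fcl) => [c c0|x p p0 [c [rs [c0 pE]]]].
  by exists c, [::]; rewrite big_nil alg_polyC.
by exists c, (x :: rs); rewrite big_cons scalerAr -pE.
Qed.

Lemma closed_sqrt (c : F) : exists s, s ^+ 2 = c.
Proof.
have [s /rootP] : exists s, root ('X^2 - c%:P) s.
  by apply: Fcl; rewrite size_XnsubC.
by rewrite !hornerE => /eqP; rewrite subr_eq0 => /eqP; exists s.
Qed.

Lemma sqrt_mod g (rs : seq F) : uniq rs -> exists r : {poly F},
  (size r <= size rs)%N /\ \prod_(x <- rs) ('X - x%:P) %| r ^+ 2 - g.
Proof.
move=> urs; have sq c := cid (closed_sqrt c).
have [r [sr hr]] := interpolation (fun x => sval (sq g.[x])) urs.
exists r; split=> //; apply: uniq_roots_dvdp; last by rewrite uniq_rootsE.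
apply/allP => x xrs; apply/rootP.
by rewrite !hornerE hr // (svalP (sq _)) subrr.
Qed.

(* Descent on the degrees of g and b; as F is algebraically closed, g is a
   square modulo any squarefree b. *)
Lemma legendre g b : g != 0 -> b != 0 -> exists X Y Z,
  [|| X != 0, Y != 0 | Z != 0] /\ X ^+ 2 = g * Y ^+ 2 + b * Z ^+ 2.
Proof.
have [n] := ubnP (size g + size b)%N; elim: n g b => // n IH g b hn g0 b0.
wlog gb : g b hn g0 b0 / (size g <= size b)%N.
  move=> W; have [/W|/ltnW] := leqP (size g) (size b); first exact.
  rewrite addnC in hn; move=> /(W b g hn b0 g0)[X [Y [Z [nz h]]]].
  by exists X, Z, Y; rewrite [(Z != 0) || _]orbC addrC.
have [c [rs [c0 bE]]] := split_poly b0.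
have [urs|nurs] := boolP (uniq rs); last first.
  have [x [b' bE']] : exists x b', b = ('X - x%:P) ^+ 2 * b'.
    rewrite bE; elim: rs nurs {bE} => //= x rs IHrs; rewrite negb_and negbK.
    case/orP => [xrs|/IHrs[y [b' h]]].
      exists x, (c *: \prod_(y <- rem x rs) ('X - y%:P)).
      by rewrite big_cons (big_rem x xrs) /= mulrA expr2 scalerAr.
    by exists y, (('X - x%:P) * b'); rewrite big_cons scalerAr h mulrCA.
  have b'0 : b' != 0 by apply: contraNneq b0 => h; rewrite bE' h mulr0.
  have [|//|//|X [Y [Z [nz h]]]] := IH g b'.
    rewrite -ltnS (leq_trans _ hn) // ltnS ltn_add2l bE' mulrC.
    rewrite size_Mmonic ?monic_exp ?monicXsubC // size_exp_XsubC //.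
    by rewrite addnS -[X in (X < _)%N]addn0 ltn_add2l.
  have X0 := polyXsubC_eq0 x.
  exists (('X - x%:P) * X), (('X - x%:P) * Y), Z; rewrite !mulf_eq0 X0 /=; split=> //.
  rewrite exprMn h bE'; ring.
have sb : size b = (size rs).+1 by rewrite bE size_scale // size_prod_XsubC.
have [rs0|rs0] := eqVneq (size rs) 0%N.
  have [x xE] := closed_sqrt c.
  exists x%:P, 0, 1; rewrite oner_neq0 !orbT -polyC_exp xE bE (size0nil rs0).
  by rewrite big_nil alg_polyC; split=> //; ring.
have [r [sr]] := sqrt_mod g urs.
rewrite -(dvdpZl _ _ c0) -bE => /dvdpP[b1 b1E].
have [b10|b10] := eqVneq b1 0.
  exists r, 1, 0; rewrite oner_neq0 orbT expr1n expr0n mulr0 addr0 mulr1; split=> //.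
  by apply/eqP; rewrite -subr_eq0 b1E b10 mul0r.
have sb1 : (size b1 < size b)%N.
  have h : (size (b1 * b)%R <= maxn (size (r ^+ 2)%R) (size g))%N.
    by rewrite -b1E (leq_trans (size_polyD _ _)) // size_polyN.
  have h2 : (size (r ^+ 2)%R <= (size rs + size rs).-1)%N.
    by rewrite expr2 (leq_trans (size_polyMleq _ _)) // -!subn1 leq_sub2r // leq_add.
  rewrite size_mul // sb addnS /= in h; move: h h2 gb rs0; rewrite sb leq_max.
  by move: (size b1) (size g) (size (r ^+ 2)) (size rs); clear; lia.
have [|//|//|X [Y [Z [nz h1]]]] := IH g b1.
  by rewrite -ltnS (leq_trans _ hn) // ltnS ltn_add2l.
(* Multiplicativity of the norm u^2 - g v^2: the element X + Y sqrt g, of norm b1 Z^2, times r +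
   sqrt g, of norm b1 b, has norm b (b1 Z)^2. *)
exists (X * r + g * Y), (X + r * Y), (b1 * Z); split; last first.
  have -> : b * (b1 * Z) ^+ 2 = (r ^+ 2 - g) * (b1 * Z ^+ 2) by rewrite b1E; ring.
  have -> : b1 * Z ^+ 2 = X ^+ 2 - g * Y ^+ 2 by rewrite h1; ring.
  ring.
rewrite -!negb_and; apply: contraTN nz => /and3P[/eqP e1 /eqP e2 e3].
move: e3; rewrite mulf_eq0 (negbTE b10) /= => /eqP Z0.
have XE : X = - (r * Y) by apply/eqP; rewrite -addr_eq0 e2.
have : (b1 * b) * Y == 0.
  by rewrite -b1E -oppr_eq0 -[X in _ == X]e1 XE; apply/eqP; ring.
rewrite !mulf_eq0 (negbTE b10) (negbTE b0) /= => /eqP Y0.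
by rewrite XE Y0 Z0 mulr0 oppr0 !eqxx.
Qed.

Lemma conic_point (a b c d e g : {poly F}) : exists x y z,
  [|| x != 0, y != 0 | z != 0] /\
  a * x ^+ 2 + b * y ^+ 2 + c * z ^+ 2 + d * x * y + e * x * z + g * y * z = 0.
Proof.
have [a0|a0] := eqVneq a 0.
  by exists 1, 0, 0; rewrite oner_neq0 a0; split=> //; ring.
(* Completing squares: 4 a q = (2 a x + d y + e z)^2 + A y^2 + 2 B y z + C z^2
   and A (A y^2 + 2 B y z + C z^2) = (A y + B z)^2 + D z^2. *)
pose A := 4%:R * a * b - d ^+ 2; pose B := 2%:R * a * g - d * e.
pose C := 4%:R * a * c - e ^+ 2; pose D := A * C - B ^+ 2.
have two : 2%:R != 0 :> {poly F} by rewrite -polyC_natr polyC_eq0.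
have four : 4%:R != 0 :> {poly F} by rewrite (natrM _ 2 2) mulf_neq0.
have cancel x y z : (2%:R * a * x + d * y + e * z) ^+ 2 + A * y ^+ 2 +
    2%:R * B * y * z + C * z ^+ 2 = 0 ->
  a * x ^+ 2 + b * y ^+ 2 + c * z ^+ 2 + d * x * y + e * x * z + g * y * z = 0.
  move=> h; apply: (mulfI (mulf_neq0 four a0)); rewrite mulr0 -[RHS]h /A /B /C; ring.
have [A0|A0] := eqVneq A 0.
  exists (- d), (2%:R * a), 0; rewrite mulf_neq0 // orbT; split=> //.
  by apply: cancel; rewrite A0; ring.
have [L [M [z [nz h]]]] : exists L M z, [|| L != 0, M != 0 | z != 0] /\
    M ^+ 2 + D * z ^+ 2 + A * L ^+ 2 = 0.
  have [D0|D0] := eqVneq D 0.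
    by exists 0, 0, 1; rewrite oner_neq0 !orbT D0; split=> //; ring.
  have [||M [L [z [nz h]]]] := @legendre (- A) (- D); rewrite ?oppr_eq0 //.
  exists L, M, z; rewrite orbCA; split=> //; rewrite h; ring.
(* Back substitution scaled by 2 a A to avoid denominators: the forms 2 a x + d y + e z and A y + B
   z take the values 2 a A L and 2 a A M. *)
exists (A * L - d * (M - B * z) - e * A * z), (2%:R * a * (M - B * z)), (2%:R * a * A * z).
split; last first.
  apply: cancel; apply: (mulfI A0); rewrite mulr0.
  transitivity (4%:R * a ^+ 2 * A ^+ 2 * (M ^+ 2 + D * z ^+ 2 + A * L ^+ 2)).
    by rewrite /D; ring.
  by rewrite h mulr0.
rewrite -!negb_and; apply: contraTN nz => /and3P[e1 e2 e3].
move: e3; rewrite !mulf_eq0 (negbTE two) (negbTE a0) (negbTE A0) /= => /eqP z0.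
move: e2; rewrite z0 mulr0 subr0 !mulf_eq0 (negbTE two) (negbTE a0) /= => /eqP M0.
move: e1; rewrite z0 M0 !mulr0 !subr0 mulr0 subr0 mulf_eq0 (negbTE A0) /= => /eqP L0.
by rewrite L0 !eqxx.
Qed.
End Conics.

(** * The field of rational functions in one variable *)

Lemma fraction_of (R : idomainType) (n : {fraction R}) :
  exists p q : R, q != 0 /\ n * tofrac q = tofrac p.
Proof.
elim/quotW: n => x; have d0 := denom_ratioP x.
exists (frac x).1, (frac x).2; split=> //; rewrite [LHS]/GRing.mul /= !piE.
apply/eqmodP; rewrite /= FracField.equivfE /FracField.mulf.
by rewrite !numden_Ratio ?mulf_neq0 ?oner_neq0 // !mulr1 mulrC.
Qed.

Lemma tofrac_inj (R : idomainType) : injective (@tofrac R).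
Proof. by move=> p q /eqP; rewrite tofrac_eq => /eqP. Qed.

(* N is the field K(var) of rational functions. It is kept abstract because
   unification is very slow on the concrete type {fraction {poly K}}. *)
Section RationalFunctions.
Variables (K N : fieldType) (tofr : {rmorphism {poly K} -> N}).
Hypothesis tofr_inj : injective tofr.
Hypothesis tofr_frac : forall n, exists p q, q != 0 /\ n * tofr q = tofr p.

Definition cst : K -> N := tofr \o polyC.
HB.instance Definition _ := GRing.RMorphism.on cst.

Definition var : N := tofr 'X.

Lemma tofr_eq0 p : (tofr p == 0) = (p == 0).
Proof. by rewrite -(inj_eq tofr_inj) rmorph0. Qed.

Lemma ev1_var p : (map_poly cst p).[var] = tofr p.
Proof.
elim/poly_ind: p => [|p c IH]; first by rewrite !rmorph0 horner0.
rewrite rmorphD rmorphM /= map_polyX map_polyC hornerMXaddC IH.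
by rewrite rmorphD rmorphM.
Qed.

Lemma fracE (n : N) : exists p q : {poly K},
  [/\ q != 0, coprimep p q & n * tofr q = tofr p].
Proof.
have [p [q [q0 h]]] := tofr_frac n.
have g0 : gcdp p q != 0 by rewrite gcdp_eq0 (negbTE q0) andbF.
exists (p %/ gcdp p q), (q %/ gcdp p q); split.
- by rewrite dvdp_div_eq0 ?dvdp_gcdr.
- by rewrite coprimep_div_gcd // q0 orbT.
apply: (mulIf (_ : tofr (gcdp p q) != 0)); first by rewrite tofr_eq0.
by rewrite -mulrA -!rmorphM /= !divpK ?dvdp_gcdl ?dvdp_gcdr.
Qed.

Definition num n : {poly K} := sval (cid (fracE n)).
Definition den n : {poly K} := sval (cid (svalP (cid (fracE n)))).

Lemma num_den n : [/\ den n != 0, coprimep (num n) (den n) & n * tofr (den n) = tofr (num n)].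
Proof. exact: svalP (cid (svalP (cid (fracE n)))). Qed.

(** The derivation d/d[var], by the quotient rule on a chosen fraction; [dfrE] shows that the choice
    does not matter. *)
Definition dfr_def (n : N) : N :=
  tofr ((num n)^`() * den n - num n * (den n)^`()) / tofr (den n) ^+ 2.

Definition dfr := locked dfr_def.

Lemma dfrE n p q : q != 0 -> n * tofr q = tofr p ->
  dfr n * tofr q ^+ 2 = tofr (p^`() * q - p * q^`()).
Proof.
move=> q0 h; rewrite /dfr -lock /dfr_def; have [d0 _ h1] := num_den n.
have : num n * q = p * den n.
  by apply: tofr_inj; rewrite !rmorphM /= -h -h1; ring.
move: (num n) (den n) d0 {h1} => u v v0 e.
have := congr1 (@deriv _) e; rewrite !derivM => e'.
have v0' : tofr v ^+ 2 != 0 by rewrite expf_neq0 // tofr_eq0.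
apply: (mulIf v0'); rewrite mulrAC divfK // -!rmorphXn -!rmorphM /=; congr (tofr _).
have -> : (u^`() * v - u * v^`()) * q ^+ 2 =
  v * q * (u^`() * q + u * q^`()) - (u * q) * (v^`() * q + v * q^`()) by ring.
rewrite e' e; ring.
Qed.

Lemma dfr_tofr p : dfr (tofr p) = tofr p^`().
Proof.
have := @dfrE (tofr p) p 1 (oner_neq0 _); rewrite rmorph1 mulr1 expr1n mulr1.
by move=> ->; rewrite // derivC mulr0 subr0 mulr1.
Qed.

Lemma dfr_cst c : dfr (cst c) = 0.
Proof. by rewrite dfr_tofr derivC rmorph0. Qed.

Lemma dfr_var : dfr var = 1.
Proof. by rewrite dfr_tofr derivX rmorph1. Qed.

Lemma dfrD m n : dfr (m + n) = dfr m + dfr n.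
Proof.
have [v0 _ hm] := num_den m; have [w0 _ hn] := num_den n.
move: (num m) (den m) (num n) (den n) v0 w0 hm hn => u v x w v0 w0 hm hn.
have h : (m + n) * tofr (v * w) = tofr (u * w + x * v).
  by rewrite rmorphD !rmorphM /= -hm -hn; ring.
have vw0 : tofr (v * w) ^+ 2 != 0 by rewrite expf_neq0 // tofr_eq0 mulf_neq0.
apply: (mulIf vw0); rewrite (dfrE _ h) ?mulf_neq0 //.
transitivity (dfr m * tofr v ^+ 2 * tofr w ^+ 2 + dfr n * tofr w ^+ 2 * tofr v ^+ 2).
rewrite (dfrE v0 hm) (dfrE w0 hn) -!rmorphXn -!rmorphM -rmorphD /=; congr (tofr _).
  by rewrite derivD !derivM; ring.
by rewrite rmorphM /=; ring.
Qed.

Lemma dfrM m n : dfr (m * n) = dfr m * n + m * dfr n.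
Proof.
have [v0 _ hm] := num_den m; have [w0 _ hn] := num_den n.
move: (num m) (den m) (num n) (den n) v0 w0 hm hn => u v x w v0 w0 hm hn.
have h : (m * n) * tofr (v * w) = tofr (u * x).
  by rewrite !rmorphM /= -hm -hn; ring.
have vw0 : tofr (v * w) ^+ 2 != 0 by rewrite expf_neq0 // tofr_eq0 mulf_neq0.
apply: (mulIf vw0); rewrite (dfrE _ h) ?mulf_neq0 //.
transitivity (dfr m * tofr v ^+ 2 * (n * tofr w) * tofr w +
    dfr n * tofr w ^+ 2 * (m * tofr v) * tofr v).
  rewrite (dfrE v0 hm) (dfrE w0 hn) hm hn -!rmorphM -rmorphD /=; congr (tofr _).
  by rewrite !derivM; ring.
by rewrite rmorphM /=; ring.
Qed.

Lemma dfr0 : dfr 0 = 0.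
Proof. by rewrite -{1}(rmorph0 cst) dfr_cst. Qed.

Lemma var_transcendental p : (map_poly cst p).[var] = 0 -> p = 0.
Proof. by rewrite ev1_var => /eqP; rewrite tofr_eq0 => /eqP. Qed.

(** One power of v clears the denominators of P(u / v) both in N and at points, so that an identity
    in N can be evaluated in K. *)
Lemma specialize (u v : {poly K}) g P : g * tofr v = tofr u ->
  exists m h, (map_poly cst P).[g] * tofr v ^+ m = tofr h /\
    forall x, v.[x] != 0 -> h.[x] = v.[x] ^+ m * P.[u.[x] / v.[x]].
Proof.
move=> hg; elim/poly_ind: P => [|P c [m [h [h1 h2]]]].
  exists 0%N, 0; split; first by rewrite !rmorph0 horner0 mul0r.
  by move=> x _; rewrite !horner0 mulr0.
exists m.+1, (h * u + c%:P * v ^+ m.+1); split.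
  rewrite rmorphD rmorphM /= map_polyX map_polyC hornerMXaddC exprS.
  rewrite rmorphD !rmorphM rmorphXn /= -h1 -hg /cst /= exprS; ring.
move=> x vx; rewrite hornerMXaddC hornerD hornerM hornerCM horner_exp h2 // exprS.
set y := _ / _; have -> : u.[x] = y * v.[x] by rewrite divfK.
by ring.
Qed.

Hypothesis Kcl : alg_closed K.
Hypothesis K0 : [pchar K] =i pred0.

Lemma deriv_eq0 (p : {poly K}) : p^`() = 0 -> (size p <= 1)%N.
Proof.
move=> h; rewrite leqNgt; apply/negP => sp.
have := congr1 (fun q : {poly K} => q`_(size p).-2) h; rewrite coef_deriv coef0.
have -> : ((size p).-2.+1 = (size p).-1)%N by case: (size p) sp => [|[]].
move/eqP; rewrite -mulr_natr mulf_eq0 -lead_coefE lead_coef_eq0.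
have /pcharf0P -> := K0.
by rewrite -size_poly_eq0; case: (size p) sp => [|[]].
Qed.

(* If var is a rational function of g = u / v, then the fibres of g have at
   most one point, so u - c v is a power of a linear form for almost all c; if
   the exponent were > 1 the Wronskian of u and v would have infinitely many
   zeros. *)
Lemma mobius g A B : (map_poly cst B).[g] != 0 ->
  var * (map_poly cst B).[g] = (map_poly cst A).[g] ->
  exists a b c d, a * d - b * c != 0 /\
    g * (cst c * var + cst d) = cst a * var + cst b.
Proof.
move=> Bg0 hg; have [v0 cop gE] := num_den g.
move: (num g) (den g) v0 cop gE => u v v0 cop gE.
have B0 : B != 0 by apply: contraNneq Bg0 => ->; rewrite rmorph0 horner0.
have [mA [hA [hA1 hA2]]] := specialize A gE.
have [mB [hB [hB1 hB2]]] := specialize B gE.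
have val x : v.[x] != 0 -> x * B.[u.[x] / v.[x]] = A.[u.[x] / v.[x]].
  move=> vx; have e : 'X * hB * v ^+ mA = hA * v ^+ mB.
    apply: tofr_inj; rewrite !rmorphM !rmorphXn /= -hA1 -hB1 -hg; rewrite /var; ring.
  have := congr1 (horner^~ x) e; rewrite /= !hornerE hA2 // hB2 // => e'.
  apply: (mulfI (expf_neq0 (mA + mB) vx)); rewrite exprD.
  set y := _ / _ in e' *; transitivity (x * (v.[x] ^+ mB * B.[y]) * v.[x] ^+ mA).
    by ring.
  by rewrite e'; ring.
have nconst c : g <> cst c.
  move=> gc; move: hg Bg0; rewrite gc !horner_map /= => hg /negP; apply.
  have : (map_poly cst (B.[c] *: 'X - (A.[c])%:P)).[var] = 0.
    rewrite rmorphB /= map_polyZ map_polyX map_polyC !hornerE /=.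
    by rewrite mulrC hg subrr.
  move/var_transcendental/polyP/(_ 1%N); rewrite coefB coefZ coefX coefC coef0 /=.
  by rewrite mulr1 subr0 => ->; rewrite rmorph0.
have gconst x : u = x *: v -> False.
  move=> ux; apply: (nconst x); apply: (mulIf (_ : tofr v != 0)); first by rewrite tofr_eq0.
  by rewrite gE ux -mul_polyC rmorphM.
have [le2|gt2] := leqP (maxn (size u) (size v)) 2.
  have lin (p : {poly K}) : (size p <= 2)%N -> tofr p = cst p`_1 * var + cst p`_0.
    move=> sp; rewrite -[p]coefK -(ev1_var (\poly_(i < _) _)).
    rewrite coefK (@horner_coef_wide _ 2) ?(leq_trans (size_poly _ _)) //.
    by rewrite !big_ord_recl big_ord0 !coef_map /= addr0 expr0 mulr1 addrC.
  move: le2; rewrite geq_max => /andP[su sv].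
  exists u`_1, u`_0, v`_1, v`_0; rewrite -!lin //; split=> //.
  rewrite subr_eq0; apply/negP => /eqP det.
  have ext (p q : {poly K}) : (size p <= 2)%N -> (size q <= 2)%N ->
      p`_0 = q`_0 -> p`_1 = q`_1 -> p = q.
    move=> sp sq e0 e1; apply/polyP => -[|[|i]] //.
    by rewrite !nth_default // ?(leq_trans sp) ?(leq_trans sq).
  have sZ x : (size (x *: v) <= 2)%N by rewrite (leq_trans (size_scale_leq _ _)).
  have [v1|v1] := eqVneq v`_1 0.
    have v00 : v`_0 != 0.
      by apply: contraNneq v0 => v00; rewrite (ext v 0) ?size_poly0 ?coef0.
    have u1 : u`_1 = 0.
      by move/eqP: det; rewrite v1 mulr0 mulf_eq0 (negbTE v00) orbF => /eqP.
    apply: (gconst (u`_0 / v`_0)); apply: ext; rewrite ?sZ // coefZ ?divfK //.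
    by rewrite v1 mulr0.
  apply: (gconst (u`_1 / v`_1)); apply: ext; rewrite ?sZ // coefZ ?divfK //.
  by rewrite mulrAC det mulfK.
exfalso; pose k := (maxn (size u) (size v)).-1.
have k1 : (maxn (size u) (size v) = k.+1)%N by rewrite /k prednK // (leq_trans _ gt2).
have k2 : (1 < k)%N by rewrite -ltnS -k1.
have su : (size u <= k.+1)%N by rewrite -k1 leq_maxl.
have sv : (size v <= k.+1)%N by rewrite -k1 leq_maxr.
pose W := u^`() * v - u * v^`().
(* A zero Wronskian would make u divide u', so u' = 0, and then u = 0 or v' = 0; in characteristic 0
   this contradicts the degrees or the nonconstancy of g. *)
have [W0|W0] := eqVneq W 0.
  have e : u^`() * v = u * v^`() by apply/eqP; rewrite -subr_eq0 -/W W0.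
  have : u %| u^`() by rewrite -(Gauss_dvdpl _ cop) e dvdp_mulIl.
  have [u'0 _|u'0 /(dvdp_leq u'0)] := eqVneq u^`() 0; last first.
    rewrite leqNgt lt_size_deriv //.
    by apply: contraNneq u'0 => ->; rewrite derivC.
  move/eqP: e; rewrite u'0 mul0r eq_sym mulf_eq0 => /orP[/eqP u0|/eqP/deriv_eq0 v'].
    by apply: (gconst 0); rewrite u0 scale0r.
  have := deriv_eq0 u'0; move: gt2; rewrite leq_max ltnNge.
  by case/orP; rewrite ?ltnNge => /negP h1 h2; apply: h1; rewrite leqW.
have [cW [rs [cW0 WE]]] := split_poly Kcl W0.
(* A nonroot y of D is not a zero of B, keeps the degree of u - y v equal to k, and is not a value
   of g at a zero of the Wronskian. A zero of v among [rs] merely excludes the value 0 as well. *)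
pose D := B * ((u`_k)%:P - v`_k *: 'X) *
  \prod_(l <- [seq u.[x] / v.[x] | x <- rs]) ('X - l%:P).
have D0 : D != 0.
  apply: mulf_neq0; last by rewrite monic_neq0 ?monic_prod_XsubC.
  apply: mulf_neq0 => //.
  apply/negP => /eqP/polyP h; move: (h 1%N) (h 0%N).
  rewrite !coefB !coefZ !coefX !coefC ?coef0 /= mulr1 mulr0 sub0r subr0.
  move=> /eqP; rewrite oppr_eq0 => /eqP vk uk.
  have lt (p : {poly K}) : (size p <= k.+1)%N -> p`_k = 0 -> (size p <= k)%N.
    rewrite leq_eqVlt => /orP[/eqP sp pk|//].
    have : lead_coef p = 0 by rewrite lead_coefE sp.
    by move=> /eqP; rewrite lead_coef_eq0 => /eqP p0; rewrite p0 size_poly0 in sp.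
  by have := ltnn k; rewrite -k1 -ltnS /= gtn_max !ltnS ?lt //; rewrite -k1 ltnn.
have [y] := nonroot Kcl D0; rewrite !hornerM !mulf_eq0 !negb_or.
move=> /andP[/andP[By ky] Ly]; pose w := u - y *: v.
have sw : (k < size w)%N.
  rewrite ltnNge; apply/negP => /leq_sizeP/(_ k (leqnn k)) h.
  by move: ky; rewrite !hornerE mulrC; move: h; rewrite coefB coefZ => ->; rewrite eqxx.
have rw x : root w x -> v.[x] != 0 /\ u.[x] = y * v.[x].
  move=> /rootP; rewrite !hornerE => /eqP; rewrite subr_eq0 => /eqP ux.
  split=> //; apply/negP => /eqP vx; have := coprimep_root cop (x := x).
  by rewrite rootE ux vx mulr0 eqxx => /(_ isT).
have rootE x : root w x -> x = A.[y] / B.[y].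
  move=> /rw[vx ux]; have := val x vx; rewrite ux mulfK // => <-.
  by rewrite mulfK.
have [x xw] : exists x, root w x by apply: Kcl; rewrite gtn_eqF // (leq_trans _ sw) // ltnW.
have [q qE] := factor_theorem _ _ xw.
have sq : (1 < size q)%N.
  have q0 : q != 0 by apply: contraTneq sw => q0; rewrite /w -/w qE q0 mul0r size_poly0.
  by move: sw; rewrite qE size_Mmonic ?monicXsubC // size_XsubC addn2 /= ltnS; exact: (leq_trans k2).
have [x' x'q] : exists x', root q x' by apply: Kcl; rewrite gtn_eqF.
have xx' : x' = x.
  rewrite (rootE _ xw); apply: rootE.
  by rewrite qE rootM x'q.
have w'x : w^`().[x] = 0.
  rewrite qE derivM derivXsubC !hornerE subrr mulr0 add0r.
  by apply/rootP; rewrite -xx'.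
have [vx ux] := rw x xw.
have : root W x.
  apply/rootP; move: w'x; rewrite /w /W derivB derivZ !hornerE => /eqP.
  by rewrite subr_eq0 => /eqP ->; rewrite ux; ring.
rewrite WE rootZ // root_prod_XsubC => xrs.
move: Ly; rewrite -/(root _ _) root_prod_XsubC => /negP; apply.
by apply/mapP; exists x => //; rewrite ux mulfK.
Qed.
End RationalFunctions.

(** * Descent to subfields *)

Section Subfields.
Variable F : fieldType.

(** A propositional predicate, since the subfields that occur are defined by existence of fractions
    or as unions of chains; [sf_type] turns it into a field over which polynomials can be formed. *)
Record subfield := Subfield {
  carrier :> F -> Prop;
  carrier1 : carrier 1;
  carrierB : forall x y, carrier x -> carrier y -> carrier (x - y);
  carrier_div : forall x y, carrier x -> carrier y -> carrier (x / y) }.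

Variable S : subfield.

Lemma carrierM x y : S x -> S y -> S (x * y).
Proof.
move=> hx hy; have h := carrier_div hx (carrier_div (carrier1 S) hy).
by rewrite div1r invrK in h.
Qed.

Definition sf_pred : {pred F} := fun x => `[< S x >].

Fact sf_closed : divring_closed sf_pred.
Proof.
split=> [|x y /asboolP hx /asboolP hy|x y /asboolP hx /asboolP hy]; apply/asboolP.
- exact: carrier1.
- exact: carrierB.
- exact: carrier_div.
Qed.

HB.instance Definition _ := GRing.isDivringClosed.Build F sf_pred sf_closed.

Record sf_type := SfType { sf_val : F; _ : sf_val \in sf_pred }.
HB.instance Definition _ := [isSub for sf_val].
HB.instance Definition _ := [Choice of sf_type by <:].
HB.instance Definition _ := [SubChoice_isSubIntegralDomain of sf_type by <:].
HB.instance Definition _ := [SubIntegralDomain_isSubField of sf_type by <:].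

HB.instance Definition _ := GRing.RMorphism.copy sf_val (val : sf_type -> F).

Lemma sf_valP (x : sf_type) : S (sf_val x).
Proof. by case: x => x /= /asboolP. Qed.

Lemma sf_lift x : S x -> exists y, sf_val y = x.
Proof. by move=> /asboolP Sx; exists (SfType (Sx : x \in sf_pred)). Qed.

End Subfields.

Section Descent.
Variables (K N : fieldType) (cK : {rmorphism K -> N}) (M : subfield N).
Hypothesis Kcl : alg_closed K.
Hypothesis K0 : [pchar K] =i pred0.
Local Notation M0 := (sf_type M).
Local Notation psi := (@sf_val N M).
Local Notation at_ H w := ((map_poly psi H).[cK w]).

Definition constants : subfield K.
Proof.
exists (fun c => M (cK c)); first by rewrite rmorph1; exact: carrier1.
- by move=> x y hx hy; rewrite rmorphB; exact: carrierB.
- by move=> x y hx hy; rewrite fmorph_div; exact: carrier_div.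
Defined.
Local Notation k1 := (sf_type constants).
Local Notation val1 := (@sf_val K constants).

Hypothesis algK : forall c : K, exists2 P : {poly k1}, P != 0 & root (map_poly val1 P) c.

Lemma psi_inj : injective psi. Proof. exact: fmorph_inj. Qed.

Definition emb (c : k1) : M0 := sval (cid (sf_lift (sf_valP c : M (cK (val1 c))))).

Lemma embE c : psi (emb c) = cK (val1 c).
Proof. exact: svalP (cid (sf_lift (sf_valP c : M (cK (val1 c))))). Qed.

Fact emb_zmod : zmod_morphism emb.
Proof. by move=> x y; apply: psi_inj; rewrite [RHS]rmorphB /= !embE !rmorphB. Qed.
Fact emb_monoid : monoid_morphism emb.
Proof.
split=> [|x y]; apply: psi_inj; first by rewrite embE !rmorph1.
by rewrite [RHS]rmorphM /= !embE !rmorphM.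
Qed.
HB.instance Definition _ := GRing.isZmodMorphism.Build k1 M0 emb emb_zmod.
HB.instance Definition _ := GRing.isMonoidMorphism.Build k1 M0 emb emb_monoid.

Lemma at_emb (C : {poly k1}) w : at_ (map_poly emb C) w = cK (map_poly val1 C).[w].
Proof.
rewrite -horner_map -!map_poly_comp; congr (_.[_]).
by apply: eq_map_poly => c /=; rewrite embE.
Qed.

Lemma pchar_k1 : [pchar k1] =i pred0.
Proof. by move=> p; rewrite -(K0 p) (fmorph_pchar val1). Qed.

Lemma primitive_element (cs : seq K) : exists z, forall c, c \in cs ->
  exists C : {poly k1}, (map_poly val1 C).[z] = c.
Proof.
elim: cs => [|c cs [z hz]]; first by exists 0.
have [P P0 Pz] := algK z; have [Q Q0 Qc] := algK c.
have [n [[r1 h1] [r2 h2]]] := pchar0_PET P0 Pz Q0 Qc pchar_k1.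
exists (c *+ n - z) => d; rewrite inE => /orP[/eqP->|/hz[C Cd]]; first by exists r2.
by exists (C \Po r1); rewrite map_comp_poly horner_comp h1.
Qed.

(** zs consists of the roots of the minimal polynomial mu of z over M. They lie in K because mu
    divides a polynomial over K [&] M, which splits in K; by separability their number is deg mu. So
    M[z] is a field, relations over M pass from z to each w, and the remainder modulo mu has size at
    most [size zs]. *)
Lemma conjugates z : exists zs : seq K, [/\ uniq zs, z \in zs,
  forall H : {poly M0}, at_ H z = 0 -> forall w, w \in zs -> at_ H w = 0,
  forall H : {poly M0}, at_ H z != 0 -> exists G, at_ (G * H) z = 1 &
  (forall H : {poly M0}, (size H <= size zs)%N -> at_ H z = 0 -> H = 0) /\
  forall H : {poly M0}, exists H' : {poly M0}, (size H' <= size zs)%N /\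
    forall w, w \in zs -> at_ H' w = at_ H w].
Proof.
have [P P0 Pz] := algK z.
pose ann n := `[< exists H : {poly M0}, [/\ size H = n, H != 0 & at_ H z = 0] >].
have [|n /asboolP[mu [smu mu0 muz]] minmu] := @ex_minnP ann.
  exists (size (map_poly emb P)); apply/asboolP; exists (map_poly emb P).
  by rewrite map_poly_eq0 at_emb (rootP Pz) rmorph0.
have {smu minmu} minmu H : H != 0 -> at_ H z = 0 -> (size mu <= size H)%N.
  by move=> H0 Hz; rewrite smu; apply: minmu; apply/asboolP; exists H.
have dvdmu H : at_ H z = 0 -> mu %| H.
  move=> Hz; apply/modp_eq0P/eqP; apply: contraT => r0.
  have rz : at_ (H %% mu) z = 0.
    have := congr1 (fun p => at_ p z) (divp_eq H mu).
    by rewrite rmorphD rmorphM /= hornerD hornerM muz mulr0 add0r Hz.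
  by have := minmu _ r0 rz; rewrite leqNgt ltn_modpN0.
have copmu H : at_ H z != 0 -> coprimep H mu.
  move=> Hz; have := dvdp_gcdl H mu; have := dvdp_gcdr H mu.
  rewrite coprimep_def; move: (gcdp_eq0 H mu); rewrite (negbTE mu0) andbF.
  move: (gcdp H mu) => d d0 /dvdpP[e muE] /dvdpP[e' HE].
  have dz : at_ d z != 0.
    by apply: contraNneq Hz => dz; rewrite HE rmorphM hornerM dz mulr0.
  have e0 : e != 0 by apply: contraNneq mu0 => e0; rewrite muE e0 mul0r.
  have ez : at_ e z = 0.
    move/eqP: muz; rewrite muE rmorphM hornerM mulf_eq0 (negbTE dz) orbF.
    by move/eqP.
  have := minmu e e0 ez; rewrite muE size_mul ?d0 //.
  have : (0 < size d)%N by rewrite size_poly_gt0 d0.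
  have : (0 < size e)%N by rewrite size_poly_gt0.
  by move: (size d) (size e) => [|[|a]] [|b] //=; move=> _ _; rewrite !addnS ltnS ltnNge leq_addr.
have mu1 : (1 < size mu)%N.
  rewrite ltnNge; apply/negP => /size1_polyC muc; move: mu0 muz.
  by rewrite muc map_polyC hornerC polyC_eq0 /= => /negP h /eqP; rewrite fmorph_eq0.
have sepmu : separable_poly mu.
  rewrite separable_poly.unlock coprimep_sym; apply: copmu.
  apply/negP => /eqP /(minmu) h.
  have d0 : mu^`() != 0.
    apply/negP => /eqP d0; have := congr1 (fun p : {poly M0} => p`_(size mu).-2) d0.
    rewrite coef_deriv coef0 (_ : (size mu).-2.+1 = (size mu).-1)%N; last first.
      by case: (size mu) mu1 => [|[]].
    move/eqP; rewrite -mulr_natr mulf_eq0 -lead_coefE lead_coef_eq0 (negbTE mu0) /=.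
    rewrite -(fmorph_eq0 psi) rmorph_nat -(rmorph_nat cK) fmorph_eq0.
    have /pcharf0P -> := K0; by case: (size mu) mu1 => [|[]].
  by have := h d0; rewrite leqNgt lt_size_deriv.
have [|c [rs [c0 PE]]] := @split_poly _ Kcl (map_poly val1 P).
  by rewrite map_poly_eq0.
have : map_poly psi mu %| \prod_(x <- rs) ('X - (cK x)%:P).
  rewrite -(dvdpZr _ _ (_ : cK c != 0)) ?fmorph_eq0 //.
  rewrite (_ : _ *: _ = map_poly psi (map_poly emb P)).
    by rewrite dvdp_map; apply: dvdmu; rewrite at_emb (rootP Pz) rmorph0.
  rewrite -map_poly_comp (eq_map_poly (g := cK \o val1)); last first.
    by move=> x /=; rewrite embE.
  rewrite map_poly_comp PE map_polyZ rmorph_prod; congr (_ *: _).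
  by apply: eq_bigr => x _; rewrite rmorphB /= map_polyX map_polyC.
move=> /dvdp_prod_XsubC[m muE]; set zs := mask m rs in muE.
have szs : size zs = (size mu).-1.
  by rewrite -(size_map_poly psi) (eqp_size muE) size_prod_XsubC.
have rootzs w : w \in zs -> at_ mu w = 0.
  move=> wzs; apply/rootP; rewrite (eqp_root muE).
  by rewrite -(big_map cK predT (fun x => 'X - x%:P)) root_prod_XsubC map_f.
exists zs; split.
- have : separable_poly (map_poly psi mu) by rewrite separable_map.
  rewrite (eqp_separable muE) -(big_map cK predT (fun x => 'X - x%:P)).
  by rewrite separable_prod_XsubC (map_inj_uniq (fmorph_inj cK)).
- have : root (map_poly psi mu) (cK z) by apply/rootP.
  rewrite (eqp_root muE) -(big_map cK predT (fun x => 'X - x%:P)).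
  by rewrite root_prod_XsubC (mem_map (fmorph_inj cK)).
- move=> H /dvdmu/dvdpP[q ->] w /rootzs wz.
  by rewrite rmorphM hornerM wz mulr0.
- move=> H /copmu/Bezout_eq1_coprimepP[[U V] /= e]; exists U.
  have -> : U * H = 1 - V * mu by rewrite -e addrK.
  by rewrite rmorphB rmorph1 rmorphM /= hornerD hornerN hornerM muz mulr0 subr0 hornerC.
split.
  move=> H sH Hz; apply/eqP; apply: contraT => H0.
  have := leq_trans (minmu H H0 Hz) sH; rewrite szs.
  by case: (size mu) mu1 => // k _; rewrite ltnn.
move=> H; exists (H %% mu); split.
  by have := ltn_modpN0 H mu0; rewrite szs; case: (size mu) mu1.
move=> w /rootzs wz; have := congr1 (fun p => at_ p w) (divp_eq H mu).
by rewrite rmorphD rmorphM /= hornerD hornerM wz mulr0 add0r => ->.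
Qed.

Record subspace := Subspace {
  vec :> N -> Prop;
  vec0 : vec 0;
  vecD : forall x y, vec x -> vec y -> vec (x + y);
  vecZ : forall c x, vec x -> vec (x * cK c) }.

(** By Lagrange interpolation the coefficients of H are K-linear combinations of its values. For H
    over M and conjugate points, this finds elements of M in a space stable under conjugation. *)
Lemma coef_subspace (V : subspace) (zs : seq K) (H : {poly N}) : uniq zs ->
  (size H <= size zs)%N -> (forall w, w \in zs -> V H.[cK w]) ->
  forall i, V H`_i.
Proof.
move=> uzs sH hV i.
pose L w := sval (cid (interpolation (fun x => (x == w)%:R : K) uzs)).
have LP w : (size (L w) <= size zs)%N /\ forall x, x \in zs -> (L w).[x] = (x == w)%:R.
  exact: svalP (cid (interpolation (fun x => (x == w)%:R : K) uzs)).
have -> : H = \sum_(w <- zs) H.[cK w] *: map_poly cK (L w).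
  apply/eqP; rewrite -subr_eq0; apply/eqP.
  apply: (@roots_geq_poly_eq0 _ _ (map cK zs)).
  - apply/allP => _ /mapP[x xzs ->]; apply/rootP.
    rewrite hornerD hornerN horner_sum (bigD1_seq x) //= big1_seq ?addr0.
      by rewrite hornerZ horner_map /= (LP x).2 // eqxx rmorph1 mulr1 subrr.
    move=> w /andP[wx wzs]; rewrite hornerZ horner_map /= (LP w).2 //.
    by rewrite eq_sym (negbTE wx) rmorph0 mulr0.
  - by rewrite (map_inj_uniq (fmorph_inj cK)).
  - rewrite size_map (leq_trans (size_polyD _ _)) // geq_max sH size_polyN.
    apply: (leq_trans (size_sum _ _ _)); apply/bigmax_leqP_seq => w _ _.
    by rewrite (leq_trans (size_scale_leq _ _)) // size_map_poly (LP w).1.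
rewrite coef_sum big_seq; elim/big_ind: _ => //; first exact: vec0.
  exact: vecD.
by move=> w wzs; rewrite coefZ coef_map; apply: vecZ; exact: hV.
Qed.

Definition const_space : subspace.
Proof.
exists (fun x => exists c, x = cK c); first by exists 0; rewrite rmorph0.
- by move=> _ _ [c ->] [d ->]; exists (c + d); rewrite rmorphD.
- by move=> c _ [d ->]; exists (d * c); rewrite rmorphM.
Defined.

(** M and K are linearly disjoint over their intersection. Write c i = D i(z) with D i over M
    reduced modulo the minimal polynomial of z; its coefficients also lie in K by interpolation. The
    sum of the m i D i vanishes at z, hence identically, and a suitable coefficient of it is the new
    relation. *)
Lemma linear_disjoint (I : finType) (m : I -> M0) (c : I -> K) :
  (exists i, c i != 0) -> \sum_i psi (m i) * cK (c i) = 0 ->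
  exists ka : I -> K, [/\ exists i, ka i != 0, forall i, M (cK (ka i)) &
    \sum_i psi (m i) * cK (ka i) = 0].
Proof.
move=> [i0 ci0] hc.
have [z hz] := primitive_element [seq c i | i <- enum I].
have /choice[C hC] : forall i, exists C : {poly k1}, (map_poly val1 C).[z] = c i.
  by move=> i; apply: hz; rewrite map_f // mem_enum.
have [zs [uzs zzs _ _ [minz /= red]]] := conjugates z.
have /choice[D hD] := fun i => red (map_poly emb (C i)).
have Dz i : at_ (D i) z = cK (c i) by rewrite (hD i).2 // at_emb hC.
have Dconst i l : exists d, psi (D i)`_l = cK d.
  rewrite -coef_map; apply: (@coef_subspace const_space zs) => //.
    by rewrite size_map_poly (hD i).1.
  by move=> w wzs; rewrite (hD i).2 // at_emb; eexists.
pose ka i l := sval (cid (Dconst i l)).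
have hka i l : psi (D i)`_l = cK (ka i l) := svalP (cid (Dconst i l)).
have [l Dl] : exists l, (D i0)`_l != 0.
  exists (size (D i0)).-1; rewrite -lead_coefE lead_coef_eq0.
  apply: contraNneq ci0 => D0; rewrite -(fmorph_eq0 cK) -Dz D0.
  by rewrite rmorph0 horner0.
exists (fun i => ka i l); split.
- by exists i0; rewrite -(fmorph_eq0 cK) -hka fmorph_eq0.
- by move=> i; rewrite -hka; exact: sf_valP.
have sum0 : \sum_i m i *: D i = 0.
  apply: minz.
    apply: (leq_trans (size_sum _ _ _)); apply/bigmax_leqP => i _.
    by rewrite (leq_trans (size_scale_leq _ _)) // (hD i).1.
  rewrite rmorph_sum horner_sum -[RHS]hc; apply: eq_bigr => i _.
  by rewrite /= map_polyZ hornerZ Dz.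
have := congr1 (fun p : {poly M0} => psi p`_l) sum0.
rewrite coef0 rmorph0 coef_sum rmorph_sum => h; rewrite -[RHS]h.
by apply: eq_bigr => i _; rewrite coefZ rmorphM /= hka.
Qed.

End Descent.

(** * Rational functions of one element, and conics with a point *)

Definition ev1 (K N : comNzRingType) (cK : {rmorphism K -> N}) (t : N) : {poly K} -> N :=
  horner_eval t \o map_poly cK.
HB.instance Definition _ (K N : comNzRingType) (cK : {rmorphism K -> N}) t :=
  GRing.RMorphism.on (ev1 cK t).

Lemma ev1C (K N : comNzRingType) (cK : {rmorphism K -> N}) t c : ev1 cK t c%:P = cK c.
Proof. by rewrite /ev1 /= map_polyC /horner_eval hornerC. Qed.

Lemma ev1X (K N : comNzRingType) (cK : {rmorphism K -> N}) t : ev1 cK t 'X = t.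
Proof. by rewrite /ev1 /= map_polyX /horner_eval hornerX. Qed.

Section OneVariable.
Variables (K N : fieldType) (cK : {rmorphism K -> N}).
Hypothesis Kcl : alg_closed K.
Local Notation rat t := (ratio_of (ev1 cK t)).

Lemma ev1E t P : ev1 cK t P = (map_poly cK P).[t].
Proof. by []. Qed.

Lemma ev1_root t P : P != 0 -> ev1 cK t P = 0 -> exists c, t = cK c.
Proof.
move=> P0; have [c [rs [c0 ->]]] := split_poly Kcl P0.
rewrite ev1E map_polyZ hornerZ => /eqP; rewrite mulf_eq0 fmorph_eq0 (negbTE c0) /=.
rewrite rmorph_prod horner_prod; elim: rs => [|x rs IH]; first by rewrite big_nil oner_eq0.
rewrite big_cons mulf_eq0 => /orP[|//].
by rewrite rmorphB /= map_polyX map_polyC hornerXsubC subr_eq0 => /eqP ->; exists x.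
Qed.

Lemma rat_C t c : rat t (cK c).
Proof. by exists c%:P, 1; rewrite rmorph1 oner_neq0 mulr1 /= ev1E map_polyC hornerC. Qed.

Lemma rat_X t : rat t t.
Proof. by exists 'X, 1; rewrite rmorph1 oner_neq0 mulr1 /= ev1E map_polyX hornerX. Qed.

Lemma rat_ev1 t u P : rat t u -> rat t (ev1 cK u P).
Proof.
move=> h; rewrite ev1E horner_coef; apply: ratio_of_sum => i.
by rewrite coef_map; apply: ratio_ofM; [exact: rat_C|exact: ratio_ofX].
Qed.

Lemma rat_ev2 t x y (P : {poly {poly K}}) : rat t x -> rat t y -> rat t (ev2 cK x y P).
Proof.
move=> hx hy; elim/poly2_ind: P => [c|||p q hp hq|p q hp hq].
- by rewrite ev2CC; exact: rat_C.
- by rewrite ev2X.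
- by rewrite ev2Y.
- by rewrite rmorphD; exact: ratio_ofD.
- by rewrite rmorphM; exact: ratio_ofM.
Qed.

Definition qform (R : comNzRingType) (k0 k1 k2 k3 k4 k5 x y z : R) :=
  k0 * x ^+ 2 + k1 * y ^+ 2 + k2 * z ^+ 2 + k3 * x * y + k4 * x * z + k5 * y * z.

(* Projection of the conic from its rational point (x0, x1, x2). *)
Lemma conic_projection (q0 q1 q2 : N) (k0 k1 k2 k3 k4 k5 x0 x1 x2 : K)
  (mu := q1 - q0 * cK (x1 / x0)) (nu := q2 - q0 * cK (x2 / x0)) :
  (forall c0 c1 c2, q0 * cK c0 + q1 * cK c1 + q2 * cK c2 = 0 ->
     [/\ c0 = 0, c1 = 0 & c2 = 0]) ->
  ~~ [&& k0 == 0, k1 == 0, k2 == 0, k3 == 0, k4 == 0 & k5 == 0] ->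
  qform (cK k0) (cK k1) (cK k2) (cK k3) (cK k4) (cK k5) q0 q1 q2 = 0 ->
  qform k0 k1 k2 k3 k4 k5 x0 x1 x2 = 0 -> x0 != 0 ->
  [/\ nu != 0, forall P, ev1 cK (mu / nu) P = 0 -> P = 0 &
     [/\ rat (mu / nu) (q0 / nu), rat (mu / nu) (q1 / nu) & rat (mu / nu) (q2 / nu)]].
Proof.
move=> indep knz hq hx x00.
have nu0 : nu != 0.
  apply/negP => /eqP nu0; have [|_ _ /eqP] := indep (- (x2 / x0)) 0 1.
    by rewrite -nu0 /nu rmorphN rmorph0 rmorph1; ring.
  by rewrite oner_eq0.
have tr P : ev1 cK (mu / nu) P = 0 -> P = 0.
  move=> hP; apply/eqP; apply: contraT => /ev1_root/(_ hP)[c hc].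
  have [|_ /eqP] := indep (c * (x2 / x0) - x1 / x0) 1 (- c); last by rewrite oner_eq0.
  have : mu - cK c * nu = 0 by rewrite -hc divfK // subrr.
  by move=> <-; rewrite /mu /nu rmorphB rmorph1 rmorphN rmorphM; ring.
split=> //.
set s := mu / nu; have muE : mu = s * nu by rewrite divfK.
(* b1 and b2 are the partial derivatives of the form in y and z at the point. With q = la (x0, x1,
   x2) + (0, mu, nu) the term in la^2 drops out, because the point is on the conic, so la / nu is
   determined by the linear equation [rel]. *)
pose b1 := 2%:R * k1 * x1 + k3 * x0 + k5 * x2.
pose b2 := 2%:R * k2 * x2 + k4 * x0 + k5 * x1.
pose la := q0 / cK x0; have cx0 : cK x0 != 0 by rewrite fmorph_eq0.
have q0E : q0 = la * cK x0 by rewrite divfK.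
have e c : q0 * cK (c / x0) = la * cK c by rewrite fmorph_div /la; ring.
have q1E : q1 = s * nu + la * cK x1 by rewrite -muE /mu e subrK.
have q2E : q2 = nu + la * cK x2 by rewrite /nu e subrK.
have rel : la / nu * (cK b1 * s + cK b2) + (cK k1 * s ^+ 2 + cK k5 * s + cK k2) = 0.
  apply: (mulIf (expf_neq0 2 nu0)); rewrite mul0r.
  transitivity (la * (cK b1 * s + cK b2) * nu +
     (cK k1 * s ^+ 2 + cK k5 * s + cK k2) * nu ^+ 2).
    by rewrite mulrDl -{2}[la](divfK nu0); ring.
  rewrite -[RHS]hq q0E q1E q2E.
  transitivity (qform (cK k0) (cK k1) (cK k2) (cK k3) (cK k4) (cK k5)
     (la * cK x0) (s * nu + la * cK x1) (nu + la * cK x2) -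
     la ^+ 2 * cK (qform k0 k1 k2 k3 k4 k5 x0 x1 x2)).
    by rewrite /qform /b1 /b2 !(rmorphD, rmorphM, rmorphXn, rmorph_nat); ring.
  by rewrite hx rmorph0 mulr0 subr0.
pose P : {poly K} := k1 *: 'X^2 + k5 *: 'X + k2%:P.
have PE : ev1 cK s P = cK k1 * s ^+ 2 + cK k5 * s + cK k2.
  by rewrite ev1E !rmorphD /= !map_polyZ map_polyXn map_polyX map_polyC !hornerE.
pose Q : {poly K} := b1 *: 'X + b2%:P.
have QE : ev1 cK s Q = cK b1 * s + cK b2.
  by rewrite ev1E rmorphD /= map_polyZ map_polyX map_polyC hornerD hornerZ hornerX hornerC.
(* If the coefficient of la / nu vanished, [rel] and the transcendence of s would give k1 = k5 = k2
   = 0 and b1 = b2 = 0; as x0 is nonzero, the whole form would be zero. *)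
have Q0 : ev1 cK s Q != 0.
  apply: contraNN knz => /eqP hQ; move: rel; rewrite -QE hQ mulr0 add0r -PE.
  move/tr/polyP => hP; move/tr/polyP: hQ => hQ.
  move: (hP 2%N) (hP 1%N) (hP 0%N) (hQ 1%N) (hQ 0%N).
  rewrite !(coefD, coefZ, coefXn, coefX, coefC, coef0) /=.
  rewrite !(mulr0, mulr1, addr0, add0r) => k10 k50 k20.
  rewrite /b1 /b2 k10 k50 k20 !(mulr0, mul0r, addr0, add0r) => /eqP k3x /eqP k4x.
  move/eqP: hx; rewrite /qform k10 k50 k20.
  move: k3x k4x; rewrite !mulf_eq0 (negbTE x00) !orbF => /eqP-> /eqP->.
  rewrite !(mul0r, addr0) mulf_eq0 expf_eq0 (negbTE x00) !orbF => /eqP->.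
  by rewrite !eqxx.
have hla : rat s (la / nu).
  apply: (ratio_of_div _ _ Q0 (m := - ev1 cK s P)).
  - exact/ratio_ofN/ratio_of_val.
  - exact: ratio_of_val.
  - by apply/eqP; rewrite -addr_eq0 QE PE rel.
have hC c : rat s (la * cK c / nu).
  by rewrite mulrAC; apply: ratio_ofM => //; exact: rat_C.
split; first by rewrite q0E.
- rewrite q1E mulrDl mulfK //; apply: ratio_ofD => //; exact: rat_X.
- rewrite q2E mulrDl divff //; apply: ratio_ofD => //; exact: ratio_of1.
Qed.

End OneVariable.

(** * A rational generic fibre *)

Section ChainRule.
Variables (K N : fieldType) (tofr : {rmorphism {poly K} -> N}).
Hypothesis tofr_inj : injective tofr.
Hypothesis tofr_frac : forall n, exists p q, q != 0 /\ n * tofr q = tofr p.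
Local Notation dfr := (dfr tofr_inj tofr_frac).
Variables (k : fieldType) (rho : {rmorphism k -> N}).
Hypothesis drho : forall c, dfr (rho c) = 0.

Lemma dfr_ev2 X Y (P : {poly {poly k}}) :
  dfr (ev2 rho X Y P) = ev2 rho X Y (map_poly deriv P) * dfr X + ev2 rho X Y P^`() * dfr Y.
Proof.
elim/poly2_ind: P => [c|||p q hp hq|p q hp hq].
- by rewrite ev2CC drho map_polyC /= !derivC rmorph0 !mul0r addr0.
- by rewrite ev2X map_polyC /= derivX derivC rmorph0 mul0r addr0 rmorph1 mul1r.
- rewrite ev2Y derivX rmorph1 mul1r (_ : map_poly _ 'X = 0) ?rmorph0 ?mul0r ?add0r //.
  apply/polyP => i; rewrite coef_map_id0 ?derivC // coefX coef0.
  by case: (_ == _); rewrite ?(derivC (1 : k)) ?(derivC (0 : k)) // -?polyC0 -?polyC1 derivC.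
- by rewrite rmorphD dfrD hp hq raddfD derivD !rmorphD /=; ring.
- rewrite rmorphM dfrM hp hq derivM rmorphD !rmorphM /=.
  have -> : map_poly deriv (p * q) = map_poly deriv p * q + p * map_poly deriv q.
    apply/polyP => i; rewrite coefD !coefM coef_map_id0 ?derivC // coefM.
    rewrite raddf_sum -big_split; apply: eq_bigr => j _ /=.
    by rewrite derivM !(coef_map_id0 _ _ (derivC _)).
  by rewrite rmorphD !rmorphM /=; ring.
Qed.
End ChainRule.

Section RationalFibre.
Variables (k0 K : fieldType) (io : {rmorphism k0 -> K}).
Hypothesis k0cl : alg_closed k0.
Hypothesis Kcl : alg_closed K.
Hypothesis K0 : [pchar K] =i pred0.
Variable f : {poly {poly k0}}.
Hypothesis firr : forall b, irr2 (f - b%:P%:P).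
Variable a : K.
Hypothesis tra : forall p : {poly k0}, ev1 io a p = 0 -> p = 0.
Hypothesis alga : forall c : K, exists2 P : {poly {poly k0}}, P != 0 & ev2 io a c P = 0.
Variables (N : fieldType) (tofr : {rmorphism {poly K} -> N}).
Hypothesis tofr_inj : injective tofr.
Hypothesis tofr_frac : forall n, exists p q, q != 0 /\ n * tofr q = tofr p.
Local Notation cst := (@cst K N tofr).
Local Notation var := (@var K N tofr).
Local Notation dfr := (dfr tofr_inj tofr_frac).
Local Notation num := (num tofr_inj tofr_frac).
Local Notation den := (den tofr_inj tofr_frac).
Variables X Y : N.

Let rho : {rmorphism k0 -> N} := cst \o io.
Local Notation Psi := (ev2 rho X Y).
Hypothesis fa : Psi f = cst a.
Hypothesis gen : ratio2 cst X Y var.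
Hypothesis Psi_inj : forall p, Psi p = 0 -> p = 0.

Definition imageM : subfield N.
Proof.
exists (ratio2 rho X Y); first exact: ratio_of1.
- by move=> x y hx hy; apply: ratio_ofD => //; exact: ratio_ofN.
- exact: ratio_of_inv.
Defined.
Local Notation M := imageM.
Local Notation M0 := (sf_type M).
Local Notation psi := (@sf_val N M).
Local Notation k1 := (sf_type (constants cst M)).
Local Notation val1 := (@sf_val K (constants cst M)).
Local Notation rat t := (ratio_of (ev1 cst t)).
Local Notation at_ H w := ((map_poly psi H).[cst w]).

Lemma Psi_a R : Psi (comp1 f R) = cst (ev1 io a R).
Proof.
rewrite -Psi_comp1 fa /ev1 /= /horner_eval -(horner_map cst) -map_poly_comp.
by [].
Qed.

Lemma M_a p : M (cst (ev1 io a p)).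
Proof. by rewrite -Psi_a; exact: ratio_of_val. Qed.

Lemma algebraic_over_constants (c : K) : exists2 P : {poly k1}, P != 0 & root (map_poly val1 P) c.
Proof.
have [P P0 hP] := alga c.
pose li p := sval (cid (sf_lift (M_a p : constants cst M (ev1 io a p)))).
have liE p : val1 (li p) = ev1 io a p.
  exact: svalP (cid (sf_lift (M_a p : constants cst M (ev1 io a p)))).
exists (\poly_(i < size P) li P`_i).
  apply/negP => /eqP h; case/negP: (P0); rewrite -lead_coef_eq0; apply/eqP/tra.
  rewrite lead_coefE -liE; have /polyP/(_ (size P).-1) := h.
  rewrite coef_poly coef0; case: ltnP => [_ ->|]; first by rewrite rmorph0.
  by rewrite leqNgt ltn_predL size_poly_gt0 P0.
apply/rootP; rewrite -hP (ev2_coef _ _ _ (leqnn _)) (@horner_coef_wide _ (size P)).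
  by apply: eq_bigr => i _; rewrite coef_map coef_poly ltn_ord /= liE.
by rewrite size_map_poly size_poly.
Qed.

(** The constants in M are exactly k0(a): they are algebraic over k0(a), and k0(f) is algebraically
    closed in k0(x, y) by [alg_const]. *)
Lemma constants_a c : M (cst c) -> exists R1 R2 : {poly k0},
  R2 != 0 /\ c * ev1 io a R2 = ev1 io a R1.
Proof.
move=> Mc; have [P P0 hP] := alga c.
have [|//||R1 [R2 [R20 h]]] := @alg_const _ k0cl _ firr _ rho X Y Psi_inj (cst c) P.
- have [p [q [q0 e]]] := Mc; exists p, q; split=> //.
  by apply: contraNneq q0 => ->; rewrite rmorph0.
- rewrite fa -(rmorph0 cst) -hP; symmetry.
  by apply: ev2_morph.
exists R1, R2; split=> //; apply: (fmorph_inj cst).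
by rewrite rmorphM /= -!Psi_a h.
Qed.

(* The coefficients expressing var through X, Y and X, Y through var all lie in
   k1(z); the conjugates of var over M are then again generators. *)
Lemma conjugate_generators : exists (z : K) (zs : seq K) (Hs : {poly M0}),
  [/\ [/\ uniq zs, z \in zs & at_ Hs z = var],
   forall H : {poly M0}, at_ H z = 0 -> forall w, w \in zs -> at_ H w = 0,
   forall H : {poly M0}, at_ H z != 0 -> exists G, at_ (G * H) z = 1,
   forall H : {poly M0}, exists H' : {poly M0}, (size H' <= size zs)%N /\
    forall w, w \in zs -> at_ H' w = at_ H w &
   forall w, w \in zs -> rat (at_ Hs w) var].
Proof.
have [PS [QS /= [QS0 genE]]] := gen.
have [_ _ XE] := num_den tofr_inj tofr_frac X; have [X20 _ _] := num_den tofr_inj tofr_frac X.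
have [Y20 _ YE] := num_den tofr_inj tofr_frac Y.
move: (num X) (den X) (num Y) (den Y) X20 Y20 XE YE.
move=> X1 X2 Y1 Y2 X20 Y20 XE YE.
pose coefs2 (P : {poly {poly K}}) := [seq c | p <- polyseq P, c <- polyseq p].
pose cs := coefs2 PS ++ coefs2 QS ++ polyseq X1 ++ polyseq X2 ++ polyseq Y1 ++ polyseq Y2.
have [z hz] := primitive_element K0 algebraic_over_constants cs.
have [zs [uzs zzs vanish inv [minz red]]] := conjugates Kcl K0 algebraic_over_constants z.
pose Rz n := exists H : {poly M0}, at_ H z = n.
have RzD m n : Rz m -> Rz n -> Rz (m + n).
  by move=> [H <-] [G <-]; exists (H + G); rewrite rmorphD hornerD.
have RzM m n : Rz m -> Rz n -> Rz (m * n).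
  by move=> [H <-] [G <-]; exists (H * G); rewrite rmorphM hornerM.
have RzMM n : M n -> Rz n.
  by move=> /sf_lift[y yE]; exists y%:P; rewrite map_polyC hornerC.
have RzX n i : Rz n -> Rz (n ^+ i).
  move=> h; elim: i => [|i IH]; last by rewrite exprS; exact: RzM.
  by apply: (RzMM); exact: carrier1.
have Rz_sum n (F : 'I_n -> N) : (forall i, Rz (F i)) -> Rz (\sum_(i < n) F i).
  move=> h; elim/big_ind: _ => //; exists 0; rewrite rmorph0 horner0.
  by [].
have Rz_cs c : c \in cs -> Rz (cst c).
  by move=> /hz[C <-]; exists (map_poly (emb (cK := cst) (M := M)) C); rewrite at_emb.
have MX : M X by rewrite -(ev2X rho X Y); exact: ratio_of_val.
have MY : M Y by rewrite -(ev2Y rho X Y); exact: ratio_of_val.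
have Rz_ev P : {subset coefs2 P <= cs} -> Rz (ev2 cst X Y P).
  move=> sub; rewrite (ev2_coef _ _ _ (leqnn _)); apply: (Rz_sum) => i.
  apply: (RzM); last by apply: (RzX); exact: RzMM.
  rewrite horner_coef size_map_poly; apply: (Rz_sum) => j.
  apply: (RzM); last by apply: (RzX); exact: RzMM.
  rewrite coef_map; apply/Rz_cs/sub/allpairsPdep.
  by exists P`_i, P`_i`_j; split=> //; rewrite mem_nth.
have [Hs HsE] : Rz var.
  have [HP HPE] : Rz (ev2 cst X Y PS).
    by apply: (Rz_ev) => c; rewrite !mem_cat => ->.
  have [HQ HQE] : Rz (ev2 cst X Y QS).
    by apply: (Rz_ev) => c; rewrite !mem_cat => ->; rewrite orbT.
  have [|G GE] := inv HQ; first by rewrite HQE.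
  exists (G * HP); rewrite rmorphM hornerM HPE -genE -HQE mulrCA -hornerM -rmorphM GE.
  by rewrite mulr1.
exists z, zs, Hs; split=> // w wzs.
have vanish1 H : at_ H z != 0 -> at_ H w != 0.
  move=> /inv[G GE]; have : at_ (G * H - 1) w = 0.
    by apply: (vanish) => //; rewrite rmorphB rmorph1 hornerD hornerN hornerC GE subrr.
  rewrite rmorphB rmorph1 hornerD hornerN hornerC rmorphM hornerM => /eqP.
  by rewrite subr_eq0; apply: contraTneq => ->; rewrite mulr0 eq_sym oner_eq0.
(* H writes p([var]) in M[z]; moving z to w conjugates both the coefficients of p, which gives q,
   and [var], which gives the value of Hs at w. *)
have lift (p : {poly K}) : {subset polyseq p <= cs} -> exists (H : {poly M0}) (q : {poly K}),
    at_ H z = tofr p /\ at_ H w = ev1 cst (at_ Hs w) q.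
  move=> sub; have hc i : exists C : {poly k1}, (map_poly val1 C).[z] = p`_i.
    have [lt|ge] := ltnP i (size p); first by apply: hz; apply: sub; exact: mem_nth.
    by exists 0; rewrite rmorph0 horner0 nth_default.
  have /choice[C hC] := hc.
  exists (\sum_(i < size p) map_poly (emb (cK := cst) (M := M)) (C i) * Hs ^+ i).
  exists (\poly_(i < size p) (map_poly val1 (C i)).[w]).
  rewrite !rmorph_sum !horner_sum /=; split.
    rewrite -ev1_var horner_coef size_map_poly; apply: eq_bigr => i _.
    by rewrite rmorphM hornerM at_emb hC rmorphXn horner_exp /= HsE coef_map.
  rewrite ev1E (@horner_coef_wide _ (size p)); last by rewrite size_map_poly size_poly.
  apply: eq_bigr => i _; rewrite rmorphM hornerM at_emb rmorphXn horner_exp /=.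
  by rewrite coef_map coef_poly ltn_ord.
have ratM (n : N) (p q : {poly K}) : M n -> {subset polyseq p <= cs} ->
    {subset polyseq q <= cs} -> q != 0 -> n * tofr q = tofr p -> rat (at_ Hs w) n.
  move=> /sf_lift[y yE] /lift[Hp [p' [hp1 hp2]]] /lift[Hq [q' [hq1 hq2]]] q0 e.
  exists p', q'; rewrite /= -hp2 -hq2; split.
    by apply: vanish1; rewrite hq1 tofr_eq0.
  have : at_ (y%:P * Hq - Hp) w = 0.
    apply: (vanish) => //.
    by rewrite rmorphB rmorphM /= map_polyC hornerD hornerN hornerM hornerC hq1 hp1 /= yE e subrr.
  rewrite rmorphB rmorphM /= map_polyC hornerD hornerN hornerM hornerC /= yE => /eqP.
  by rewrite subr_eq0 => /eqP.
have rX : rat (at_ Hs w) X.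
  by apply: (ratM _ _ _ MX _ _ X20 XE) => c; rewrite !mem_cat => ->; rewrite !orbT.
have rY : rat (at_ Hs w) Y.
  by apply: (ratM _ _ _ MY _ _ Y20 YE) => c; rewrite !mem_cat => ->; rewrite !orbT.
exact: ratio_of_div (rat_ev2 PS rX rY) (rat_ev2 QS rX rY) QS0 genE.
Qed.

(* Take g = 1 / X', since f(X, Y) = a gives Y' / X' in M. *)
Lemma derivation : exists g : N, g != 0 /\ forall n, M n -> M (g * dfr n).
Proof.
have drho c : dfr (rho c) = 0 by rewrite /rho /= dfr_cst.
suff [g [g0 [gX gY]]] : exists g : N, g != 0 /\ M (g * dfr X) /\ M (g * dfr Y).
  exists g; split=> // n [P [Q [Q0 h]]].
  have MPsi p : M (g * dfr (Psi p)).
    rewrite (@dfr_ev2 _ _ _ tofr_inj tofr_frac _ _ drho) mulrDr.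
    rewrite [g * (_ * dfr X)]mulrCA [g * (_ * dfr Y)]mulrCA.
    by apply: ratio_ofD; apply: ratio_ofM; [exact: ratio_of_val|exact: gX|
      exact: ratio_of_val|exact: gY].
  have := congr1 (fun x => g * dfr x) h; rewrite /= dfrM mulrDr => e.
  have h1 : ratio2 rho X Y (g * dfr (Psi P) - n * (g * dfr (Psi Q))).
    apply: ratio_ofD; first exact: MPsi.
    by apply/ratio_ofN/ratio_ofM; [exists P, Q|exact: MPsi].
  have h2 : g * dfr n * Psi Q = g * dfr (Psi P) - n * (g * dfr (Psi Q)).
    by rewrite -e; ring.
  rewrite -h2 in h1.
  have h3 : ratio2 rho X Y (Psi Q) by exact: ratio_of_val.
  have [al [be [be0 h4]]] := ratio_of_inv h1 h3.
  by exists al, be; split=> //; rewrite -h4 mulfK.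
(* X may be constant. Then Y' is nonzero, since [var] is a rational function of X and Y over K and
   has derivative 1; 1 / Y' replaces 1 / X'. *)
have [dX|dX] := eqVneq (dfr X) 0.
  have dY : dfr Y != 0.
    apply/negP => /eqP dY; have [P [Q [Q0 h]]] := gen.
    have := congr1 dfr h.
    rewrite dfrM !(@dfr_ev2 _ _ _ tofr_inj tofr_frac _ _ (dfr_cst tofr_inj tofr_frac)).
    rewrite dX dY dfr_var !mulr0 addr0 mulr0 addr0 mul1r.
    by move/eqP: Q0.
  exists (dfr Y)^-1; rewrite invr_eq0 dY dX mulr0 mulVf //; split=> //; split.
    by rewrite -(rmorph0 Psi); exact: ratio_of_val.
  exact: ratio_of1.
exists (dfr X)^-1; rewrite invr_eq0 dX mulVf //; split=> //; split; first exact: ratio_of1.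
have e : Psi (map_poly deriv f) * dfr X + Psi f^`() * dfr Y = 0.
  by rewrite -(@dfr_ev2 _ _ _ tofr_inj tofr_frac _ _ drho) fa dfr_cst.
(* Otherwise f_x(X, Y) = 0 too, since X' is nonzero; by injectivity of [Psi] both partial
   derivatives of f vanish, and f is constant in characteristic 0. *)
have fy : Psi f^`() != 0.
  apply/negP => /eqP fy; move/eqP: e; rewrite fy mul0r addr0 mulf_eq0 (negbTE dX) orbF.
  move/eqP/Psi_inj => fx; move/Psi_inj: fy => fy.
  have k0char : [pchar k0] =i pred0 by move=> p; rewrite -(K0 p) (fmorph_pchar io).
  have natr0 (R : fieldType) (n : nat) : [pchar R] =i pred0 -> (n.+1)%:R != 0 :> R.
    by move=> /pcharf0P ->.
  have /size1_polyC fC : (size f <= 1)%N.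
    rewrite leqNgt; apply/negP => sf; have /polyP/(_ (size f).-2) := fy.
    rewrite coef_deriv coef0 (_ : (size f).-2.+1 = (size f).-1)%N; last first.
      by case: (size f) sf => [|[]].
    move/eqP; rewrite -mulr_natr mulf_eq0 -lead_coefE lead_coef_eq0 -size_poly_eq0.
    rewrite -polyC_natr polyC_eq0.
    by case: (size f) sf => [|[|n]] //= _; rewrite (negbTE (natr0 _ _ k0char)).
  move: fx; rewrite fC map_polyC /= => /eqP; rewrite polyC_eq0 => /eqP.
  move/(deriv_eq0 k0char)/size1_polyC => f0C.
  by case: (firr 0); rewrite fC f0C -!polyCB deg2C.
exists (- map_poly deriv f), f^`(); split=> //; rewrite rmorphN /=.
apply: (mulIf dX).
transitivity (Psi f^`() * dfr Y * ((dfr X)^-1 * dfr X)); first by ring.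
move/eqP: e; rewrite addrC addr_eq0 => /eqP e.
by rewrite mulVf // mulr1 e mulNr.
Qed.

Lemma dfr_horner (H : {poly N}) w : dfr H.[cst w] = (map_poly dfr H).[cst w].
Proof.
rewrite horner_coef (@horner_coef_wide _ (size H)) ?size_poly //.
rewrite (big_morph _ (dfrD tofr_inj tofr_frac) (dfr0 tofr_inj tofr_frac)); apply: eq_bigr => i _.
rewrite coef_map_id0 ?dfr0 // dfrM -rmorphXn /= dfr_cst mulr0 addr0.
by [].
Qed.

(* The vector fields Q(var) / g with deg Q <= 2 are spanned by those defined
   over M: a Moebius change of var preserves this space, which therefore is
   stable under conjugation. *)
Lemma tangent_fields : exists (I : finType) (m : I -> M0) (g : N), [/\ g != 0,
  forall i, exists Q : {poly K}, (size Q <= 3)%N /\ psi (m i) * g = tofr Q &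
  forall l : 'I_3, exists c : I -> K, var ^+ l = \sum_i psi (m i) * g * cst (c i)].
Proof.
have [z [zs [Hs [[uzs zzs HsE] vanish inv red hrat]]]] := conjugate_generators.
have [g [g0 gM]] := derivation.
pose li (x : M0) := sval (cid (sf_lift (gM _ (sf_valP x)))).
have liE x : psi (li x) = g * dfr (psi x) := svalP (cid (sf_lift (gM _ (sf_valP x)))).
pose Hd : {poly M0} := \poly_(i < size Hs) li Hs`_i.
have HdE w : at_ Hd w = g * dfr (at_ Hs w).
  rewrite dfr_horner (@horner_coef_wide _ (size Hs) (map_poly psi Hd)); last first.
    by rewrite size_map_poly size_poly.
  rewrite (@horner_coef_wide _ (size Hs) (map_poly _ _)); last first.
    by rewrite (leq_trans (size_poly _ _)) // size_map_poly.
  rewrite mulr_sumr; apply: eq_bigr => i _; rewrite coef_map coef_poly ltn_ord /= liE.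
  by rewrite (coef_map_id0 _ _ (dfr0 tofr_inj tofr_frac)) coef_map /= mulrA.
(* Hd represents the derivation g d/d[var] applied to [var], so G has the value 1 / g at z, and
   [G * Hs ^+ l] represents [var ^+ l / g]. *)
have [|G GE] := inv Hd; first by rewrite HdE HsE dfr_var mulr1.
have GEw w : w \in zs -> at_ G w * (g * dfr (at_ Hs w)) = 1.
  move=> wzs; have : at_ (G * Hd - 1) w = 0.
    by apply: (vanish _ _ w wzs); rewrite rmorphB rmorph1 hornerD hornerN hornerC GE subrr.
  rewrite rmorphB rmorph1 hornerD hornerN hornerC rmorphM hornerM HdE => /eqP.
  by rewrite subr_eq0 => /eqP.
have /choice[h hh] := fun l : 'I_3 => red (G * Hs ^+ l).
(* n stands for the vector field n g d/d[var], a multiple of the derivation of M; size 3 is degree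
   2. *)
pose Wv (n : N) := exists Q : {poly K}, (size Q <= 3)%N /\ n * g = tofr Q.
have Wv0 : Wv 0 by exists 0; rewrite size_poly0 mul0r rmorph0.
have WvD x y : Wv x -> Wv y -> Wv (x + y).
  move=> [P [sP hP]] [Q [sQ hQ]]; exists (P + Q); rewrite mulrDl hP hQ rmorphD.
  by rewrite (leq_trans (size_polyD _ _)) // geq_max sP sQ.
have WvZ c x : Wv x -> Wv (x * cst c).
  move=> [P [sP hP]]; exists (c *: P); rewrite (leq_trans (size_scale_leq _ _)) //.
  by rewrite mulrAC hP -mul_polyC mulrC rmorphM.
pose W := Subspace Wv0 WvD WvZ.
have tofrZ c P : tofr (c *: P) = cst c * tofr P by rewrite -mul_polyC rmorphM.
have hW (l : 'I_3) w : w \in zs -> W (at_ (h l) w).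
  move=> wzs; rewrite (hh l).2 // rmorphM hornerM rmorphXn horner_exp.
  have [A [B [B0 hAB]]] := hrat w wzs.
  have [a' [b [c [d [det e]]]]] := mobius tofr_inj tofr_frac Kcl K0 B0 hAB.
  have e' := congr1 dfr e.
  rewrite dfrM !dfrD !dfrM !dfr_cst dfr_var !mul0r !add0r !addr0 !mulr1 in e'.
  move: (GEw w wzs) e e'; move: (at_ G w) (at_ Hs w) (dfr _) => Gw s ds Ge e e'.
  pose L1 : {poly K} := a' *: 'X + b%:P; pose L2 : {poly K} := c *: 'X + d%:P.
  have L1E : tofr L1 = cst a' * var + cst b.
    by rewrite /L1 -mul_polyC rmorphD rmorphM.
  have L2E : tofr L2 = cst c * var + cst d.
    by rewrite /L2 -mul_polyC rmorphD rmorphM.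
  have sL (x y : K) : (size (x *: 'X + y%:P)%R <= 2)%N.
    rewrite (leq_trans (size_polyD _ _)) // geq_max (leq_trans (size_scale_leq _ _)) ?size_polyX //.
    by rewrite (leq_trans (size_polyC_leq1 _)).
  (* The derivative of the Moebius function s = L1 / L2 is its determinant over L2^2. Hence s^l / ds
     is a multiple of L2^2, L1 L2 or L1^2, of degree at most 2 in [var]. *)
  have wr : ds * tofr L2 ^+ 2 = cst (a' * d - b * c).
    rewrite L2E rmorphB !rmorphM; rewrite -L2E in e e' *.
    transitivity ((ds * tofr L2 + s * cst c) * tofr L2 - cst c * (s * tofr L2)).
      by ring.
    by rewrite e' e L2E; ring.
  have key (P : {poly K}) : s ^+ l * tofr L2 ^+ 2 = tofr P -> (size P <= 3)%N ->
      W (Gw * s ^+ l).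
    move=> hP sP; exists ((a' * d - b * c)^-1 *: P).
    rewrite (leq_trans (size_scale_leq _ _)) //; split=> //.
    have D0 : cst (a' * d - b * c) != 0 by rewrite fmorph_eq0.
    apply: (mulfI D0); rewrite tofrZ fmorphV (mulVKf D0) -hP -wr.
    transitivity (Gw * (g * ds) * (s ^+ l * tofr L2 ^+ 2)); first by ring.
    by rewrite Ge mul1r.
  have sLL (x y u v : K) : (size ((x *: 'X + y%:P) * (u *: 'X + v%:P))%R <= 3)%N.
    by rewrite (leq_trans (size_polyMleq _ _)) // -subn1 leq_subLR (leq_add (sL _ _) (sL _ _)).
  move: key; case: l => [[|[|[|//]]] lt] key.
  - by apply: (key (L2 * L2) _ (sLL _ _ _ _)); rewrite rmorphM; exact: mul1r.
  - apply: (key (L1 * L2) _ (sLL _ _ _ _)); rewrite rmorphM L1E -e -L2E /=; ring.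
  - apply: (key (L1 * L1) _ (sLL _ _ _ _)); rewrite rmorphM L1E -e -L2E /=; ring.
exists ('I_3 * 'I_(size zs))%type, (fun p : 'I_3 * 'I_(size zs) => (h p.1)`_p.2), g; split=> //.
  move=> [l i] /=; rewrite -coef_map.
  apply: (coef_subspace (V := W) uzs); first by rewrite size_map_poly (hh l).1.
  by move=> w wzs; exact: hW.
move=> l; exists (fun p : 'I_3 * 'I_(size zs) => if p.1 == l then z ^+ p.2 else 0).
rewrite -(pair_bigA _ (fun l' (i : 'I_(size zs)) =>
  psi (h l')`_i * g * cst (if l' == l then z ^+ i else 0))) /=.
rewrite (bigD1 l) //= [X in _ + X]big1 ?addr0; last first.
  move=> l' /negbTE ne; rewrite big1 // => i _; rewrite ne rmorph0 mulr0.
  by [].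
have -> : var ^+ l = at_ (h l) z * g.
  rewrite (hh l).2 // rmorphM hornerM rmorphXn horner_exp HsE.
  rewrite mulrAC; have := GEw z zzs; rewrite HsE dfr_var mulr1 => ->.
  by rewrite mul1r.
rewrite (@horner_coef_wide _ (size zs)) ?size_map_poly ?(hh l).1 // mulr_suml.
apply: eq_bigr => i _; rewrite eqxx coef_map rmorphXn /=; ring.
Qed.

(** The powers 1, [var], [var]^2 are combinations of the spanning family, so its coefficient matrix
    has rank 3 and three independent rows can be selected. *)
Lemma tangent_basis : exists (w : 'I_3 -> M0) (q : 'I_3 -> {poly K}) (g : N),
  [/\ g != 0, forall i, (size (q i) <= 3)%N, forall i, psi (w i) * g = tofr (q i) &
      (\matrix_(i < 3, j < 3) (q i)`_j) \in unitmx].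
Proof.
have [I [m [g [g0 /choice[Q hQ] /choice[c hc]]]]] := tangent_fields.
pose A := \matrix_(i < #|I|, j < 3) (Q (enum_val i))`_j.
have Afull : row_full A.
  apply/row_fullP; exists (\matrix_(l < 3, i < #|I|) c l (enum_val i)).
  apply/matrixP => l j; rewrite !mxE.
  have e : 'X^l = \sum_i c l i *: Q i.
    apply: tofr_inj; rewrite rmorphXn [LHS]hc rmorph_sum; apply: eq_bigr => i _.
    by rewrite (hQ i).2 -mul_polyC rmorphM mulrC.
  transitivity ((\sum_i c l i *: Q i)`_j); last first.
    by rewrite -e coefXn -val_eqE /= eq_sym.
  rewrite coef_sum; under eq_bigr => i _ do rewrite !mxE.
  rewrite [RHS](reindex (@enum_val I predT)) /=; last first.
    by apply: onW_bij; exact: enum_val_bij.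
  by apply: eq_bigr => i _; rewrite coefZ.
exists (fun i => m (enum_val (fullrankfun Afull i))), (fun i => Q (enum_val (fullrankfun Afull i))), g.
split=> //; try by move=> i; case: (hQ (enum_val (fullrankfun Afull i))).
have := fullrowsub_unit Afull; congr (_ \in unitmx).
by apply/matrixP => i j; rewrite !mxE.
Qed.

Lemma rational_generator : exists s : N,
  [/\ M s, forall P, ev1 cst s P = 0 -> P = 0 & rat s var].
Proof.
have [w [q [g [g0 sq wg Bu]]]] := tangent_basis.
set B := \matrix_(_, _) _ in Bu.
have comb (c : 'rV[K]_3) : (\sum_i psi (w i) * cst (c 0 i)) * g = tofr (\sum_i c 0 i *: q i).
  rewrite mulr_suml rmorph_sum; apply: eq_bigr => i _.
  by rewrite -mul_polyC rmorphM mulrAC wg mulrC.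
have combB (c : 'rV[K]_3) (j : 'I_3) : (\sum_i c 0 i *: q i)`_j = (c *m B) 0 j.
  by rewrite mxE coef_sum; apply: eq_bigr => i _; rewrite coefZ mxE.
have indep (c : 'rV[K]_3) : \sum_i psi (w i) * cst (c 0 i) = 0 -> c = 0.
  move=> h; have := comb c; rewrite h mul0r => /esym/eqP; rewrite tofr_eq0 // => /eqP e.
  apply: (can_inj (mulmxK Bu)); rewrite mul0mx; apply/rowP => j.
  by rewrite -combB e coef0 mxE.
have onto (p : {poly K}) : (size p <= 3)%N ->
    exists c : 'rV[K]_3, (\sum_i psi (w i) * cst (c 0 i)) * g = tofr p.
  move=> sp; exists (\row_j p`_j *m invmx B); rewrite comb; congr (tofr _).
  apply/polyP => j; have [lt|ge] := ltnP j 3.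
    by rewrite (combB _ (Ordinal lt)) mulmxKV // mxE.
  rewrite (nth_default _ (leq_trans sp ge)) nth_default //; apply: leq_trans ge.
  apply: (leq_trans (size_sum _ _ _)); apply/bigmax_leqP => i _.
  by rewrite (leq_trans (size_scale_leq _ _)).
(* [var] is the quotient of the combinations of the w i that represent [var] and 1, and nu cancels
   in it. *)
have fin s nu : nu != 0 -> (forall i, rat s (psi (w i) / nu)) -> rat s var.
  move=> nu0 hs.
  have hc (c : 'rV[K]_3) : rat s ((\sum_i psi (w i) * cst (c 0 i)) / nu).
    rewrite mulr_suml; apply: ratio_of_sum => i; rewrite mulrAC.
    by apply: ratio_ofM => //; exact: rat_C.
  have [|c0 e0] := onto 1; first by rewrite size_poly1.
  have [|c1 e1] := onto 'X; first by rewrite size_polyX.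
  apply: (ratio_of_div (hc c1) (hc c0)).
    rewrite mulf_neq0 ?invr_eq0 //; apply/negP => /eqP h.
    by move/eqP: e0; rewrite h mul0r rmorph1 eq_sym oner_eq0.
  rewrite mulrA; congr (_ / _); apply: (mulIf g0).
  by rewrite e1 -mulrA e0 rmorph1 mulr1.
pose i0 : 'I_3 := 0; pose i1 : 'I_3 := 1; pose i2 : 'I_3 := 2%:R.
have sum3 (F : 'I_3 -> N) : \sum_i F i = F i0 + F i1 + F i2.
  rewrite !big_ord_recl big_ord0 addr0 addrA; congr (F _ + F _ + F _);
  exact: val_inj.
have all3 (P : 'I_3 -> Prop) : P i0 -> P i1 -> P i2 -> forall i, P i.
  move=> h0 h1 h2 [[|[|[|//]]] lt]; [move: h0|move: h1|move: h2];
  congr (P _); exact: val_inj.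
pose pm (k : 'I_6) : M0 := nth 0 [:: w i0 ^+ 2; w i1 ^+ 2; w i2 ^+ 2;
  w i0 * w i1; w i0 * w i2; w i1 * w i2] k.
pose pq (k : 'I_6) : {poly K} := nth 0 [:: q i0 ^+ 2; q i1 ^+ 2; q i2 ^+ 2;
  q i0 * q i1; q i0 * q i2; q i1 * q i2] k.
have pmq k : psi (pm k) * g ^+ 2 = tofr (pq k).
  have e i j : psi (w i * w j) * g ^+ 2 = tofr (q i * q j).
    by rewrite !rmorphM /= -!wg; ring.
  by case: k => [[|[|[|[|[|[|//]]]]]] lt]; rewrite /pm /pq /= ?expr2 e.
have spq k : (size (pq k) <= 5)%N.
  have e i j : (size (q i * q j)%R <= 5)%N.
    by rewrite (leq_trans (size_polyMleq _ _)) // -subn1 leq_subLR (leq_add (sq i) (sq j)).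
  by case: k => [[|[|[|[|[|[|//]]]]]] lt]; rewrite /pq /= ?expr2 e.
(* The six products of two basis fields have degree at most 4, so they lie in a space of dimension
   5. *)
have [u [u0 hu]] : exists u : 'rV[K]_6, u != 0 /\ \sum_k u 0 k *: pq k = 0.
  pose C := \matrix_(k < 6, j < 5) (pq k)`_j.
  have /rowV0Pn[u /sub_kermxP hu u0] : kermx C != 0.
    by rewrite kermx_eq0 /row_free neq_ltn ltnS rank_leq_col.
  exists u; split=> //; apply/polyP => j; rewrite coef0 coef_sum.
  have [lt|ge] := ltnP j 5; last first.
    by rewrite big1 // => k _; rewrite coefZ nth_default ?mulr0 // (leq_trans (spq k)).
  have /rowP/(_ (Ordinal lt)) := hu; rewrite !mxE => e; rewrite -[RHS]e.
  by apply: eq_bigr => k _; rewrite coefZ mxE.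
have [||ka [[k0' ka0] Mka hka]] := linear_disjoint Kcl K0 algebraic_over_constants (m := pm) (c := u 0).
- apply: contrapT => h; move/negP: u0; apply; apply/eqP/rowP => k; rewrite mxE.
  by apply/eqP; apply: contrapT => /negP uk; apply: h; exists k.
- apply: (mulIf (expf_neq0 2 g0)); rewrite mul0r.
  transitivity (tofr (\sum_k u 0 k *: pq k)); last by rewrite hu rmorph0.
  rewrite mulr_suml rmorph_sum; apply: eq_bigr => k _.
  by rewrite mulrAC pmq -mul_polyC rmorphM mulrC.
have /choice[R1 /choice[R2 hR]] := fun k => constants_a (Mka k).
pose ea (p : {poly k0}) : K := ev1 io a p.
have ea0 p : p != 0 -> ea p != 0 by apply: contraNneq => /tra ->.
(* The descended coefficients, now in k0(a), are multiplied by the common denominator D; this gives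
   a conic over k0[x], for which [conic_point] is available. *)
pose r k := R1 k * \prod_(j | j != k) R2 j.
pose D := ea (\prod_j R2 j).
have D0 : D != 0 by apply/ea0/prodf_neq0 => j _; case: (hR j).
have rE k : ea (r k) = ka k * D.
  rewrite /ea /D (bigD1 k) //= /r !rmorphM /= -(hR k).2; ring.
pose o (n : nat) (lt : (n < 6)%N) := Ordinal lt.
pose j0 := @o 0 isT; pose j1 := @o 1 isT; pose j2 := @o 2 isT.
pose j3 := @o 3 isT; pose j4 := @o 4 isT; pose j5 := @o 5 isT.
have two : 2%:R != 0 :> k0.
  have /pcharf0P h := K0; rewrite -(fmorph_eq0 io) rmorph_nat h.
  by [].
have [x [y [z [nz hxyz]]]] :=
  conic_point k0cl two (r j0) (r j1) (r j2) (r j3) (r j4) (r j5).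
have hX : qform (ea (r j0)) (ea (r j1)) (ea (r j2)) (ea (r j3)) (ea (r j4)) (ea (r j5))
   (ea x) (ea y) (ea z) = 0.
  transitivity (ea 0); last by rewrite /ea rmorph0.
  rewrite -hxyz /ea /qform; move: (r j0) (r j1) (r j2) (r j3) (r j4) (r j5).
  by move=> *; rewrite !expr2 !rmorphD !rmorphM.
have hQ : qform (cst (ea (r j0))) (cst (ea (r j1))) (cst (ea (r j2))) (cst (ea (r j3)))
   (cst (ea (r j4))) (cst (ea (r j5))) (psi (w i0)) (psi (w i1)) (psi (w i2)) = 0.
  have sum6 (F : 'I_6 -> N) :
      \sum_i F i = F j0 + F j1 + F j2 + F j3 + F j4 + F j5.
    rewrite !big_ord_recl big_ord0 addr0 !addrA.
    by congr (F _ + F _ + F _ + F _ + F _ + F _); exact: val_inj.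
  rewrite !rE -[RHS](mul0r (cst D)) -hka sum6 /qform /pm /=.
  by rewrite !expr2 !rmorphM; ring.
have knz : ~~ [&& ea (r j0) == 0, ea (r j1) == 0, ea (r j2) == 0, ea (r j3) == 0,
    ea (r j4) == 0 & ea (r j5) == 0].
  apply: contraNN ka0; rewrite !rE !mulf_eq0 (negbTE D0) !orbF.
  move=> /andP[z0 /and5P[z1 z2 z3 z4 z5]]; move: z0 z1 z2 z3 z4 z5.
  case: k0' => [[|[|[|[|[|[|//]]]]]] lt] h0 h1 h2 h3 h4 h5;
  [move: h0|move: h1|move: h2|move: h3|move: h4|move: h5];
  congr (ka _ == 0); exact: val_inj.
have indep3 c0 c1 c2 : psi (w i0) * cst c0 + psi (w i1) * cst c1 + psi (w i2) * cst c2 = 0 ->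
    [/\ c0 = 0, c1 = 0 & c2 = 0].
  pose c : 'rV[K]_3 := \row_i nth 0 [:: c0; c1; c2] i.
  move=> h; have /rowP e : c = 0 by apply: indep; rewrite sum3 !mxE.
  by split; [have := e i0|have := e i1|have := e i2]; rewrite !mxE.
have Ms (i j k : 'I_3) (u1 u2 u3 : {poly k0}) :
    M ((psi (w i) - psi (w j) * cst (ea u1 / ea u2)) /
       (psi (w k) - psi (w j) * cst (ea u3 / ea u2))).
  have hM i' u' : M (psi (w i') - psi (w j) * cst (ea u' / ea u2)).
    apply: carrierB; first exact: sf_valP.
    apply: carrierM; first exact: sf_valP.
    by rewrite fmorph_div; apply: carrier_div; exact: M_a.
  by apply: carrier_div.
(* The projection divides by the first coordinate of the point; the variables are permuted to make
   it nonzero. *)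
case/or3P: nz => /ea0 nz0.
- have [nu0 tr [h0 h1 h2]] := conic_projection Kcl indep3 knz hQ hX nz0.
  exact: (ex_intro _ _ (And3 (Ms _ _ _ _ _ _) tr (fin _ _ nu0 (all3 _ h0 h1 h2)))).
- have A1 c0 c1 c2 : psi (w i1) * cst c0 + psi (w i0) * cst c1 + psi (w i2) * cst c2 = 0 ->
      [/\ c0 = 0, c1 = 0 & c2 = 0].
    by rewrite [X in X + _]addrC => /indep3[]; split.
  have A2 : ~~ [&& ea (r j1) == 0, ea (r j0) == 0, ea (r j2) == 0,
      ea (r j3) == 0, ea (r j5) == 0 & ea (r j4) == 0].
    apply: contraNN knz => /andP[h0 /and5P[h1 h2 h3 h4 h5]].
    by rewrite h0 h1 h2 h3 h4 h5.
  have A3 : qform (cst (ea (r j1))) (cst (ea (r j0))) (cst (ea (r j2)))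
      (cst (ea (r j3))) (cst (ea (r j5))) (cst (ea (r j4)))
      (psi (w i1)) (psi (w i0)) (psi (w i2)) = 0.
    by rewrite -[RHS]hQ /qform; ring.
  have A4 : qform (ea (r j1)) (ea (r j0)) (ea (r j2)) (ea (r j3))
      (ea (r j5)) (ea (r j4)) (ea y) (ea x) (ea z) = 0.
    by rewrite -[RHS]hX /qform; ring.
  have [nu0 tr [h1 h0 h2]] := conic_projection Kcl A1 A2 A3 A4 nz0.
  exact: (ex_intro _ _ (And3 (Ms _ _ _ _ _ _) tr (fin _ _ nu0 (all3 _ h0 h1 h2)))).
- have A1 c0 c1 c2 : psi (w i2) * cst c0 + psi (w i0) * cst c1 + psi (w i1) * cst c2 = 0 ->
      [/\ c0 = 0, c1 = 0 & c2 = 0].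
    by rewrite -addrA addrC => /indep3[]; split.
  have A2 : ~~ [&& ea (r j2) == 0, ea (r j0) == 0, ea (r j1) == 0,
      ea (r j4) == 0, ea (r j5) == 0 & ea (r j3) == 0].
    apply: contraNN knz => /andP[h0 /and5P[h1 h2 h3 h4 h5]].
    by rewrite h0 h1 h2 h3 h4 h5.
  have A3 : qform (cst (ea (r j2))) (cst (ea (r j0))) (cst (ea (r j1)))
      (cst (ea (r j4))) (cst (ea (r j5))) (cst (ea (r j3)))
      (psi (w i2)) (psi (w i0)) (psi (w i1)) = 0.
    by rewrite -[RHS]hQ /qform; ring.
  have A4 : qform (ea (r j2)) (ea (r j0)) (ea (r j1)) (ea (r j4))
      (ea (r j5)) (ea (r j3)) (ea z) (ea x) (ea y) = 0.
    by rewrite -[RHS]hX /qform; ring.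
  have [nu0 tr [h2 h0 h1]] := conic_projection Kcl A1 A2 A3 A4 nz0.
  exact: (ex_intro _ _ (And3 (Ms _ _ _ _ _ _) tr (fin _ _ nu0 (all3 _ h0 h1 h2)))).
Qed.

Lemma ev2_rho s G : ev2 rho (cst a) s G = ev1 cst s (map_poly (ev1 io a) G).
Proof.
elim/poly2_ind: G => [c|||p q hp hq|p q hp hq].
- by rewrite ev2CC map_polyC /= !ev1C.
- by rewrite ev2X map_polyC /= ev1C ev1X.
- by rewrite ev2Y map_polyX ev1X.
- by rewrite !rmorphD /= hp hq.
- by rewrite !rmorphM /= hp hq.
Qed.

(** An equation n B(s) = A(s) over K is a K-linear relation between the elements n s^j and s^j of M.
    By linear disjointness there is one over the constants of M, that is, over k0(f). *)
Lemma rat_over_M s n : (forall P, ev1 cst s P = 0 -> P = 0) -> M s -> M n -> rat s n ->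
  ratio2 rho (Psi f) s n.
Proof.
move=> tr /sf_lift[s0 sE] /sf_lift[n0 nE] [A [B [B0 h]]].
pose l := maxn (size A) (size B).
pose m (i : 'I_l + 'I_l) : M0 :=
  match i with inl j => n0 * s0 ^+ j | inr j => s0 ^+ j end.
pose c (i : 'I_l + 'I_l) : K := match i with inl j => B`_j | inr j => - A`_j end.
have expand (d : 'I_l + 'I_l -> K) : \sum_i psi (m i) * cst (d i) =
    n * ev1 cst s (\poly_(j < l) (if insub j is Some j' then d (inl j') else 0)) +
    ev1 cst s (\poly_(j < l) (if insub j is Some j' then d (inr j') else 0)).
  rewrite big_sumType /= !ev1E.
  have sP (F : nat -> K) : (size (map_poly cst (\poly_(j < l) F j)) <= l)%N.
    by rewrite size_map_poly size_poly.
  rewrite !(horner_coef_wide _ (sP _)) mulr_sumr; congr (_ + _); apply: eq_bigr => j _.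
    by rewrite coef_map /= coef_poly ltn_ord valK rmorphXn /= nE sE; ring.
  by rewrite coef_map /= coef_poly ltn_ord valK rmorphXn /= sE mulrC.
have polyE (F : {poly K}) : (size F <= l)%N ->
    \poly_(j < l) (if insub j is Some j' then F`_(val (j' : 'I_l)) else 0) = F.
  move=> sF; apply/polyP => j; rewrite coef_poly; case: ltnP => lt.
    by rewrite insubT.
  by rewrite nth_default // (leq_trans sF).
have [||ka [[i kai] Mka hka]] := linear_disjoint Kcl K0 algebraic_over_constants (m := m) (c := c).
- have B1 : B != 0 by apply: contraNneq B0 => ->; rewrite rmorph0.
  have lt : ((size B).-1 < l)%N.
    by rewrite (leq_trans _ (leq_maxr _ _)) // ltn_predL size_poly_gt0.
  by exists (inl (Ordinal lt)); rewrite /= -lead_coefE lead_coef_eq0.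
- rewrite expand /= polyE ?leq_maxr //.
  rewrite (_ : \poly_(_ < _) _ = - A) ?rmorphN ?h ?subrr //.
  rewrite -[RHS]polyE ?size_polyN ?leq_maxl //; apply/polyP => j.
  by rewrite !coef_poly; case: insubP => // j' _ _; rewrite coefN.
have Ms' : forall x, M (cst x) -> ratio2 rho (Psi f) s (cst x).
  move=> x /constants_a[R1 [R2 [R20 e]]]; exists R1%:P, R2%:P.
  rewrite /= fa !ev2_rho !map_polyC !ev1E !map_polyC !hornerC /= -rmorphM e.
  by rewrite fmorph_eq0; split=> //; apply: contraNneq R20 => /tra ->.
have rs : ratio2 rho (Psi f) s s.
  by exists 'X, 1; rewrite rmorph1 oner_neq0 mulr1 /= ev2Y.
have rP (F : 'I_l -> K) : (forall j, M (cst (F j))) ->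
    ratio2 rho (Psi f) s
      (ev1 cst s (\poly_(j < l) (if insub j is Some j' then F j' else 0))).
  move=> MF; rewrite ev1E (@horner_coef_wide _ l) ?size_map_poly ?size_poly //.
  apply: ratio_of_sum => j; rewrite coef_map coef_poly ltn_ord valK.
  by apply: ratio_ofM; [exact: Ms'|exact: ratio_ofX].
rewrite expand in hka.
apply: (ratio_of_div (ratio_ofN (rP (ka \o inr) (fun j => Mka (inr j))))
                     (rP (ka \o inl) (fun j => Mka (inl j)))); last first.
  by apply/eqP; rewrite -addr_eq0 hka.
(* If the new denominator vanished at s, its coefficients would be zero, then those of the numerator
   too, against the nontriviality of the relation. *)
apply/negP => /eqP/tr/polyP e1.
have e1' j : ka (inl j) = 0.
  by have := e1 j; rewrite coef_poly ltn_ord valK coef0.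
move: hka; rewrite (_ : ev1 _ _ _ = 0) ?mulr0 ?add0r.
  move/tr/polyP => e2; case: i kai => j; last first.
    by have := e2 j; rewrite coef_poly ltn_ord valK coef0 => ->; rewrite eqxx.
  by rewrite e1' eqxx.
rewrite -[RHS](rmorph0 (ev1 cst s)); congr (ev1 _ _ _); apply/polyP => j.
by rewrite coef_poly coef0; case: insubP => [j' _ _|]; rewrite ?e1' if_same.
Qed.

Theorem coordinate_of_rational_fibre : exists u,
  (forall G, subst2 f u G = 0 -> G = 0) /\ forall h, exists G, h = subst2 f u G.
Proof.
have [s [Ms tr rv]] := rational_generator.
have ratn n : rat s n.
  have [d0 _ e] := num_den tofr_inj tofr_frac n.
  apply: (ratio_of_div (rat_ev1 (num n) rv) (rat_ev1 (den n) rv)).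
    by rewrite ev1E ev1_var tofr_eq0.
  by rewrite !ev1E !ev1_var.
apply: (coordinate_of_generator k0cl firr Psi_inj (t := s)).
- have [P [Q [Q0 e]]] := Ms; exists P, Q; split=> //.
  by apply: contraNneq Q0 => ->; rewrite rmorph0.
- move=> G; rewrite fa ev2_rho => /tr/polyP h; apply/polyP => i; rewrite coef0.
  by apply: tra; have := h i; rewrite coef_map coef0.
- apply: rat_over_M => //; rewrite -(ev2X rho X Y); exact: ratio_of_val.
- apply: rat_over_M => //; rewrite -(ev2Y rho X Y); exact: ratio_of_val.
Qed.

End RationalFibre.

(** * Zeros of polynomials *)

Section Zeros.
Variable K : fieldType.
Hypothesis Kcl : alg_closed K.

Lemma deg2_swap (p : {poly {poly K}}) : deg2 (swapXY p) = deg2 p.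
Proof. by rewrite /deg2 addnC swapXYK. Qed.

Lemma irr2_swap (p : {poly {poly K}}) : irr2 p -> irr2 (swapXY p).
Proof.
move=> [dp hp]; split=> [|a b e]; first by rewrite deg2_swap.
have [||] := hp (swapXY a) (swapXY b); first by rewrite -rmorphM /= -e swapXYK.
  by rewrite deg2_swap; left.
by rewrite deg2_swap; right.
Qed.

Lemma dvd2_swap (p q : {poly {poly K}}) : dvd2 (swapXY p) (swapXY q) -> dvd2 p q.
Proof. by move=> [w e]; exists (swapXY w); rewrite -(swapXYK q) e rmorphM /= swapXYK. Qed.

Lemma ev2_swap (k A : comNzRingType) (rho : {rmorphism k -> A}) x y (p : {poly {poly k}}) :
  ev2 rho y x (swapXY p) = ev2 rho x y p.
Proof.
elim/poly2_ind: p => [c|||p q hp hq|p q hp hq].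
- by rewrite swapXY_polyC map_polyC /= !ev2CC.
- by rewrite swapXY_polyC map_polyX ev2Y ev2X.
- by rewrite swapXY_X ev2Y ev2X.
- by rewrite !rmorphD /= hp hq.
- by rewrite !rmorphM /= hp hq.
Qed.

Lemma ev2_polyC (k A : comNzRingType) (rho : {rmorphism k -> A}) x y (p : {poly k}) :
  ev2 rho x y p%:P = ev1 rho x p.
Proof. exact: ev2C. Qed.

(** Elimination of y makes x a root of a nonzero polynomial over K, hence an element of K;
    exchanging the variables treats y. *)
Lemma common_zeros (N : fieldType) (rho : {rmorphism K -> N}) x y p g :
  irr2 p -> ~ dvd2 p g -> ev2 rho x y p = 0 -> ev2 rho x y g = 0 ->
  exists c d, x = rho c /\ y = rho d.
Proof.
have main x' y' p' g' : irr2 p' -> ~ dvd2 p' g' -> ev2 rho x' y' p' = 0 ->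
    ev2 rho x' y' g' = 0 -> exists c, x' = rho c.
  move=> irp npg px gx; have [r [u [v [r0 e]]]] := irr_bezout Kcl irp npg.
  apply: (ev1_root (P := r) Kcl r0); rewrite -(ev2_polyC rho x' y') -e.
  by rewrite rmorphD !rmorphM /= px gx !mulr0 addr0.
move=> irp npg px gx; have [c xE] := main x y p g irp npg px gx.
have [||||d yE] := main y x (swapXY p) (swapXY g).
- exact: irr2_swap.
- by move/dvd2_swap.
- by rewrite ev2_swap.
- by rewrite ev2_swap.
- by exists c, d.
Qed.

Lemma ev2_redx (k : fieldType) (io : {rmorphism k -> K}) x y (P : {poly {poly k}}) :
  ev2 io (io x) y P = ev1 io y (redx x P).
Proof.
elim/poly2_ind: P => [c|||p q hp hq|p q hp hq].
- by rewrite ev2CC redxC hornerC ev1C.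
- by rewrite ev2X redxC hornerX ev1C.
- by rewrite ev2Y /redx map_polyX ev1X.
- by rewrite !rmorphD /= hp hq.
- by rewrite !rmorphM /= hp hq.
Qed.

Lemma size_redx (k : fieldType) (x : k) (P : {poly {poly k}}) : (lead_coef P).[x] != 0 ->
  size (redx x P) = size P.
Proof.
by move=> h; apply: size_poly_eq => //; rewrite /horner_eval -lead_coefE.
Qed.

(** A curve is not contained in the finite set r(x) = t(y) = 0. Both variables are needed, since on
    a vertical line only y varies. *)
Lemma zero_avoiding p (r t : {poly K}) : deg2 p != 0%N -> r != 0 -> t != 0 ->
  exists x y, ev2 idfun x y p = 0 /\ (r.[x] != 0 \/ t.[y] != 0).
Proof.
move=> dp r0 t0; have p0 := deg2_neq0 dp.
have [sp|sp] := leqP (size p) 1.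
  have pC := size1_polyC sp; have [y hy] := nonroot Kcl t0.
  have [x /rootP hx] : exists x, root p`_0 x.
    apply: Kcl; apply: contraNN dp => /size_poly1P[c _ e].
    by rewrite pC e deg2C.
  exists x, y; split; last by right.
  by rewrite pC ev2_polyC ev1E map_poly_id ?hx.
have lp0 : lead_coef p * r != 0 by rewrite mulf_neq0 // lead_coef_eq0.
have [x] := nonroot Kcl lp0; rewrite hornerM mulf_eq0 negb_or => /andP[lx rx].
have [y /rootP hy] : exists y, root (redx x p) y.
  by apply: Kcl; rewrite size_redx //; case: (size p) sp => [|[]].
exists x, y; split; last by left.
by rewrite (ev2_redx idfun) ev1E map_poly_id.
Qed.

Lemma nullstellensatz (p q : {poly {poly K}}) : irr2 p ->
  (forall x y, ev2 idfun x y p = 0 -> ev2 idfun x y q = 0) -> dvd2 p q.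
Proof.
move=> irp hq; apply: contrapT => npq.
have [r [u [v [r0 e]]]] := irr_bezout Kcl irp npq.
have [|t [u' [v' [t0 e']]]] := @irr_bezout _ Kcl (swapXY p) (swapXY q) (irr2_swap irp).
  by move/dvd2_swap.
have [x [y [hp]]] := zero_avoiding irp.1 r0 t0; have hqx := hq _ _ hp; case.
  have := congr1 (ev2 idfun x y) e.
  rewrite rmorphD !rmorphM /= hp hqx !mulr0 addr0 ev2_polyC ev1E map_poly_id // => <-.
  by rewrite eqxx.
have := congr1 (ev2 idfun y x) e'.
rewrite rmorphD !rmorphM /= !ev2_swap hp hqx !mulr0 addr0 ev2_polyC ev1E map_poly_id // => <-.
by rewrite eqxx.
Qed.

End Zeros.

(** * The closed fibre over a transcendental value as generic fibre *)

Section GenericFibre.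
Variables (k0 K : fieldType) (io : {rmorphism k0 -> K}).
Hypothesis k0cl : alg_closed k0.
Hypothesis Kcl : alg_closed K.
Variables (f : {poly {poly k0}}) (a : K).
Hypothesis tra : forall p : {poly k0}, ev1 io a p = 0 -> p = 0.
Hypothesis Fairr : irr2 (map_poly (map_poly io) f - a%:P%:P).
Variables (N : fieldType) (tofr : {rmorphism {poly K} -> N}).
Hypothesis tofr_inj : injective tofr.
Local Notation cst := (@cst K N tofr).
Local Notation var := (@var K N tofr).
Variables X Y : N.
Let rho : {rmorphism k0 -> N} := cst \o io.
Hypothesis fa : ev2 rho X Y f = cst a.
Hypothesis gen : ratio2 cst X Y var.

Lemma not_in_k0 b : a <> io b.
Proof.
move=> ab; have := @tra ('X - b%:P); rewrite rmorphB /= ev1X ev1C ab subrr.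
by move=> /(_ erefl)/eqP; rewrite polyXsubC_eq0.
Qed.

(** Suppose H vanishes on the fibre. For suitable x0 in k0, solve f(x0, y) = a in K; then H(x0, y) =
    0 puts y in the algebraically closed field k0, hence also a. If f does not involve y, the same
    argument is applied to x and the leading coefficient of H. *)
Lemma generic_fibre_ndvd (H : {poly {poly k0}}) : H != 0 ->
  ~ dvd2 (map_poly (map_poly io) f - a%:P%:P) (map_poly (map_poly io) H).
Proof.
move=> H0 [w e].
have zero x y : ev2 io x y f = a -> ev2 io x y H = 0.
  move=> h; have := congr1 (ev2 idfun x y) e.
  rewrite rmorphM /= ev2B ev2CC !(@ev2_map _ _ _ io idfun io) //= h subrr mulr0.
  by [].
have [sf|sf] := leqP (size f) 1.
  have fC := size1_polyC sf.
  have [x /rootP hx] : exists x, root (map_poly io f`_0 - a%:P) x.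
    apply: Kcl; apply/negP => /size_poly1P[c _ ce]; case/negP: Fairr.1.
    by rewrite fC map_polyC /= -polyCB ce deg2C.
  have hx' : ev1 io x f`_0 = a.
    by move/eqP: hx; rewrite hornerD hornerN hornerC subr_eq0 => /eqP.
  have [b xb] : exists b, x = io b.
    apply: (ev1_root (P := lead_coef H) k0cl); first by rewrite lead_coef_eq0.
    rewrite /lead_coef; move: (size H).-1 => i.
    have := congr1 (fun p : {poly {poly K}} => (p`_i).[x]) e.
    have -> : map_poly (map_poly io) f - a%:P%:P = (map_poly io f`_0 - a%:P)%:P.
      by rewrite fC map_polyC polyCB coefC.
    by rewrite coefMC coef_map hornerM hx mulr0.
  by apply: (@not_in_k0 (f`_0).[b]); rewrite -hx' xb ev1E horner_map.
have [x1 hx1] := redx_neq0 k0cl H0.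
have lf0 : lead_coef f * lead_coef H != 0.
  by rewrite mulf_neq0 // lead_coef_eq0 // -size_poly_gt0 ltnW.
have [x0] := nonroot k0cl lf0; rewrite hornerM mulf_eq0 negb_or => /andP[lx Hx].
have sr : (1 < size (map_poly io (redx x0 f)))%N by rewrite size_map_poly size_redx.
have [y /rootP] : exists y, root (map_poly io (redx x0 f) - a%:P) y.
  apply: Kcl; rewrite size_polyDl ?(gtn_eqF sr) // size_polyN.
  exact: leq_ltn_trans (size_polyC_leq1 _) sr.
rewrite hornerD hornerN hornerC => /eqP; rewrite subr_eq0 -ev1E -ev2_redx => /eqP hy.
have [b yb] : exists b, y = io b.
  apply: (ev1_root (P := redx x0 H) k0cl); last by rewrite -ev2_redx zero.
  by rewrite -size_poly_gt0 size_redx // size_poly_gt0.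
by apply: (@not_in_k0 (redx x0 f).[b]); rewrite -hy ev2_redx yb ev1E horner_map.
Qed.

(** A nonzero H in the kernel would make (X, Y) a common zero of two coprime polynomials over K, so
    X, Y and with them [var] would be constant. *)
Lemma generic_fibre_inj H : ev2 rho X Y H = 0 -> H = 0.
Proof.
move=> hH; apply/eqP; apply: contraT => /generic_fibre_ndvd nd.
have [||c [d [Xc Yd]]] := @common_zeros _ Kcl _ cst X Y _ _ Fairr nd.
- by rewrite ev2B ev2CC (@ev2_map _ _ _ io cst rho) // fa subrr.
- by rewrite (@ev2_map _ _ _ io cst rho).
have constE P : ev2 cst X Y P = cst (ev2 idfun c d P).
  by rewrite Xc Yd (ev2_morph (rho' := cst)).
have [P [Q [Q0 e]]] := gen; move: Q0 e => /=; rewrite !constE fmorph_eq0 => Q0 e.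
set c' := ev2 idfun c d Q in Q0 e; pose b := ev2 idfun c d P / c'.
have vb : var = cst b.
  by apply: (mulIf (_ : cst c' != 0)); rewrite ?fmorph_eq0 // e -rmorphM divfK.
have := var_transcendental tofr_inj (p := 'X - b%:P).
rewrite rmorphB /= map_polyX map_polyC hornerXsubC vb subrr.
by move=> /(_ erefl)/eqP; rewrite polyXsubC_eq0.
Qed.

End GenericFibre.

(** * Fibres as affine varieties *)

Section Translation.
Variable K : fieldType.

Definition of_mpoly : {mpoly K[2]} -> {poly {poly K}} :=
  mmap (@pC2 K) (fun i => if i == 0 then 'X%:P else 'X).
HB.instance Definition _ := GRing.RMorphism.on of_mpoly.

Definition to_mpoly : {poly {poly K}} -> {mpoly K[2]} :=
  ev2 (@mpolyC 2 K) 'X_0 'X_1.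

Lemma meval_of_mpoly (f : {mpoly K[2]}) (v : 'I_2 -> K) :
  ev2 idfun (v 0) (v 1) (of_mpoly f) = f.@[v].
Proof.
rewrite mevalE /of_mpoly /mmap rmorph_sum; apply: eq_bigr => m _.
rewrite rmorphM /= ev2CC /mmap1 rmorph_prod; congr (_ * _).
apply: eq_bigr => i _; rewrite rmorphXn /=; congr (_ ^+ _).
case: eqP => [->|]; first by rewrite ev2X.
move=> i0; rewrite ev2Y (_ : i = 1) //; apply/val_inj => /=.
by case: i i0 => [[|[|i]]] // h []; exact: val_inj.
Qed.

Lemma meval_to_mpoly p (v : 'I_2 -> K) :
  (to_mpoly p).@[v] = ev2 idfun (v 0) (v 1) p.
Proof.
rewrite /to_mpoly (ev2_morph (rho' := idfun)) /= ?mevalXU // => c.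
exact: mevalC.
Qed.

Definition zeros (p : {poly {poly K}}) : set 'rV[K]_2 :=
  [set v | ev2 idfun (v 0 0) (v 0 1) p = 0]%classic.

Definition point (x y : K) : 'rV[K]_2 := \row_i (if i == 0 then x else y).

Lemma point0 x y : point x y 0 0 = x. Proof. by rewrite mxE. Qed.
Lemma point1 x y : point x y 0 1 = y. Proof. by rewrite mxE. Qed.

Lemma zerosM p q : zeros (p * q) = (zeros p `|` zeros q)%classic.
Proof.
apply/seteqP; split=> v; rewrite /zeros /= rmorphM /=.
  by move=> /eqP; rewrite mulf_eq0 => /orP[]/eqP; [left|right].
by case=> ->; rewrite ?mulr0 ?mul0r.
Qed.

Lemma closed_zeros p : zariski_closed (zeros p).
Proof.
exists [set to_mpoly p]%classic; apply/seteqP; split=> v /=.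
  by move=> h _ ->; rewrite meval_to_mpoly.
by move=> /(_ _ erefl); rewrite meval_to_mpoly.
Qed.

Lemma not_in_closed (X Z : set 'rV[K]_2) : zariski_closed Z -> ~ (X `<=` Z)%classic ->
  exists p, (Z `<=` zeros p)%classic /\ ~ (X `<=` zeros p)%classic.
Proof.
move=> [S ->] nXZ; apply: contrapT => h; apply: nXZ => v Xv q Sq.
apply: contrapT => qv; apply: h; exists (of_mpoly q).
split=> [w /(_ _ Sq)|/(_ _ Xv)]; first by rewrite /zeros /= meval_of_mpoly.
by rewrite /zeros /= meval_of_mpoly.
Qed.

Lemma fibreE f a : fibre f a = zeros (of_mpoly f - a%:P%:P).
Proof.
by apply/seteqP; split=> v; rewrite /fibre /zeros /= ev2B ev2CC meval_of_mpoly;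
  [move=> ->; rewrite subrr|move/eqP; rewrite subr_eq0 => /eqP].
Qed.

Hypothesis Kcl : alg_closed K.

Lemma zeros_sub (p q : {poly {poly K}}) : irr2 p -> (zeros p `<=` zeros q)%classic -> dvd2 p q.
Proof.
move=> irp pq; apply: nullstellensatz => // x y h.
by have := pq (point x y); rewrite /zeros /= !point0 !point1; apply.
Qed.

Lemma zeros_irreducible p : irr2 p -> zariski_irreducible (zeros p).
Proof.
move=> irp; split.
  have [x [y [h _]]] := zero_avoiding Kcl irp.1 (oner_neq0 _) (oner_neq0 _).
  by exists (point x y); rewrite /zeros /= !point0 !point1.
move=> Z1 Z2 c1 c2 h; apply: contrapT => /not_orP[n1 n2].
have [q1 [s1 m1]] := not_in_closed c1 n1.
have [q2 [s2 m2]] := not_in_closed c2 n2.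
have : dvd2 p (q1 * q2).
  apply: zeros_sub => // v /h; rewrite zerosM.
  by case=> [/s1|/s2]; [left|right].
case/(irr_prime Kcl irp) => -[w e]; [apply: m1|apply: m2]; rewrite e zerosM => v pv; by right.
Qed.

Lemma zeros_component p g : irr2 p -> g != 0 ->
  irreducible_component (zeros (p * g)) (zeros p).
Proof.
move=> irp g0; split.
- by rewrite zerosM => v; left.
- exact: zeros_irreducible.
move=> Y [Y0 irY] pY YX; apply/seteqP; split=> //.
(* p may divide g: as Y is irreducible, it lies in [zeros p] or in [zeros g], and in the second case
   p is split off from g. *)
move: YX; rewrite zerosM; have [n] := ubnP (deg2 g); elim: n g g0 => // n IH g g0 hn YX.
have [//|Yg] := irY _ _ (closed_zeros p) (closed_zeros g) YX.
have [h gE] : dvd2 p g by apply: zeros_sub => // v /pY/Yg.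
have h0 : h != 0 by apply: contraNneq g0 => h0; rewrite gE h0 mul0r.
apply: (IH h) => //.
  rewrite -ltnS; apply: leq_trans hn; rewrite ltnS gE deg2M ?(irr2_neq0 irp) //.
  by rewrite -[X in (X < _)%N]addn0 ltn_add2l lt0n irp.1.
by move=> v /Yg; rewrite gE zerosM => -[]; [right|left].
Qed.

Lemma component_unique H p q : H != 0 -> (exists! Z, irreducible_component (zeros H) Z) ->
  irr2 p -> irr2 q -> dvd2 p H -> dvd2 q H -> dvd2 p q.
Proof.
move=> H0 [Z [_ uZ]] irp irq.
have comp r : irr2 r -> dvd2 r H -> Z = zeros r.
  move=> irr [w e]; apply: uZ; rewrite e mulrC; apply: zeros_component => //.
  by apply: contraNneq H0 => w0; rewrite e w0 mul0r.
move=> /(comp _ irp) pZ /(comp _ irq) qZ.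
by apply: zeros_sub => //; rewrite -pZ -qZ.
Qed.

Lemma prime_power p (H : {poly {poly K}}) : irr2 p -> H != 0 ->
  (forall q, irr2 q -> dvd2 q H -> dvd2 p q) ->
  exists c n, H = c%:P%:P * p ^+ n.
Proof.
move=> irp; have [n] := ubnP (deg2 H); elim: n H => // n IH H hn H0 hH.
have [/deg2_eq0P e|dH] := eqVneq (deg2 H) 0%N.
  by exists H`_0`_0, 0%N; rewrite mulr1.
have [q irq qH] := irr_factor dH.
have [H' e] := dvd2_trans (hH q irq qH) qH.
have H'0 : H' != 0 by apply: contraNneq H0 => h; rewrite e h mul0r.
have [||c [m e']] := IH H' _ H'0.
- rewrite -ltnS; apply: leq_trans hn; rewrite ltnS e deg2M ?(irr2_neq0 irp) //.
  by rewrite -[X in (X < _)%N]addn0 ltn_add2l lt0n irp.1.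
- by move=> r irr rH; apply: hH => //; rewrite e; exact: dvd2_mulr.
by exists c, m.+1; rewrite e e' exprSr mulrA.
Qed.

Lemma avoid_finite (A : set K) (r : {poly K}) : r != 0 -> finite_set A ->
  exists2 b, ~ A b & r.[b] != 0.
Proof.
move=> r0 /finite_seqP[s ->].
have h : \prod_(x <- s) ('X - x%:P) * r != 0.
  by rewrite mulf_neq0 // monic_neq0 // monic_prod_XsubC.
have [b] := nonroot Kcl h; rewrite hornerM mulf_eq0 negb_or => /andP[sb rb].
exists b => //= bs; move: sb; rewrite -[_ == 0]/(root _ b) root_prod_XsubC.
by rewrite bs.
Qed.

(** All fibres of a constant f but one are empty, and the empty set is not irreducible, so
    infinitely many values would be exceptional. *)
Lemma rational_nonconstant f : rational_polynomial f -> deg2 (of_mpoly f) != 0%N.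
Proof.
move=> rf; apply/negP => /eqP/deg2_eq0P fc.
set c := _`_0 in fc.
have X0 : 'X - c%:P != 0 :> {poly K} by rewrite polyXsubC_eq0.
have [b /contrapT] := avoid_finite X0 rf.
move=> [[_ [[v]]]] + _ _; rewrite fibreE /zeros /= fc -!polyCB ev2CC /= hornerXsubC => /eqP.
by rewrite subr_eq0 eq_sym subr_eq0 => ->.
Qed.
Lemma irr2_scale (c : K) p : c != 0 -> irr2 p -> irr2 (c%:P%:P * p).
Proof.
move=> c0 irp; have cc : c%:P%:P != 0 :> {poly {poly K}} by rewrite !polyC_eq0.
split=> [|u v e]; first by rewrite deg2M ?(irr2_neq0 irp) // deg2C irp.1.
have e' : p = (c^-1%:P%:P * u) * v.
  by rewrite -mulrA -e mulrA -!polyCM mulVf // mul1r.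
have [|] := irp.2 _ _ e'; last by right.
have [->|u0] := eqVneq u 0; first by rewrite mulr0; left.
by rewrite deg2M // ?polyC_eq0 ?invr_eq0 // deg2C; left.
Qed.

Hypothesis K0 : [pchar K] =i pred0.

Lemma two_roots (c d : K) n : c != 0 -> d != 0 -> (1 < n)%N -> exists z1 z2 t,
  z1 != z2 /\ c *: 'X^n - d%:P = t * ('X - z1%:P) * ('X - z2%:P).
Proof.
move=> c0 d0 n1; set g := _ - _.
have sX : size (c *: 'X^n) = n.+1 by rewrite size_scale // size_polyXn.
have sg : size g = n.+1.
  by rewrite /g size_polyDl sX // size_polyN (leq_ltn_trans (size_polyC_leq1 _)) // ltnS ltnW.
have g0 : g != 0 by rewrite -size_poly_eq0 sg.
have [|z1 r1] := Kcl (p := g); first by rewrite sg; case: (n) n1.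
have /factor_theorem[g2 gE] := r1.
have s2 : size g2 = n.
  apply: succn_inj; rewrite -sg gE size_Mmonic ?monicXsubC //.
    by rewrite size_XsubC addn2.
  by apply: contraNneq g0 => h; rewrite gE h mul0r.
have [|z2 r2] := Kcl (p := g2); first by rewrite s2; case: (n) n1 => [|[]].
have /factor_theorem[t g2E] := r2.
exists z2, z1, t; split; last by rewrite gE g2E.
apply: contraTneq r1 => e; move: r2; rewrite e => /rootP r2.
have /eqP := congr1 (fun p : {poly K} => p^`().[z1]) gE.
rewrite derivM derivXsubC mulr1 hornerD hornerM hornerXsubC subrr mulr0 add0r.
rewrite [X in _ == X]r2 /g derivB derivZ derivXn derivC subr0 hornerZ hornerMn hornerXn.
rewrite mulf_eq0 (negbTE c0) -mulr_natr mulf_eq0 /=.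
have /pcharf0P -> := K0; rewrite expf_eq0; case: (n) n1 => // m m0 /=.
rewrite orbF => /andP[_ /eqP ->].
by rewrite /root /g !hornerE expr0n /= mulr0 add0r oppr_eq0.
Qed.

(* Uniqueness of the component gives F - a = c p ^ n. If n > 1 then
   F - (a + 1) = c p ^ n - 1 is divisible by coprime polynomials p - z1, p - z2. *)
Lemma irreducible_fibres_prime (F : {poly {poly K}}) : deg2 F != 0%N ->
  (forall a, exists! Z, irreducible_component (zeros (F - a%:P%:P)) Z) ->
  forall a, irr2 (F - a%:P%:P).
Proof.
move=> dF uF a.
have subC0 (p : {poly {poly K}}) c : deg2 p != 0%N -> deg2 (p - c%:P%:P) != 0%N.
  apply: contraNN => /eqP/deg2_eq0P e; have -> : p = (p - c%:P%:P) + c%:P%:P by rewrite subrK.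
  by rewrite e -!polyCD deg2C.
have dFa b := subC0 F b dF; have Fa0 b := deg2_neq0 (dFa b).
have [p irp pF] := irr_factor (dFa a).
have [|c [n e]] := @prime_power p (F - a%:P%:P) irp (Fa0 a).
  by move=> q irq qF; exact: (component_unique (Fa0 a) (uF a) irp irq pF qF).
have c0 : c != 0 by apply: contraNneq (Fa0 a) => h; rewrite e h !polyC0 mul0r.
have [n2|] := ltnP 1 n; last first.
  case: n e => [|[|//]] e _; last by rewrite e expr1; exact: irr2_scale.
  by have := dFa a; rewrite e expr0 mulr1 deg2C.
have [z1 [z2 [t [z12 tE]]]] := two_roots c0 (oner_neq0 _) n2.
have e' : F - (a + 1)%:P%:P = comp1 p t * (p - z1%:P%:P) * (p - z2%:P%:P).
  rewrite -(comp1lin p z1) -(comp1lin p z2) -!comp1M -tE.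
  rewrite comp1D -(polyCN (1 : K)) comp1C -mul_polyC comp1M comp1C.
  by rewrite !polyCD opprD addrA e /comp1 map_polyXn hornerXn !polyCN.
have [q1 ir1 q1p] := irr_factor (subC0 p z1 irp.1).
have [q2 ir2 q2p] := irr_factor (subC0 p z2 irp.1).
have q12 : dvd2 q1 q2.
  apply: (component_unique (Fa0 (a + 1)) (uF _)) => //; rewrite e'.
    exact/dvd2_mulr/dvd2_mull.
  exact/dvd2_mull.
have := dvd2B q1p (dvd2_trans q12 q2p).
rewrite opprB addrC addrA subrK -!polyCB => /irr_ndvd_const -/(_ ir1) [].
by rewrite subr_eq0 eq_sym.
Qed.
End Translation.

(** * Parametrization of a rational fibre *)

Section Parametrization.
Variable K : fieldType.
Hypothesis Kcl : alg_closed K.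

Definition of_mpoly1 : {mpoly K[1]} -> {poly K} := mmap polyC (fun=> 'X).

Lemma meval_of_mpoly1 (f : {mpoly K[1]}) (v : 'I_1 -> K) : (of_mpoly1 f).[v 0] = f.@[v].
Proof.
rewrite mevalE /of_mpoly1 /mmap horner_sum; apply: eq_bigr => m _.
by rewrite /mmap1 !big_ord1 hornerM hornerC hornerXn.
Qed.

(** Only the regular expressions at one point v0 and at its image are kept. E is the product of a
    polynomial D, nonzero only inside V, with the denominators of the two coordinates; p / q is the
    first local expression of the inverse map. *)
Lemma rational_curve_param F a : rational_curve (fibre F a) ->
  exists (P Q : 'I_2 -> {poly K}) (E : {poly K}) (p q : {poly {poly K}}) (s0 : K),
    [/\ E.[s0] != 0, ev2 idfun ((P 0).[s0] / (Q 0).[s0]) ((P 1).[s0] / (Q 1).[s0]) q != 0 &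
    forall s, E.[s] != 0 -> let x := (P 0).[s] / (Q 0).[s] in let y := (P 1).[s] / (Q 1).[s] in
      [/\ (Q 0).[s] != 0, (Q 1).[s] != 0, ev2 idfun x y (of_mpoly F) = a &
        ev2 idfun x y q != 0 -> s * ev2 idfun x y q = ev2 idfun x y p]].
Proof.
move=> [_ [U [V [phi [psi [[[ZU _ UE] _] [[ZV [SV ZVE] VE] [v0 Vv0]] [rphi rpsi] hU hV]]]]]].
have [D SD Dv0] : exists2 D, SV D & D.@[v0 0] != 0.
  apply: contrapT => h; move: Vv0; rewrite VE => -[_]; rewrite ZVE; apply=> D SD.
  by apply/eqP; apply: contraT => D0; case: h; exists D.
have VD (v : 'rV[K]_1) : D.@[v 0] != 0 -> V v.
  move=> Dv; rewrite VE; split=> //; rewrite ZVE => /(_ D SD) e.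
  by rewrite e eqxx in Dv.
have /choice[PQ hPQ] : forall j, exists pq : {mpoly K[1]} * {mpoly K[1]}, pq.2.@[v0 0] != 0 /\
    forall v, V v -> pq.2.@[v 0] != 0 -> psi v 0 j = pq.1.@[v 0] / pq.2.@[v 0].
  by move=> j; have [p [q h]] := rpsi j _ Vv0; exists (p, q).
have [p [q [q0 hpq]]] := rphi 0 _ (hV _ Vv0).1.
pose P j := of_mpoly1 (PQ j).1; pose Q j := of_mpoly1 (PQ j).2.
have hv (v : 'rV[K]_1) : v = const_mx (v 0 0).
  by apply/rowP => i; rewrite mxE ord1.
have ev (g : {mpoly K[1]}) s : (of_mpoly1 g).[s] = g.@[(const_mx s : 'rV_1) 0].
  by rewrite -meval_of_mpoly1 mxE.
pose s0 := v0 0 0; have v0E : v0 = const_mx s0 := hv v0.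
have psiE s : (of_mpoly1 D).[s] != 0 -> (Q 0).[s] != 0 -> (Q 1).[s] != 0 ->
   forall g : {mpoly K[2]}, ev2 idfun ((P 0).[s] / (Q 0).[s]) ((P 1).[s] / (Q 1).[s]) (of_mpoly g) =
     g.@[psi (const_mx s) 0].
  move=> Ds Q0 Q1 g; have Vs : V (const_mx s) by apply: VD; rewrite -ev.
  have PQE j : (Q j).[s] != 0 -> (P j).[s] / (Q j).[s] = psi (const_mx s) 0 j.
    by rewrite /P /Q !ev => Qs; rewrite (hPQ j).2.
  by rewrite !PQE // meval_of_mpoly.
exists P, Q, (of_mpoly1 D * Q 0 * Q 1), (of_mpoly p), (of_mpoly q), s0.
have ok0 : [/\ (of_mpoly1 D).[s0] != 0, (Q 0).[s0] != 0 & (Q 1).[s0] != 0].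
  by rewrite !ev -!v0E; split=> //; exact: (hPQ _).1.
split.
- by case: ok0 => D0 Q0 Q1; rewrite !hornerM !mulf_neq0.
- by case: ok0 => D0 Q0 Q1; rewrite psiE // -v0E.
move=> s; rewrite !hornerM !mulf_eq0 !negb_or -andbA => /and3P[Ds Q0 Q1].
rewrite /= !psiE //.
have Vs : V (const_mx s) by apply: VD; rewrite -ev.
have [Us ps] := hV _ Vs; split=> //.
- by move: Us; rewrite UE => -[].
- move=> qs; have := hpq _ Us qs; rewrite ps mxE => e.
  by rewrite [X in X * _]e divfK.
Qed.

Variables (N : fieldType) (tofr : {rmorphism {poly K} -> N}).
Hypothesis tofr_inj : injective tofr.
Local Notation cst := (@cst K N tofr).
Local Notation var := (@var K N tofr).

Lemma ev2_specialize (P0 Q0 P1 Q1 : {poly K}) (G : {poly {poly K}}) : Q0 != 0 -> Q1 != 0 ->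
  exists n A, ev2 cst (tofr P0 / tofr Q0) (tofr P1 / tofr Q1) G * tofr (Q0 * Q1) ^+ n = tofr A /\
    forall s, Q0.[s] != 0 -> Q1.[s] != 0 ->
      ev2 idfun (P0.[s] / Q0.[s]) (P1.[s] / Q1.[s]) G * (Q0 * Q1).[s] ^+ n = A.[s].
Proof.
rewrite -(tofr_eq0 tofr_inj Q0) -(tofr_eq0 tofr_inj Q1) => q0 q1.
elim/poly2_ind: G => [c|||p q [n [A [e h]]] [m [B [e' h']]]|p q [n [A [e h]]] [m [B [e' h']]]].
- by exists 0%N, c%:P; split=> [|s _ _]; rewrite ev2CC mulr1 ?hornerC.
- exists 1%N, (P0 * Q1); split=> [|s a b]; rewrite ev2X expr1.
    by rewrite !rmorphM mulrA divfK.
  by rewrite !hornerM mulrA divfK.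
- exists 1%N, (P1 * Q0); split=> [|s a b]; rewrite ev2Y expr1.
    by rewrite !rmorphM [tofr Q0 * _]mulrC mulrA divfK.
  by rewrite !hornerM [Q0.[s] * _]mulrC mulrA divfK.
- exists (n + m)%N, (A * (Q0 * Q1) ^+ m + B * (Q0 * Q1) ^+ n); split=> [|s a b].
    rewrite !rmorphD !(rmorphM tofr A) !(rmorphM tofr B) /= !rmorphXn /= -e -e' exprD; ring.
  by rewrite rmorphD /= hornerD !(hornerM A) !(hornerM B) !horner_exp -h // -h' // exprD; ring.
- exists (n + m)%N, (A * B); split=> [|s a b].
    by rewrite !rmorphM /= -e -e' exprD !rmorphM /=; ring.
  by rewrite rmorphM /= (hornerM A) -h // -h' // exprD; ring.
Qed.

(** The identities known at points hold off the zeros of E. Cleared of denominators they are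
    polynomial identities, which then hold in K[s] and can be read in N. *)
Theorem rational_param F a : rational_curve (fibre F a) -> exists X Y,
  ev2 cst X Y (of_mpoly F) = cst a /\ ratio2 cst X Y var.
Proof.
move=> /rational_curve_param[P [Q [E [p [q [s0 [Es0 qs0 h]]]]]]].
have E0 : E != 0 by apply: contraNneq Es0 => ->; rewrite horner0.
have [Q00 Q10 _ _] := h s0 Es0.
have Q0n : Q 0 != 0 by apply: contraNneq Q00 => ->; rewrite horner0.
have Q1n : Q 1 != 0 by apply: contraNneq Q10 => ->; rewrite horner0.
have QQ n : tofr (Q 0 * Q 1) ^+ n != 0 by rewrite expf_neq0 // tofr_eq0 // mulf_neq0.
have zero A : (forall s, E.[s] != 0 -> A.[s] = 0) -> A = 0.
  move=> hA; apply/eqP; apply: contraT => A0.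
  have [s] := nonroot Kcl (mulf_neq0 E0 A0).
  rewrite hornerM mulf_eq0 negb_or => /andP[/hA ->]; by rewrite eqxx.
exists (tofr (P 0) / tofr (Q 0)), (tofr (P 1) / tofr (Q 1)); split.
  apply/eqP; rewrite -subr_eq0 -(ev2CC cst (tofr (P 0) / tofr (Q 0)) (tofr (P 1) / tofr (Q 1)) a) -ev2B.
  have [n [A [e hA]]] := ev2_specialize (P 0) (P 1) (of_mpoly F - a%:P%:P) Q0n Q1n.
  rewrite -(mulIr_eq0 _ (mulIf (QQ n))) e (zero A) ?rmorph0 // => s Es.
  have [u v w _] := h s Es.
  by rewrite -hA // ev2B ev2CC w subrr mul0r.
have [n [A [e hA]]] := ev2_specialize (P 0) (P 1) q Q0n Q1n.
have [m [B [e' hB]]] := ev2_specialize (P 0) (P 1) p Q0n Q1n.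
exists p, q; split.
  rewrite /= -(mulIr_eq0 _ (mulIf (QQ n))) e tofr_eq0 //.
  apply: contraNneq qs0 => A0; have := hA s0 Q00 Q10; rewrite A0 horner0 => /eqP.
  by rewrite mulf_eq0 expf_eq0 hornerM mulf_eq0 (negbTE Q00) (negbTE Q10) andbF orbF.
have A0 : A != 0.
  apply: contraNneq qs0 => A0; have := hA s0 Q00 Q10; rewrite A0 horner0 => /eqP.
  by rewrite mulf_eq0 expf_eq0 hornerM mulf_eq0 (negbTE Q00) (negbTE Q10) andbF orbF.
have key : 'X * A * (Q 0 * Q 1) ^+ m = B * (Q 0 * Q 1) ^+ n.
  (* The inverse formula is known only where q is nonzero at the point; the extra factor A, a
     numerator of q(X, Y), makes the identity trivial elsewhere. *)
  apply: (mulIf A0); apply/eqP; rewrite -subr_eq0; apply/eqP/zero => s Es.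
  have [u v _ w] := h s Es; rewrite hornerD hornerN !(hornerM _ A).
  have [-> | As] := eqVneq A.[s] 0; first by rewrite !mulr0 subrr.
  apply/eqP; rewrite subr_eq0 (hornerM _ (_ ^+ m)) (hornerM 'X A) (hornerM B).
  rewrite !horner_exp hornerX -(hA s u v) -(hB s u v) -w.
    by apply/eqP; ring.
  by apply: contraNneq As => qs; rewrite -(hA s u v) qs mul0r.
apply: (mulIf (QQ (n + m)%N)).
have := congr1 tofr key; rewrite !rmorphM !rmorphXn /= -e -e' -/var rmorphM /= => k.
by rewrite exprD mulrA -[var * _ * _]mulrA k -mulrA [_ ^+ m * _]mulrC.
Qed.
End Parametrization.

(** * A transcendental value and a maximal field of definition *)

Section Uncountable.
Variables (R : realType) (g : nat -> R).

(** Cantor's nested closed intervals. On the right only the last quarter is kept, since g n may be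
    the midpoint itself. *)
Definition halve (n : nat) (I : R * R) : R * R :=
  let m := (I.1 + I.2) / 2%:R in
  if g n <= m then ((m + I.2) / 2%:R, I.2) else (I.1, m).

Fixpoint nested n : R * R := if n is m.+1 then halve m (nested m) else (0, 1).

Lemma halve_prop n I : I.1 < I.2 ->
  [/\ I.1 <= (halve n I).1, (halve n I).1 < (halve n I).2, (halve n I).2 <= I.2 &
   forall x, (halve n I).1 <= x -> x <= (halve n I).2 -> x <> g n].
Proof.
case: I => a b /= ab; rewrite /halve /=; case: (lerP (g n) ((a + b) / 2)) => /= h.
  have am : (a + b) / 2 < ((a + b) / 2 + b) / 2 by lra.
  by split; try lra; move=> x x1 x2 xg; lra.
by split; try lra; move=> x x1 x2 xg; lra.
Qed.

Lemma nested_lt n : (nested n).1 < (nested n).2.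
Proof. by elim: n => [|n IH] /=; [exact: ltr01|case: (halve_prop n IH)]. Qed.

Lemma nested_le m n : (m <= n)%N ->
  (nested m).1 <= (nested n).1 /\ (nested n).2 <= (nested m).2.
Proof.
elim: n => [|n IH]; first by rewrite leqn0 => /eqP ->.
rewrite leq_eqVlt => /orP[/eqP -> //|]; rewrite ltnS => /IH[h1 h2] /=.
have [k1 _ k2 _] := halve_prop n (nested_lt n).
by split; [exact: le_trans h1 k1|exact: le_trans k2 h2].
Qed.

Lemma real_uncountable : exists x, forall n, x <> g n.
Proof.
pose E := [set x | exists n, x = (nested n).1]%classic.
have ubE n : ubound E (nested n).2.
  move=> _ [m ->]; have [mn|/ltnW nm] := leqP m n.
    by apply: le_trans (nested_le mn).1 _; apply/ltW/nested_lt.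
  by apply: le_trans (nested_le nm).2; apply/ltW/nested_lt.
have supE : has_sup E by split; [exists (nested 0).1, 0%N|exists (nested 0).2].
exists (sup E) => n; have [_ _ _] := halve_prop n (nested_lt n); apply.
- by apply: sup_upper_bound => //; exists n.+1.
- by apply: ge_sup; [exact: supE.1|exact: (ubE n.+1)].
Qed.
End Uncountable.

Section GenericValue.
Variable K : fieldType.

Definition ratio_subfield (T : comNzRingType) (e : {rmorphism T -> K}) : subfield K.
Proof.
exists (ratio_of e); first exact: ratio_of1.
- by move=> x y hx hy; apply: ratio_ofD => //; exact: ratio_ofN.
- by move=> x y; exact: ratio_of_inv.
Defined.

Lemma clear_denominators (T : comNzRingType) (e : {rmorphism T -> K}) (p : {poly K}) :
  (forall i, ratio_of e p`_i) -> exists (P : {poly T}) d, e d != 0 /\ map_poly e P = e d *: p.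
Proof.
elim/poly_ind: p => [|p c IH] h.
  by exists 0, 1; rewrite !rmorph0 scaler0 rmorph1 oner_neq0.
have [|P [d [d0 hP]]] := IH.
  by move=> i; have := h i.+1; rewrite coefD coefMX coefC addr0.
have := h 0%N; rewrite coefD coefMX coefC add0r => -[al [be [b0 hc]]].
exists (be *: P * 'X + (d * al)%:P), (be * d); rewrite rmorphM mulf_neq0 //; split=> //.
rewrite rmorphD rmorphM /= map_polyZ map_polyX map_polyC /= hP rmorphM -hc.
rewrite scalerDr -!mul_polyC !polyCM; ring.
Qed.

(** T is an iterated polynomial ring over the integers, one variable for each element of cs; it is
    countable by construction. *)
Lemma countable_subring (cs : seq K) : exists (T : countComNzRingType) (e : {rmorphism T -> K}),
  forall c, c \in cs -> exists t, e t = c.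
Proof.
elim: cs => [|c cs [T [e h]]]; first by exists int, intr.
exists {poly T}, (ev1 e c) => d; rewrite inE => /orP[/eqP ->|/h[t <-]].
  by exists 'X; exact: ev1X.
by exists t%:P; exact: ev1C.
Qed.

Definition transcendental (S : subfield K) a :=
  forall p : {poly K}, (forall i, S p`_i) -> root p a -> p = 0.

Hypothesis Kcl : alg_closed K.
Hypothesis Kunc : forall g : nat -> K, exists x, forall n, x <> g n.

(** The roots of the nonzero polynomials with coefficients in a countable ring, together with s,
    form a countable set; g lists it by pairs of a polynomial and an index. *)
Lemma exists_transcendental (cs s : seq K) : exists (S : subfield K) a,
  [/\ a \notin s, forall c, c \in cs -> S c & transcendental S a].
Proof.
have [T [e h]] := countable_subring cs.
have /choice[rs hrs] : forall P : {poly T}, exists rs : seq K,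
    map_poly e P != 0 -> forall a, root (map_poly e P) a -> a \in rs.
  move=> P; have [->|P0] := eqVneq (map_poly e P) 0; first by exists [::].
  have [c [rs [c0 ->]]] := split_poly Kcl P0; exists rs => _ a.
  by rewrite rootZ // root_prod_XsubC.
pose g n : K := if unpickle n is Some (P, i) then nth 0 (rs P ++ s) i else 0.
have [a ha] := Kunc g.
have mem P c : c \in rs P ++ s -> a <> c.
  by move=> hc; have := ha (pickle (P, index c (rs P ++ s))); rewrite /g pickleK nth_index.
exists (ratio_subfield e), a; split.
- by apply/negP => sa; apply: (mem 0 a) => //; rewrite mem_cat sa orbT.
- by move=> c /h[t <-]; exact: ratio_of_val.
move=> p /clear_denominators[P [d [d0 hP]]] pa; apply/eqP; apply: contraT => p0.
case: (mem P a) => //; rewrite mem_cat (hrs P) // hP ?rootZ //.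
by rewrite scale_poly_eq0 negb_or d0.
Qed.

(** Zorn's lemma. A polynomial over the union of a chain has finitely many coefficients, so they lie
    in one member, over which a is transcendental. *)
Lemma maximal_transcendental (cs : seq K) (S0 : subfield K) a :
  (forall c, c \in cs -> S0 c) -> transcendental S0 a ->
  exists S : subfield K, [/\ forall c, c \in cs -> S c, transcendental S a &
    forall S' : subfield K, (forall x, S x -> S' x) -> transcendental S' a ->
      forall x, S' x -> S x].
Proof.
move=> c0 t0; pose T := {S : subfield K | (forall c, c \in cs -> S c) /\ transcendental S a}.
pose le (S1 S2 : T) := `[< forall x, sval S1 x -> sval S2 x >].
have [||A tot|[S [Sc St]] Smax] := @ZL_preorder T (exist _ S0 (conj c0 t0)) le.
- by move=> S; apply/asboolP.
- by move=> S2 S1 S3 /asboolP h /asboolP h'; apply/asboolP => x /h/h'.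
- have [[S1 AS1]|nA] := pselect (exists S1, A S1); last first.
    by exists (exist _ S0 (conj c0 t0)) => S AS; case: nA; exists S.
  pose U x := exists2 S, A S & sval S x.
  have join S S' : A S -> A S' -> exists2 S'', A S'' &
      (forall x, sval S x -> sval S'' x) /\ (forall x, sval S' x -> sval S'' x).
    by move=> AS AS'; case: (tot _ _ AS AS') => /asboolP h; [exists S'|exists S].
  have U1 : U 1 by exists S1 => //; exact: carrier1.
  have UB x y : U x -> U y -> U (x - y).
    move=> [S AS Sx] [S' AS' Sy]; have [S'' AS'' [h h']] := join S S' AS AS'.
    by exists S'' => //; apply: carrierB; [exact: h|exact: h'].
  have Ud x y : U x -> U y -> U (x / y).
    move=> [S AS Sx] [S' AS' Sy]; have [S'' AS'' [h h']] := join S S' AS AS'.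
    by exists S'' => //; apply: carrier_div; [exact: h|exact: h'].
  have tU : transcendental (Subfield U1 UB Ud) a.
    move=> p /= pU pa.
    have [S AS pS] : exists2 S, A S & forall x, x \in (p : seq K) -> sval S x.
      have : forall x, x \in (p : seq K) -> U x by move=> x /(nthP 0)[i _ <-].
      elim: (p : seq K) => [|x s IH] hs; first by exists S1.
      have [|S AS hS] := IH; first by move=> y ys; apply: hs; rewrite inE ys orbT.
      have [S' AS' Sx] := hs x (mem_head _ _).
      have [S'' AS'' [h h']] := join S S' AS AS'; exists S'' => // y.
      by rewrite inE => /orP[/eqP->|/hS/h]; [exact: h'|].
    apply: ((svalP S).2) pa => i; have [ip|ip] := ltnP i (size p).
      by apply/pS/mem_nth.
    by rewrite nth_default // -(subrr 1); apply: carrierB; exact: carrier1.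
  have cU c : c \in cs -> U c by move=> hc; exists S1 => //; exact: (svalP S1).1.
  exists (exist _ (Subfield U1 UB Ud) (conj cU tU)) => S AS; apply/asboolP => x Sx.
  by exists S.
exists S; split=> // S' SS' tS'; apply/asboolP.
have cS' c : c \in cs -> S' c by move=> /Sc/SS'.
by apply: (Smax (exist _ S' (conj cS' tS'))); apply/asboolP.
Qed.

(* If S is maximal such that a is transcendental over S, then adjoining any c
   outside S makes a algebraic; hence c is algebraic over S(a), but not over S. *)
Theorem generic_value (cs s : seq K) : exists (S : subfield K) a,
  let io := @sf_val K S in
  [/\ a \notin s, forall c, c \in cs -> S c, alg_closed (sf_type S),
    forall p : {poly sf_type S}, ev1 io a p = 0 -> p = 0 &
    forall c : K, exists2 P : {poly {poly sf_type S}}, P != 0 & ev2 io a c P = 0].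
Proof.
have [S0 [a [sa c0 t0]]] := exists_transcendental cs s.
have [S [Sc St Smax]] := maximal_transcendental c0 t0; exists S, a => io.
have tra (p : {poly sf_type S}) : ev1 io a p = 0 -> p = 0.
  move=> /rootP pa; apply/eqP; rewrite -(map_poly_eq0 io); apply/eqP/St => //.
  by move=> i; rewrite coef_map; exact: sf_valP.
have algebraic c : ~ S c -> exists P : {poly {poly sf_type S}},
    map_poly (ev1 io c) P != 0 /\ root (map_poly (ev1 io c) P) a.
  move=> nSc; apply: contrapT => nP; apply: nSc.
  apply: (Smax (ratio_subfield (ev1 io c))).
  - by move=> _ /sf_lift[x <-]; rewrite -[sf_val x](ev1C io c); exact: ratio_of_val.
  - move=> p /clear_denominators[P [d [d0 hP]]] pa; apply/eqP; apply: contraT => p0.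
    by case: nP; exists P; rewrite hP scale_poly_eq0 negb_or d0 p0 rootZ.
  - by have := ratio_of_val (ev1 io c) 'X; rewrite /= ev1X.
exists => //.
- move=> p sp; have [->|p0] := eqVneq p 0; first by exists 0; exact: root0.
  have [|c pc] := Kcl (p := map_poly io p); first by rewrite size_map_poly.
  have [/sf_lift[b bc]|/algebraic[P [P0 Pa]]] := pselect (S c).
    by exists b; move: pc; rewrite -bc (fmorph_root io).
  (* The root c is algebraic over S; if it were outside S, a would be algebraic over S(c), hence
     over S. *)
  have [||q q0 qa] := @algebraic_root_polyXY _ _ io c a.
  - by exists (swapXY P); rewrite /= -swapXY_map horner_polyC swapXYK;
      rewrite (_ : map_poly _ _ = map_poly (ev1 io c) P) // -map_poly_comp; apply: eq_map_poly.
  - by exists p.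
  - by have := tra q (rootP qa) => /eqP; rewrite (negbTE q0).
- move=> c; have [/sf_lift[b bc]|/algebraic[P [P0 Pa]]] := pselect (S c).
    exists ('X - b%:P%:P); first by rewrite polyXsubC_eq0.
    by rewrite ev2B ev2Y ev2CC -bc subrr.
  exists (swapXY P); first by rewrite swapXY_eq0; apply: contraNneq P0 => ->; rewrite rmorph0.
  rewrite ev2_swap -[RHS](rootP Pa) /ev2 /=; congr (_.[_]).
Qed.
End GenericValue.

(** * Conclusion *)

Lemma lift_poly (A B : nzRingType) (e : {rmorphism A -> B}) (p : {poly B}) :
  (forall i, exists t, e t = p`_i) -> exists P, map_poly e P = p.
Proof.
move=> /choice[t ht]; exists (\poly_(i < size p) t i); apply/polyP => i.
rewrite coef_map coef_poly; case: ltnP => [_|h]; first exact: ht.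
rewrite [RHS]nth_default //; exact: rmorph0.
Qed.

Section Descent.
Variables (k0 K : fieldType) (io : {rmorphism k0 -> K}).
Local Notation up := (map_poly (map_poly io)).

Lemma deg2_map (p : {poly {poly k0}}) : deg2 (up p) = deg2 p.
Proof.
have inj : injective (map_poly io) := map_poly_inj io.
by rewrite /deg2 swapXY_map !size_map_inj_poly // rmorph0.
Qed.

Lemma irr2_map (p : {poly {poly k0}}) : irr2 (up p) -> irr2 p.
Proof.
move=> [dp hp]; split=> [|a b e]; first by rewrite -deg2_map.
by rewrite -(deg2_map a) -(deg2_map b); apply: hp; rewrite e rmorphM.
Qed.

Variables (f : {mpoly K[2]}) (F u : {poly {poly k0}}).
Hypothesis upF : up F = of_mpoly f.
Hypothesis u_inj : forall G, subst2 F u G = 0 -> G = 0.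
Hypothesis u_gen : forall h, exists G, h = subst2 F u G.

(** Writing x = A(F, u) and y = B(F, u) gives one composite of the automorphism with its inverse;
    the other follows by injectivity of the substitution. The identities are then read at points of
    K. *)
Lemma coordinate_descent : coordinate f.
Proof.
have [A hA] := u_gen 'X%:P; have [B hB] := u_gen 'X.
have inj p q : subst2 F u p = subst2 F u q -> p = q.
  move=> e; apply/eqP; rewrite -subr_eq0; apply/eqP/u_inj.
  by rewrite /subst2 ev2B -!/(subst2 _ _ _) e subrr.
have subst_subst p : subst2 F u (subst2 A B p) = p.
  by rewrite subst2_subst2 -hA -hB subst2_id.
have FAB : subst2 A B F = 'X%:P by apply: inj; rewrite subst_subst /subst2 ev2X.
have uAB : subst2 A B u = 'X by apply: inj; rewrite subst_subst /subst2 ev2Y.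
have evm p (v : 'I_2 -> K) : (to_mpoly (up p)).@[v] = ev2 io (v 0) (v 1) p.
  by rewrite meval_to_mpoly (ev2_map (rho' := io)).
have evf (v : 'I_2 -> K) : f.@[v] = ev2 io (v 0) (v 1) F.
  by rewrite -meval_of_mpoly -upF (ev2_map (rho' := io)).
exists (to_mpoly (up u)), (fun i => if i == 0 then to_mpoly (up A) else to_mpoly (up B)).
have rowE (v w : 'rV[K]_2) : v 0 0 = w 0 0 -> v 0 1 = w 0 1 -> v = w.
  move=> h0 h1; apply/rowP => i; have [->//|i0] := eqVneq i 0.
  rewrite (_ : i = 1) //; apply/val_inj => /=.
  by case: i i0 => [[|[|i]]].
split=> v; apply: rowE; rewrite /polynomial_map !mxE /=.
- by rewrite evm !mxE /= evm evf -ev2_subst2 -hA ev2X.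
- by rewrite evm !mxE /= evm evf -ev2_subst2 -hB ev2Y.
- by rewrite evf !mxE /= !evm -ev2_subst2 FAB ev2X.
- by rewrite evm !mxE /= !evm -ev2_subst2 uAB ev2Y.
Qed.
End Descent.

Section Main.
Variables (K : fieldType).
Hypothesis Kcl : alg_closed K.
Hypothesis K0 : [pchar K] =i pred0.
Hypothesis Kunc : forall g : nat -> K, exists x, forall n, x <> g n.
Variables (N : fieldType) (tofr : {rmorphism {poly K} -> N}).
Hypothesis tofr_inj : injective tofr.
Hypothesis tofr_frac : forall n, exists p q, q != 0 /\ n * tofr q = tofr p.

Lemma rational_irreducible_coordinate (f : {mpoly K[2]}) :
  rational_polynomial f -> (forall a, irreducible_fibre f a) -> coordinate f.
Proof.
move=> rf irf; pose F := of_mpoly f.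
have Firr : forall a, irr2 (F - a%:P%:P).
  apply: irreducible_fibres_prime => //; first exact: rational_nonconstant.
  by move=> a; rewrite -fibreE; exact: irf.
have /finite_seqP[s sE] := rf.
have [S [a [sa Sc Scl tra alga]]] :=
  generic_value Kcl Kunc (flatten [seq polyseq q | q <- polyseq F]) s.
have coefS i j : S F`_i`_j.
  have S0 : S 0 by rewrite -(subrr 1); apply: carrierB; exact: carrier1.
  have [iF|iF] := ltnP i (size F); last by rewrite (nth_default 0 iF) coef0.
  have [jF|jF] := ltnP j (size F`_i); last by rewrite (nth_default 0 jF).
  apply/Sc/flattenP; exists (polyseq F`_i); last exact/mem_nth.
  exact: (map_f (@polyseq K) (mem_nth 0 iF)).
have [F0 F0E] : exists F0, map_poly (map_poly (@sf_val K S)) F0 = F.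
  by apply: lift_poly => i; apply: lift_poly => j; apply: sf_lift.
have rfa : rational_curve (fibre f a).
  apply: contrapT => h; have : [set a | ~ rational_curve (fibre f a)]%classic a by [].
  by rewrite sE /= (negbTE sa).
have [X [Y [fa gen]]] := rational_param Kcl tofr_inj rfa.
have fa0 : ev2 (@cst K N tofr \o @sf_val K S) X Y F0 = @cst K N tofr a.
  by rewrite -fa -[of_mpoly f]F0E; apply/esym/ev2_map.
have F0irr b : irr2 (F0 - b%:P%:P).
  apply: (@irr2_map _ _ (@sf_val K S)).
  by rewrite rmorphB /= F0E !map_polyC /= map_polyC.
have Fairr : irr2 (map_poly (map_poly (@sf_val K S)) F0 - a%:P%:P) by rewrite F0E.
have Psi_inj := generic_fibre_inj Scl Kcl tra Fairr tofr_inj fa0 gen.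
have [u [u_inj u_gen]] := coordinate_of_rational_fibre Scl Kcl K0 F0irr tra alga
  tofr_inj tofr_frac fa0 gen Psi_inj.
exact: (coordinate_descent F0E u_inj u_gen).
Qed.
End Main.

Theorem theorem2 (R : realType) (f : {mpoly (complex R)[2]}) :
  rational_polynomial f ->
  (forall a : complex R, irreducible_fibre f a) ->
  coordinate f.
Proof.
apply: (@rational_irreducible_coordinate _ _ _ _ {fraction {poly complex R}} (@tofrac _)).
- by move=> p sp; apply/closed_rootP.
- exact: Num.Theory.pchar_num.
(* A real number different from all real parts of the sequence is not in the sequence. *)
- move=> g; have [x hx] := real_uncountable (fun n => complex.Re (g n)).
  by exists x%:C%C => n e; apply: (hx n); rewrite -e.
- exact: tofrac_inj.
- exact: fraction_of.
Qed.
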